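(* Let $S$ be the unilateral shift on $H^2$, $(Sf)(z)=zf(z)$. Then for any outer function $a\in H^{\infty}$ one has $S\mathscr{M}(\overline{a})\subseteq\mathscr{M}(\overline{a})$, and the operator norm of $S_{\overline{a}}:=S|_{\mathscr{M}(\overline{a})}$ on $(\mathscr{M}(\overline a),\|\cdot\|_{\overline a})$ is equal to $$\frac{1}{|a(0)|}\left(\int_{0}^{2\pi}|a(e^{i\theta})|^2\,\frac{d\theta}{2\pi}\right)^{1/2}.$$
   Context: Let $\mathbb{D}=\{|z|<1\}$, $\mathbb{T}=\partial\mathbb{D}$, $H^2$ the Hardy space of $\mathbb{D}$ (identified with a closed subspace of $L^2=L^2(\mathbb{T},d\theta/2\pi)$ via radial boundary values), and $H^\infty$ the bounded analytic functions on $\mathbb{D}$. For $a\in H^\infty$, the co-analytic Toeplitz operator $T_{\overline a}:H^2\to H^2$ is $T_{\overline a}f=P_+(\overline a f)$, where $P_+$ is the orthogonal projection of $L^2$ onto $H^2$. The range space is $\mathscr{M}(\overline a):=T_{\overline a}H^2$. When $a$ is outer, $T_{\overline a}$ is injective and $\mathscr{M}(\overline a)$ is a Hilbert space with the range norm $\|T_{\overline a}f\|_{\overline a}:=\|f\|_{H^2}$, $f\in H^2$. *)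

(* Defs.v *)
From HB Require Import structures.
From mathcomp Require Import all_boot all_order all_algebra.
From mathcomp Require Import all_classical all_reals all_analysis.
From mathcomp.real_closed Require Import complex.

Set Implicit Arguments.
Unset Strict Implicit.
Unset Printing Implicit Defensive.

Import Order.TTheory GRing.Theory Num.Theory.
Import numFieldNormedType.Exports.

Local Open Scope classical_set_scope.
Local Open Scope complex_scope.
Local Open Scope ring_scope.

(* The complex numbers are [R[i]]; [R[i]^o] selects the topology that it carries
   as a numFieldType.  [Normc.normc] is the modulus with values in [R].
   A function on the circle is given by its dependence on the angle t, that is,
   as a function on [0, 2 pi]. *)
Section HardySpace.
Variable R : realType.
Local Notation C := R[i].
Local Notation modc := (@Normc.normc R).

Definition expi (t : R) : C := cos t +i* sin t.

Definition expc (z : C) : C := (expR (complex.Re z))%:C * expi (complex.Im z).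

Definition circle_mean (u : R -> R) : R :=
  (pi *+ 2)^-1 * Rintegral lebesgue_measure `[0, pi *+ 2] u.

Definition circle_meanC (u : R -> C) : C :=
  circle_mean (fun t => complex.Re (u t))
  +i* circle_mean (fun t => complex.Im (u t)).

Definition inner (u v : R -> C) : C := circle_meanC (fun t => u t * (v t)^*).

Definition normL2 (u : R -> C) : R :=
  Num.sqrt (circle_mean (fun t => modc (u t) ^+ 2)).

Definition in_disk (z : C) : Prop := modc z < 1.

Definition analytic_disk (f : C -> C) : Prop :=
  exists c : nat -> C, forall z, in_disk z ->
    (fun n => (\sum_(0 <= k < n) c k * z ^+ k : C^o)) @ \oo --> (f z : C^o).

(* Radial boundary values: limit of f (r e^{it}) as r increases to 1. *)
Definition bv (f : C -> C) (t : R) : C :=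
  lim ((fun r : R => (f (r%:C * expi t) : C^o)) @ 1^'-).

(* A function on the disk is extended by 0 to the whole of [C], so that two
   elements of [H2] are equal in Rocq iff they agree on the disk. *)
Definition H2 : set (C -> C) := [set f |
  [/\ analytic_disk f,
      forall z, ~ in_disk z -> f z = 0
    & exists M : R, forall r : R, 0 <= r < 1 ->
        circle_mean (fun t => modc (f (r%:C * expi t)) ^+ 2) <= M]].

Definition normH2 (f : C -> C) : R := normL2 (bv f).

Definition Hinfty : set (C -> C) := [set f |
  analytic_disk f /\ exists M : R, forall z, in_disk z -> modc (f z) <= M].

(* Outer functions: a(z) = lam * exp (1/(2 pi) * integral over [0, 2 pi] of
   (e^{it} + z) / (e^{it} - z) * u(t) dt), with |lam| = 1 and u real-valued and
   integrable (u is log |a| on the circle). *)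
Definition outer (a : C -> C) : Prop :=
  exists lam : C, exists u : R -> R,
  [/\ modc lam = 1,
      lebesgue_measure.-integrable `[0, pi *+ 2] (EFin \o u)
    & forall z, in_disk z ->
        a z = lam * expc (circle_meanC (fun t =>
                (expi t + z) / (expi t - z) * (u t)%:C))].

(* Orthogonal projection of L^2 onto H^2: the element g of H^2 for which u - g
   is orthogonal to H^2. *)
Definition Pplus (u : R -> C) : C -> C :=
  xget (fun=> 0) [set g | H2 g /\
    forall h, H2 h -> inner (fun t => u t - bv g t) (bv h) = 0].

Definition coToeplitz (a f : C -> C) : C -> C :=
  Pplus (fun t => (bv a t)^* * bv f t).

Definition range_space (a : C -> C) : set (C -> C) := coToeplitz a @` H2.

(* The H^2 norm of the preimage of g under the co-analytic Toeplitz operator;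
   the preimage is unique when a is outer. *)
Definition range_norm (a g : C -> C) : R :=
  normH2 (xget (fun=> 0) [set f | H2 f /\ coToeplitz a f = g]).

Definition Sshift (f : C -> C) : C -> C := fun z => z * f z.

Definition op_norm (V : set (C -> C)) (N : (C -> C) -> R)
    (A : (C -> C) -> (C -> C)) : \bar R :=
  ereal_sup [set (N (A g))%:E | g in [set g | V g /\ N g <= 1]].

End HardySpace.

(* Main.v *)
(* For f in H^2, T_abar f is the unique g in H^2 with <g, h> = <f, a h> for all h
   in H^2.  Writing h = z b + h(0),
     <z T_abar f, h> = <f, a b> = <z f, z a b> = <z f, a h> - conj(h(0)) <z f, a>,
   and <1, a h> = conj(a(0) h(0)), so z T_abar f = T_abar F for
     F = z f - <z f, a> / conj(a(0)),
   where z f is orthogonal to 1.  Hence |F|^2 = |f|^2 + |<z f, a>|^2 / |a(0)|^2.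
   For |f| = 1, |<z f, a>|^2 is at most |a - a(0)|^2 = |a|^2 - |a(0)|^2, with
   equality if f is proportional to (a - a(0)) / z; thus the supremum of |F|^2 is
   |a|^2 / |a(0)|^2.

   T_abar is injective because, if a = lam exp(H u) with H the Herglotz transform,
   the functions a z^k exp(- H (max (u, - m))) are bounded by 1 and tend to
   lam z^k, so that a function orthogonal to a H^2 is orthogonal to all monomials.

   Radial boundary values exist almost everywhere and agree with the L^2 limit of
   the Taylor polynomials: f is the Poisson integral of that limit, and Poisson
   integrals converge radially at every Lebesgue point. *)
Require Import Defs.
From mathcomp Require Import all_boot all_order all_algebra.
From mathcomp Require Import all_classical all_reals all_analysis.
From mathcomp Require Import measurable_realfun.
From mathcomp.real_closed Require Import complex.
From mathcomp Require Import ring lra.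

Import Order.TTheory GRing.Theory Num.Theory.
Import numFieldNormedType.Exports.

Set Implicit Arguments.
Unset Strict Implicit.
Unset Printing Implicit Defensive.

Local Open Scope classical_set_scope.
Local Open Scope complex_scope.
Local Open Scope ring_scope.

(** The Hilbert space theory is carried out on Taylor coefficients. Elements of [H2] correspond to
    square-summable sequences, and the passage to the circle is made once: a subsequence of Taylor
    polynomials with rapidly decreasing increments converges almost everywhere, under an integrable
    majorant of the squares. Parseval's identity, the Fourier coefficients and the Poisson formula
    then follow from their polynomial cases by dominated convergence. Since [bv] and [Pplus] are
    total, with meaningless values where no limit or projection exists, Fatou's theorem is needed
    before [bv] can be computed at all, and the Toeplitz image has to be constructed from its
    prospective coefficients <f, a z^k>. Analyticity of products and exponentials comes from a
    single limit theorem for locally bounded power series. In the injectivity argument the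
    approximants converge only pointwise in the disk; the uniform bound 1 makes their coefficients
    converge and keeps their norms bounded, which amounts to weak convergence. *)

(** * Modulus, real and imaginary parts, and unimodular exponentials *)

Section Modulus.
Variable R : realType.
Local Notation C := R[i].
Local Notation modc := (@Normc.normc R).
Implicit Types (x y z : C).

Lemma modcE z : `|z| = (modc z)%:C.
Proof. by []. Qed.

Lemma modc_ge0 z : 0 <= modc z.
Proof. by case: z => a b; exact: sqrtr_ge0. Qed.

Lemma modc0 : modc 0 = 0.
Proof. exact: Normc.normc0. Qed.

Lemma modc1 : modc 1 = 1.
Proof. exact: Normc.normc1. Qed.

Lemma modcM x y : modc (x * y) = modc x * modc y.
Proof. exact: Normc.normcM. Qed.

Lemma modcN x : modc (- x) = modc x.
Proof. by apply: complexI; rewrite -!modcE normrN. Qed.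

Lemma modcB x y : modc (x - y) = modc (y - x).
Proof. by rewrite -modcN opprB. Qed.

Lemma modcD x y : modc (x + y) <= modc x + modc y.
Proof. by rewrite -lecR rmorphD -!modcE; exact: ler_normD. Qed.

Lemma modcX x n : modc (x ^+ n) = modc x ^+ n.
Proof. by elim: n => [|n IH]; rewrite ?expr0 ?modc1// !exprS modcM IH. Qed.

Lemma modcV x : modc x^-1 = (modc x)^-1.
Proof. exact: Normc.normcV. Qed.

Lemma modcJ x : modc x^* = modc x.
Proof. by case: x => a b /=; rewrite sqrrN. Qed.

Lemma modc_real (a : R) : modc a%:C = `|a|.
Proof. by rewrite /= expr0n /= addr0 sqrtr_sqr. Qed.

Lemma modc_sum (I : Type) (r : seq I) (P : pred I) (F : I -> C) :
  modc (\sum_(i <- r | P i) F i) <= \sum_(i <- r | P i) modc (F i).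
Proof.
elim/big_rec2: _ => [|i u v _ le_vu]; first by rewrite modc0.
by apply: le_trans (modcD _ _) _; rewrite lerD2l.
Qed.

Lemma modc_eq0 x : (modc x == 0) = (x == 0).
Proof. by apply/eqP/eqP => [/Normc.eq0_normc//|->]; exact: modc0. Qed.

Lemma sqr_modc z : modc z ^+ 2 = complex.Re z ^+ 2 + complex.Im z ^+ 2.
Proof. by case: z => a b /=; rewrite sqr_sqrtr// addr_ge0// sqr_ge0. Qed.

Lemma Re_le_modc z : `|complex.Re z| <= modc z.
Proof.
by case: z => a b /=; rewrite -sqrtr_sqr ler_wsqrtr// lerDl sqr_ge0.
Qed.

Lemma Im_le_modc z : `|complex.Im z| <= modc z.
Proof.
by case: z => a b /=; rewrite -sqrtr_sqr ler_wsqrtr// lerDr sqr_ge0.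
Qed.

Lemma modc_le_ReIm z : modc z <= `|complex.Re z| + `|complex.Im z|.
Proof.
rewrite -(@ler_pXn2r _ 2)// ?nnegrE ?addr_ge0 ?modc_ge0//.
rewrite sqr_modc sqrrD !real_normK ?num_real//.
by rewrite -addrA lerD2l lerDr mulrn_wge0// mulr_ge0.
Qed.

Lemma mulcJ z : z * z^* = (modc z ^+ 2)%:C.
Proof. by rewrite -sqr_normc modcE rmorphXn. Qed.

Lemma cReM x y :
  complex.Re (x * y) = complex.Re x * complex.Re y - complex.Im x * complex.Im y.
Proof. by case: x y => a b [c d]. Qed.

Lemma cImM x y :
  complex.Im (x * y) = complex.Re x * complex.Im y + complex.Im x * complex.Re y.
Proof. by case: x y => a b [c d]. Qed.

Lemma cReD x y : complex.Re (x + y) = complex.Re x + complex.Re y.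
Proof. by case: x y => a b [c d]. Qed.

Lemma cImD x y : complex.Im (x + y) = complex.Im x + complex.Im y.
Proof. by case: x y => a b [c d]. Qed.

Lemma cReN x : complex.Re (- x) = - complex.Re x.
Proof. by case: x. Qed.

Lemma cImN x : complex.Im (- x) = - complex.Im x.
Proof. by case: x. Qed.

Lemma cReJ x : complex.Re x^* = complex.Re x.
Proof. by case: x. Qed.

Lemma cImJ x : complex.Im x^* = - complex.Im x.
Proof. by case: x. Qed.

Lemma complex_eqP x y :
  complex.Re x = complex.Re y -> complex.Im x = complex.Im y -> x = y.
Proof. by case: x y => a b [c d] /= -> ->. Qed.

Lemma cvgC_modc {T : Type} {F : set_system T} {FF : Filter F} (f : T -> C)
    (l : C) :
  (f x : C^o) @[x --> F] --> (l : C^o) <->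
  modc (f x - l) @[x --> F] --> (0 : R).
Proof.
split => [/cvgrPdist_lt fl|/cvgrPdist_lt fl].
  apply/cvgrPdist_lt => e e0.
  have := fl e%:C; rewrite ltcR => /(_ e0).
  apply: filterS => t; rewrite sub0r normrN (ger0_norm (modc_ge0 _)).
  by rewrite modcE ltcR modcB.
(* In the order of [R[i]], [0 < e] forces the imaginary part of [e] to vanish, so every radius is a
   real number. *)
apply/cvgrPdist_lt => e; rewrite ltcE /= => /andP[/eqP ei e0].
have -> : e = (complex.Re e)%:C by case: e ei {e0} => a b /= ->.
apply: filterS (fl _ e0) => t; rewrite sub0r normrN (ger0_norm (modc_ge0 _)).
by rewrite modcE ltcR modcB.
Qed.

Lemma cvgC_ReIm {T : Type} {F : set_system T} {FF : Filter F} (f : T -> C)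
    (l : C) :
  (f x : C^o) @[x --> F] --> (l : C^o) <->
  complex.Re (f x) @[x --> F] --> complex.Re l /\
  complex.Im (f x) @[x --> F] --> complex.Im l.
Proof.
rewrite cvgC_modc; split => [fl|[fr fi]].
  split; apply/cvgrPdist_lt => e e0; move/cvgrPdist_lt : fl => /(_ e e0);
    apply: filterS => t; rewrite sub0r normrN (ger0_norm (modc_ge0 _)) modcB;
    apply: le_lt_trans.
  - by rewrite -cReN -cReD Re_le_modc.
  - by rewrite -cImN -cImD Im_le_modc.
apply/cvgrPdist_lt => e e0; have e2 : 0 < e / 2 by rewrite divr_gt0.
move/cvgrPdist_lt : fr => /(_ _ e2) fr; move/cvgrPdist_lt : fi => /(_ _ e2).
apply: filterS2 fr => t fr fi.
rewrite sub0r normrN (ger0_norm (modc_ge0 _)) modcB.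
apply: le_lt_trans (modc_le_ReIm _) _.
by rewrite [e]splitr ltrD// ?cReD ?cReN ?cImD ?cImN.
Qed.

Lemma cvg_modc {T : Type} {F : set_system T} {FF : Filter F} (f : T -> C)
    (l : C) :
  (f x : C^o) @[x --> F] --> (l : C^o) -> modc (f x) @[x --> F] --> modc l.
Proof.
move=> /cvgC_modc fl; apply/cvgrPdist_lt => e e0.
move/cvgrPdist_lt : fl => /(_ e e0); apply: filterS => t.
rewrite sub0r normrN (ger0_norm (modc_ge0 _)); apply: le_lt_trans.
rewrite ler_norml; apply/andP; split.
- have := modcD (f t - l) l; rewrite subrK => h; lra.
- have := modcD (l - f t) (f t); rewrite subrK modcB => h; lra.
Qed.

Lemma cvg_conjc {T : Type} {F : set_system T} {FF : Filter F} (f : T -> C)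
    (l : C) :
  (f x : C^o) @[x --> F] --> (l : C^o) ->
  ((f x)^* : C^o) @[x --> F] --> (l^* : C^o).
Proof.
move=> /cvgC_modc fl; apply/cvgC_modc.
by under eq_fun do rewrite -rmorphB modcJ.
Qed.

Lemma modc_expi (t : R) : modc (expi t) = 1.
Proof. by rewrite /expi /= cos2Dsin2 sqrtr1. Qed.

Lemma expiD (s t : R) : expi (s + t) = expi s * expi t.
Proof. by rewrite /expi cosD sinD; apply: complex_eqP => //=; ring. Qed.

Lemma expi0 : expi 0 = 1 :> C.
Proof. by rewrite /expi cos0 sin0. Qed.

Lemma expi_neq0 (t : R) : expi t != 0.
Proof. by rewrite -modc_eq0 modc_expi oner_eq0. Qed.

Lemma conj_expi (t : R) : (expi t)^* = expi (- t).
Proof. by rewrite /expi /= cosN sinN. Qed.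

Lemma expiX (t : R) n : expi t ^+ n = expi (n%:R * t).
Proof.
elim: n => [|n IH]; first by rewrite expr0 mul0r expi0.
by rewrite exprS IH -expiD -natr1; congr expi; ring.
Qed.

End Modulus.

(** * Averages on the circle *)

Section AeIntegral.
Context d (T : measurableType d) (R : realType).
Variable mu : {measure set T -> \bar R}.
Import HBNNSimple.
Local Open Scope ereal_scope.

(* Neither function is assumed measurable: the lower integral of a nonnegative
   function is a supremum over simple functions, which can be cut off on a
   null set. *)
Lemma ge0_ae_le_integralT (f g : T -> \bar R) :
  (forall x, 0 <= f x) -> (forall x, 0 <= g x) ->
  {ae mu, forall x, f x = g x} -> \int[mu]_x f x <= \int[mu]_x g x.
Proof.
move=> f0 g0 [N [mN N0 fgN]]; rewrite !ge0_integralTE//.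
apply: ge_ereal_sup => _ [h /= hf <-].
have mNc := measurableC mN.
apply: ereal_sup_ubound; exists (proj_nnsfun h mNc) => /=.
  move=> x; rewrite /= mindicE; have [xN|xN] := boolP (x \in ~` N).
    rewrite mulr1; suff <- : f x = g x by exact: hf.
    by apply: contrapT => nfg; move: xN; rewrite inE; apply; apply: fgN.
  by rewrite mulr0.
rewrite -!integralT_nnsfun; apply: ae_eq_integral => //.
- by apply/measurable_EFinP; exact: measurable_funPT.
- by apply/measurable_EFinP; exact: measurable_funPT.
exists N; split => // x /= hx; apply: contrapT => xN; apply: hx => _.
by rewrite mindicE mem_set// mulr1.
Qed.

(** Positive and negative parts are treated separately; for each, two applications of
    [ge0_ae_le_integralT] to the restrictions to [D] give equality. *)
Lemma ae_integral (D : set T) (f g : T -> \bar R) :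
  {ae mu, forall x, D x -> f x = g x} ->
  \int[mu]_(x in D) f x = \int[mu]_(x in D) g x.
Proof.
move=> fg; rewrite [LHS]integralE [RHS]integralE.
congr (_ - _); rewrite [LHS]integral_mkcond [RHS]integral_mkcond;
  apply/eqP; rewrite eq_le; apply/andP; split;
  apply: ge0_ae_le_integralT => [x|x|];
  rewrite ?erestrict_ge0//; move: fg; apply: filterS => x;
  rewrite /patch; case: ifPn => // /set_mem Dx /(_ Dx);
  by rewrite ?funeposE ?funenegE => ->.
Qed.

End AeIntegral.

(** * Means of real functions and dominated convergence *)

Section CircleMean.
Variable R : realType.
Local Notation mu := (@lebesgue_measure R).
Local Notation D := (`[0 : R, pi *+ 2]%classic).

Lemma pi2_gt0 : 0 < pi *+ 2 :> R.
Proof. by rewrite mulrn_wgt0// pi_gt0. Qed.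

Lemma circle_measure : mu D = (pi *+ 2)%:E.
Proof. by rewrite lebesgue_measure_itv /= lte_fin pi2_gt0 oppr0 adde0. Qed.

Lemma circle_measure_lty : (mu D < +oo)%E.
Proof. by rewrite circle_measure ltry. Qed.

Lemma measurable_circle : measurable D.
Proof. exact: measurable_itv. Qed.
Local Notation mD := measurable_circle.

#[global] Instance lebesgue_ae_filter : Filter (nbhs (almost_everywhere mu)).
Proof. exact: ae_filter_ringOfSetsType. Qed.

(* Integrability up to almost everywhere equality, because [bv f] is only
   controlled almost everywhere: where the radial limit fails to exist, [lim]
   takes an arbitrary value. *)
Definition circle_integrable (u : R -> R) :=
  exists2 v, mu.-integrable D (EFin \o v) &
    {ae mu, forall t, D t -> u t = v t}.

Lemma circle_mean_ae (u v : R -> R) :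
  {ae mu, forall t, D t -> u t = v t} -> circle_mean u = circle_mean v.
Proof.
move=> uv; rewrite /circle_mean /Rintegral; congr (_ * fine _).
by apply: ae_integral; move: uv; apply: filterS => t uv /uv ->.
Qed.

Lemma eq_circle_mean (u v : R -> R) :
  (forall t, u t = v t) -> circle_mean u = circle_mean v.
Proof. by move=> uv; congr circle_mean; apply/funext. Qed.

Lemma circle_integrableW (u : R -> R) :
  mu.-integrable D (EFin \o u) -> circle_integrable u.
Proof. by exists u => //; exact: aeW. Qed.

Lemma circle_integrable_ae (u v : R -> R) : circle_integrable v ->
  {ae mu, forall t, D t -> u t = v t} -> circle_integrable u.
Proof.
move=> [w iw vw] uv; exists w => //.
by move: uv vw; apply: filterS2 => t uv vw Dt; rewrite uv// vw.
Qed.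

Lemma circle_integrableD (u v : R -> R) : circle_integrable u ->
  circle_integrable v -> circle_integrable (fun t => u t + v t).
Proof.
move=> [u' iu uu'] [v' iv vv']; exists (fun t => u' t + v' t).
  by rewrite (_ : _ \o _ = (EFin \o u') \+ (EFin \o v'))%E//; exact: integrableD.
by move: uu' vv'; apply: filterS2 => t uu' vv' Dt; rewrite uu'// vv'.
Qed.

Lemma circle_integrableZ (k : R) (u : R -> R) : circle_integrable u ->
  circle_integrable (fun t => k * u t).
Proof.
move=> [u' iu uu']; exists (fun t => k * u' t).
  rewrite (_ : _ \o _ = (fun t => k%:E * (EFin \o u') t)%E)//.
  exact: integrableZl.
by move: uu'; apply: filterS => t uu' Dt; rewrite uu'.
Qed.

Lemma circle_integrableN (u : R -> R) : circle_integrable u ->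
  circle_integrable (fun t => - u t).
Proof.
move=> /(circle_integrableZ (-1)); rewrite (_ : (fun _ => _) = fun t => - u t)//.
by apply/funext => t; rewrite mulN1r.
Qed.

Lemma circle_meanD (u v : R -> R) : circle_integrable u -> circle_integrable v ->
  circle_mean (fun t => u t + v t) = circle_mean u + circle_mean v.
Proof.
move=> [u' iu uu'] [v' iv vv'].
rewrite (circle_mean_ae uu') (circle_mean_ae vv').
rewrite (@circle_mean_ae _ (fun t => u' t + v' t)).
  by rewrite /circle_mean -mulrDr -RintegralD.
by move: uu' vv'; apply: filterS2 => t uu' vv' Dt; rewrite uu'// vv'.
Qed.

Lemma circle_meanZ (k : R) (u : R -> R) : circle_integrable u ->
  circle_mean (fun t => k * u t) = k * circle_mean u.
Proof.
move=> [u' iu uu']; rewrite (circle_mean_ae uu').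
rewrite (@circle_mean_ae _ (fun t => k * u' t)).
  by rewrite /circle_mean mulrCA RintegralZl.
by move: uu'; apply: filterS => t uu' Dt; rewrite uu'.
Qed.

Lemma circle_meanN (u : R -> R) : circle_integrable u ->
  circle_mean (fun t => - u t) = - circle_mean u.
Proof.
move=> iu; rewrite -mulN1r -circle_meanZ//.
by apply: eq_circle_mean => t; rewrite mulN1r.
Qed.

Lemma circle_mean_ge0 (u : R -> R) : (forall t, D t -> 0 <= u t) ->
  0 <= circle_mean u.
Proof.
move=> u0; rewrite mulr_ge0 ?invr_ge0 ?(ltW pi2_gt0)// fine_ge0//.
by apply: integral_ge0 => t Dt; rewrite lee_fin u0.
Qed.

Lemma ae_circle_mean_ge0 (u : R -> R) :
  {ae mu, forall t, D t -> 0 <= u t} -> 0 <= circle_mean u.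
Proof.
move=> u0; rewrite (@circle_mean_ae _ (fun t => `|u t|)).
  exact: circle_mean_ge0.
by move: u0; apply: filterS => t u0 Dt; rewrite ger0_norm// u0.
Qed.

Lemma ae_circle_mean_le (u v : R -> R) : circle_integrable u ->
  circle_integrable v -> {ae mu, forall t, D t -> u t <= v t} ->
  circle_mean u <= circle_mean v.
Proof.
move=> iu iv uv; rewrite -subr_ge0 -circle_meanN// -circle_meanD//.
  by apply: ae_circle_mean_ge0; move: uv; apply: filterS => t uv Dt; rewrite subr_ge0 uv.
exact: circle_integrableN.
Qed.

Lemma circle_mean_le (u v : R -> R) : circle_integrable u ->
  circle_integrable v -> (forall t, D t -> u t <= v t) ->
  circle_mean u <= circle_mean v.
Proof. by move=> iu iv uv; apply: ae_circle_mean_le => //; exact: aeW. Qed.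

Lemma circle_bounded_integrable (M : R) (u : R -> R) : measurable_fun D u ->
  (forall t, D t -> `|u t| <= M) -> mu.-integrable D (EFin \o u).
Proof.
move=> mu_ uM; apply: measurable_bounded_integrable => //.
  by have := circle_measure_lty.
exists M; split; first exact: num_real.
by move=> x Mx t Dt /=; rewrite (le_trans (uM _ Dt))// ltW.
Qed.

Lemma circle_integrable_cst (k : R) : circle_integrable (fun=> k).
Proof.
apply: circle_integrableW; apply: (@circle_bounded_integrable `|k|) => //.
Qed.

Lemma circle_mean_cst (k : R) : circle_mean (fun=> k) = k.
Proof.
rewrite /circle_mean Rintegral_cst//= circle_measure /= mulrCA mulVf ?mulr1//.
by rewrite gt_eqF// pi2_gt0.
Qed.

(** The limit [u] is uncontrolled on the exceptional null set [N]. Its restriction [v] to the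
    complement of [N] is an everywhere limit on [D] of the restricted [u_ n], hence measurable, and
    agrees with [u] almost everywhere; dominated convergence is applied to [v]. *)
Lemma circle_mean_dominated (u_ : nat -> R -> R) (u g : R -> R) :
  (forall n, measurable_fun D (u_ n)) ->
  {ae mu, forall t, D t -> u_ n t @[n --> \oo] --> u t} ->
  mu.-integrable D (EFin \o g) ->
  {ae mu, forall t n, D t -> `|u_ n t| <= g t} ->
  circle_integrable u /\ circle_mean (u_ n) @[n --> \oo] --> circle_mean u.
Proof.
move=> mu_ [N [mN N0 cN]] ig ug.
have mNc := measurableC mN.
pose v := u \_ (~` N).
have uv t : ~ N t -> u t = v t by move=> Nt; rewrite /v patchE mem_set.
have aeuv : {ae mu, forall t, D t -> u t = v t}.
  exists N; split => // t /= ntuv; apply: contrapT => Nt; apply: ntuv => _.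
  exact: uv.
have mv : measurable_fun D v.
  apply: (@measurable_fun_cvg _ _ _ _ (fun n => u_ n \_ (~` N))) => [m|t Dt].
    apply/measurable_restrict => //.
    by apply: measurable_funS (mu_ m) => //; exact: subIsetr.
  rewrite /v patchE; case: ifPn => [/set_mem Nt|nNt].
    rewrite (_ : (fun n => _) = fun n => u_ n t).
      by apply: contrapT => h; apply: Nt; apply: cN => /= /(_ Dt).
    by apply/funext => n; rewrite patchE mem_set.
  rewrite (_ : (fun n => _) = fun n => point); first exact: cvg_cst.
  by apply/funext => n; rewrite patchE (negbTE nNt).
have [] := @dominated_convergence _ _ _ mu D mD (fun n => EFin \o u_ n)
   (EFin \o v) (EFin \o g).
- by move=> n; apply/measurable_EFinP; exact: mu_.
- by apply/measurable_EFinP; exact: mv.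
- exists N; split => // t /= h; apply: contrapT => Nt; apply: h => Dt.
  apply/fine_cvgP; split; first by near=> n.
  rewrite -uv//; apply: contrapT => h; apply: Nt; apply: cN => /= cv.
  by apply: h; exact: cv.
- exact: ig.
- by move: ug; apply: filterS => t ug n Dt; rewrite /= lee_fin ug.
move=> iv _ cv; split; first by exists v.
rewrite (circle_mean_ae aeuv) /circle_mean.
apply: cvgMr; apply: fine_cvg.
by rewrite fineK//; exact: integrable_fin_num.
Unshelve. all: by end_near. Qed.

End CircleMean.

(** * Means of complex functions and orthonormality of the exponentials *)

Section CircleMeanC.
Variable R : realType.
Local Notation C := R[i].
Local Notation modc := (@Normc.normc R).
Local Notation mu := (@lebesgue_measure R).
Local Notation D := (`[0 : R, pi *+ 2]%classic).
Implicit Types (u v w : R -> C) (k : C).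

Definition circle_integrableC u :=
  circle_integrable (fun t => complex.Re (u t)) /\
  circle_integrable (fun t => complex.Im (u t)).

Definition circle_measurableC u :=
  measurable_fun D (fun t => complex.Re (u t)) /\
  measurable_fun D (fun t => complex.Im (u t)).

Lemma circle_meanC_ae u v :
  {ae mu, forall t, D t -> u t = v t} -> circle_meanC u = circle_meanC v.
Proof.
by move=> uv; congr (_ +i* _); apply: circle_mean_ae; move: uv;
  apply: filterS => t uv /uv ->.
Qed.

Lemma eq_circle_meanC u v :
  (forall t, u t = v t) -> circle_meanC u = circle_meanC v.
Proof. by move=> uv; congr circle_meanC; apply/funext. Qed.

Lemma circle_integrableC_ae u v : circle_integrableC v ->
  {ae mu, forall t, D t -> u t = v t} -> circle_integrableC u.
Proof.
by move=> [rv iv] uv; split; [apply: circle_integrable_ae rv _|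
  apply: circle_integrable_ae iv _]; move: uv; apply: filterS => t uv /uv ->.
Qed.

Lemma circle_integrableCD u v : circle_integrableC u -> circle_integrableC v ->
  circle_integrableC (fun t => u t + v t).
Proof.
by move=> [ru iu] [rv iv]; split;
  [under eq_fun do rewrite cReD|under eq_fun do rewrite cImD];
  exact: circle_integrableD.
Qed.

Lemma circle_integrableCZ k u : circle_integrableC u ->
  circle_integrableC (fun t => k * u t).
Proof.
move=> [ru iu]; split.
  under eq_fun do rewrite cReM -mulNr.
  by apply: circle_integrableD; exact: circle_integrableZ.
under eq_fun do rewrite cImM.
by apply: circle_integrableD; exact: circle_integrableZ.
Qed.

Lemma circle_meanCD u v : circle_integrableC u -> circle_integrableC v ->
  circle_meanC (fun t => u t + v t) = circle_meanC u + circle_meanC v.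
Proof.
move=> [ru iu] [rv iv]; apply: complex_eqP; rewrite ?cReD ?cImD /=.
  by rewrite -circle_meanD//; apply: eq_circle_mean => t; rewrite cReD.
by rewrite -circle_meanD//; apply: eq_circle_mean => t; rewrite cImD.
Qed.

Lemma circle_meanCZ k u : circle_integrableC u ->
  circle_meanC (fun t => k * u t) = k * circle_meanC u.
Proof.
move=> [ru iu]; apply: complex_eqP; rewrite ?cReM ?cImM /=.
  rewrite -!circle_meanZ// -circle_meanN -?circle_meanD;
    do ?[exact: circle_integrableZ|exact/circle_integrableN/circle_integrableZ].
  by apply: eq_circle_mean => t; rewrite cReM.
rewrite -!circle_meanZ// -?circle_meanD; do ?exact: circle_integrableZ.
by apply: eq_circle_mean => t; rewrite cImM.
Qed.

Lemma circle_meanCJ u : circle_integrableC u ->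
  circle_meanC (fun t => (u t)^*) = (circle_meanC u)^*.
Proof.
move=> [ru iu]; apply: complex_eqP; rewrite ?cReJ ?cImJ /=.
  by apply: eq_circle_mean => t; rewrite cReJ.
by rewrite -circle_meanN//; apply: eq_circle_mean => t; rewrite cImJ.
Qed.

Lemma circle_meanC_real (f : R -> R) :
  circle_meanC (fun t => (f t)%:C) = (circle_mean f)%:C.
Proof. by rewrite /circle_meanC /= circle_mean_cst. Qed.

Lemma circle_integrableC_real (f : R -> R) : circle_integrable f ->
  circle_integrableC (fun t => (f t)%:C).
Proof. by split => //; exact: circle_integrable_cst. Qed.

Lemma circle_integrableC_cst k : circle_integrableC (fun=> k).
Proof. by split; exact: circle_integrable_cst. Qed.

Lemma circle_meanC_cst k : circle_meanC (fun=> k) = k.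
Proof. by apply: complex_eqP; rewrite /= circle_mean_cst. Qed.

Lemma circle_integrableC_sum (I : Type) (s : seq I) (F : I -> R -> C) :
  (forall i, circle_integrableC (F i)) ->
  circle_integrableC (fun t => \sum_(i <- s) F i t).
Proof.
move=> iF; elim: s => [|i s IH].
  by under eq_fun do rewrite big_nil; exact: circle_integrableC_cst.
by under eq_fun do rewrite big_cons; exact: circle_integrableCD.
Qed.

Lemma circle_meanC_sum (I : Type) (s : seq I) (F : I -> R -> C) :
  (forall i, circle_integrableC (F i)) ->
  circle_meanC (fun t => \sum_(i <- s) F i t) =
  \sum_(i <- s) circle_meanC (F i).
Proof.
move=> iF; elim: s => [|i s IH].
  by under eq_circle_meanC do rewrite big_nil; rewrite big_nil circle_meanC_cst.
under eq_circle_meanC do rewrite big_cons; rewrite big_cons circle_meanCD ?IH//.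
exact: circle_integrableC_sum.
Qed.

(** With [m] the mean, [modc m ^+ 2] is the mean of the real part of [m^* * u t], which is at most
    [modc m * M]; a factor [modc m] cancels. *)
Lemma circle_meanC_le (M : R) u : circle_integrableC u ->
  (forall t, D t -> modc (u t) <= M) -> modc (circle_meanC u) <= M.
Proof.
move=> iu uM; set m := circle_meanC u.
have M0 : 0 <= M.
  by apply: le_trans (modc_ge0 _) (uM 0 _); rewrite /= in_itv /= lexx ltW ?pi2_gt0.
have [->|m0] := eqVneq m 0; first by rewrite modc0.
have m0' : 0 < modc m by rewrite lt_neqAle eq_sym modc_eq0 m0 modc_ge0.
suff : modc m ^+ 2 <= modc m * M by rewrite expr2 ler_pM2l.
have <- : circle_mean (fun t => complex.Re (m^* * u t)) = modc m ^+ 2.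
  transitivity (complex.Re (circle_meanC (fun t => m^* * u t))) => //.
  by rewrite circle_meanCZ// mulrC mulcJ.
rewrite -[leRHS]circle_mean_cst; apply: circle_mean_le.
- by case: (circle_integrableCZ m^* iu).
- exact: circle_integrable_cst.
move=> t Dt; apply: le_trans (ler_norm _) (le_trans (Re_le_modc _) _).
by rewrite modcM modcJ ler_wpM2l// ?modc_ge0// uM.
Qed.

Lemma circle_measurableC_cst k : circle_measurableC (fun=> k).
Proof. by split; exact: measurable_cst. Qed.

Lemma circle_measurableCD u v : circle_measurableC u -> circle_measurableC v ->
  circle_measurableC (fun t => u t + v t).
Proof.
by move=> [ru iu] [rv iv]; split;
  [under [X in measurable_fun _ X]eq_fun do rewrite cReD
  |under [X in measurable_fun _ X]eq_fun do rewrite cImD];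
  exact: measurable_funD.
Qed.

Lemma circle_measurableCM u v : circle_measurableC u -> circle_measurableC v ->
  circle_measurableC (fun t => u t * v t).
Proof.
move=> [ru iu] [rv iv]; split.
  by under [X in measurable_fun _ X]eq_fun do rewrite cReM;
    apply: measurable_funB; exact: measurable_funM.
by under [X in measurable_fun _ X]eq_fun do rewrite cImM;
  apply: measurable_funD; exact: measurable_funM.
Qed.

Lemma circle_measurableCJ u : circle_measurableC u ->
  circle_measurableC (fun t => (u t)^*).
Proof.
move=> [ru iu]; split; first by under [X in measurable_fun _ X]eq_fun do rewrite cReJ.
by under [X in measurable_fun _ X]eq_fun do rewrite cImJ; exact: measurableT_comp.
Qed.

Lemma circle_measurableCX u n : circle_measurableC u ->
  circle_measurableC (fun t => u t ^+ n).
Proof.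
move=> mu_; elim: n => [|n IH].
  by under eq_fun do rewrite expr0; exact: circle_measurableC_cst.
by under eq_fun do rewrite exprS; exact: circle_measurableCM.
Qed.

Lemma circle_measurableC_sum (I : Type) (s : seq I) (F : I -> R -> C) :
  (forall i, circle_measurableC (F i)) ->
  circle_measurableC (fun t => \sum_(i <- s) F i t).
Proof.
move=> iF; elim: s => [|i s IH].
  by under eq_fun do rewrite big_nil; exact: circle_measurableC_cst.
by under eq_fun do rewrite big_cons; exact: circle_measurableCD.
Qed.

Lemma circle_measurableC_expi : circle_measurableC (@expi R).
Proof.
by split; apply: measurable_funTS; apply: continuous_measurable_fun;
  [exact: continuous_cos|exact: continuous_sin].
Qed.

Lemma circle_measurableC_sqr u : circle_measurableC u ->
  measurable_fun D (fun t => modc (u t) ^+ 2).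
Proof.
move=> [ru iu]; under [X in measurable_fun _ X]eq_fun do rewrite sqr_modc.
by apply: measurable_funD; exact: measurable_funX.
Qed.

Lemma circle_measurableC_cvg (u_ : nat -> R -> C) u :
  (forall n, circle_measurableC (u_ n)) ->
  (forall t, D t -> (u_ n t : C^o) @[n --> \oo] --> (u t : C^o)) ->
  circle_measurableC u.
Proof.
move=> mu_ cu; split; [apply: (@measurable_fun_cvg _ _ _ _
  (fun n t => complex.Re (u_ n t)))|apply: (@measurable_fun_cvg _ _ _ _
  (fun n t => complex.Im (u_ n t)))] => [m|t /cu /cvgC_ReIm[]//|m|t /cu /cvgC_ReIm[]//];
  by case: (mu_ m).
Qed.

Lemma circle_boundedC_integrable (M : R) u : circle_measurableC u ->
  (forall t, D t -> modc (u t) <= M) -> circle_integrableC u.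
Proof.
by move=> [ru iu] uM; split; apply: circle_integrableW;
  apply: (@circle_bounded_integrable _ M) => // t Dt;
  rewrite (le_trans _ (uM _ Dt))// ?Re_le_modc ?Im_le_modc.
Qed.

Lemma circle_meanC_dominated (u_ : nat -> R -> C) u (g : R -> R) :
  (forall n, circle_measurableC (u_ n)) ->
  {ae mu, forall t, D t -> (u_ n t : C^o) @[n --> \oo] --> (u t : C^o)} ->
  mu.-integrable D (EFin \o g) ->
  {ae mu, forall t n, D t -> modc (u_ n t) <= g t} ->
  circle_integrableC u /\
  (circle_meanC (u_ n) : C^o) @[n --> \oo] --> (circle_meanC u : C^o).
Proof.
move=> mu_ cu ig ug.
have [|||ru cru] := @circle_mean_dominated _ (fun n t => complex.Re (u_ n t))
  (fun t => complex.Re (u t)) g _ _ ig.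
- by move=> n; case: (mu_ n).
- by move: cu; apply: filterS => t cu /cu /cvgC_ReIm[].
- by move: ug; apply: filterS => t ug n Dt; apply: le_trans (ug n Dt);
    exact: Re_le_modc.
have [|||iu ciu] := @circle_mean_dominated _ (fun n t => complex.Im (u_ n t))
  (fun t => complex.Im (u t)) g _ _ ig.
- by move=> n; case: (mu_ n).
- by move: cu; apply: filterS => t cu /cu /cvgC_ReIm[].
- by move: ug; apply: filterS => t ug n Dt; apply: le_trans (ug n Dt);
    exact: Im_le_modc.
by split => //; apply/cvgC_ReIm.
Qed.

Lemma circle_meanC_bounded (M : R) (u_ : nat -> R -> C) u :
  (forall n, circle_measurableC (u_ n)) ->
  (forall t, D t -> (u_ n t : C^o) @[n --> \oo] --> (u t : C^o)) ->
  (forall n t, D t -> modc (u_ n t) <= M) ->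
  (circle_meanC (u_ n) : C^o) @[n --> \oo] --> (circle_meanC u : C^o).
Proof.
move=> mu_ cu uM.
have [|||//] := @circle_meanC_dominated u_ u (fun=> M) mu_.
- exact: aeW.
- by apply: (@circle_bounded_integrable _ `|M|) => //; exact: measurable_cst.
- by apply: aeW => t n; exact: uM.
Qed.

(** The primitives sin (m t) / m and - cos (m t) / m take the same value at both ends of the
    interval, so the fundamental theorem of calculus gives 0. *)
Lemma circle_mean_trig (m : R) : m != 0 -> expi (m * (pi *+ 2)) = 1 :> C ->
  circle_mean (fun t => cos (m * t)) = 0 /\
  circle_mean (fun t => sin (m * t)) = 0.
Proof.
move=> m0 [c1 s0].
have dl (x : R) : is_derive x (1 : R) (fun t : R => m * t) m.
  by apply: is_derive_eq; rewrite /GRing.scale /= mulr1.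
have dS (x : R) : is_derive x (1 : R) (fun t : R => m^-1 * sin (m * t)) (cos (m * x)).
  have h := @is_derive1_comp _ (@sin R) (fun t : R => m * t) x _ _ (is_derive_sin (m * x)) (dl x).
  by apply: is_derive_eq (is_deriveZ m^-1 h) _; rewrite /GRing.scale /=; field.
have dC (x : R) : is_derive x (1 : R) (fun t : R => - (m^-1 * cos (m * t))) (sin (m * x)).
  have h := @is_derive1_comp _ (@cos R) (fun t : R => m * t) x _ _ (is_derive_cos (m * x)) (dl x).
  by apply: is_derive_eq (is_deriveN (is_deriveZ m^-1 h)) _;
    rewrite /GRing.scale /=; field.
have cl : continuous (fun t : R => m * t).
  by move=> x; apply: differentiable_continuous; apply/derivable1_diffP; case: (dl x).
have FTC (f F : R -> R) : continuous f -> (forall x, is_derive x (1 : R) F (f x)) ->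
    F (pi *+ 2) = F 0 -> circle_mean f = 0.
  move=> cf dF FE.
  have cF : continuous F.
    by move=> x; apply: differentiable_continuous; apply/derivable1_diffP; case: (dF x).
  rewrite /circle_mean /Rintegral (@continuous_FTC2 _ f F).
  - by rewrite FE -EFinB subrr /= mulr0.
  - exact: pi2_gt0.
  - exact: continuous_subspaceT.
  - split; first by move=> x _; case: (dF x).
      by apply: cvg_at_right_filter; exact: cF.
    by apply: cvg_at_left_filter; exact: cF.
  - by move=> x _; rewrite derive1E; case: (dF x).
split; [apply: (FTC _ _ _ dS)|apply: (FTC _ _ _ dC)].
- by move=> x; apply: continuous_comp; [exact: cl|exact: continuous_cos].
- by rewrite s0 !mulr0 sin0 mulr0.
- by move=> x; apply: continuous_comp; [exact: cl|exact: continuous_sin].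
- by rewrite c1 mulr0 cos0.
Qed.

(** Conjugation reduces to [k <= j], where the integrand is the single exponential
    [expi ((j - k)%:R * t)]. *)
Lemma circle_meanC_expi (j k : nat) :
  circle_meanC (fun t => expi t ^+ j * (expi t ^+ k)^*) = (j == k)%:R :> C.
Proof.
wlog : j k / (k <= j)%N => [h|kj].
  have [/h//|/ltnW kj] := leqP k j.
  rewrite eq_sym -conjC_nat -(h k j)// -circle_meanCJ; last first.
    apply: (@circle_boundedC_integrable 1).
      by apply: circle_measurableCM; [|apply: circle_measurableCJ];
        apply: circle_measurableCX; exact: circle_measurableC_expi.
    by move=> t _; rewrite modcM modcJ !modcX modc_expi !expr1n mulr1.
  by apply: eq_circle_meanC => t; rewrite rmorphM /= conjCK mulrC.
have E t : expi t ^+ j * (expi t ^+ k)^* = expi ((j - k)%:R * t) :> C.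
  by rewrite !expiX conj_expi -expiD natrB// mulrBl.
rewrite (eq_circle_meanC E); have [->|jk] := eqVneq j k.
  by under eq_circle_meanC do rewrite subnn mul0r expi0; rewrite circle_meanC_cst.
have m0 : (j - k)%:R != 0 :> R.
  by rewrite pnatr_eq0 subn_eq0 -ltnNge ltn_neqAle eq_sym jk.
have e1 : expi ((j - k)%:R * (pi *+ 2)) = 1 :> C.
  rewrite -expiX (_ : expi _ = 1) ?expr1n//.
  by rewrite /expi cos2pi sin2pi.
by have [c s] := circle_mean_trig m0 e1; rewrite /circle_meanC /= c s.
Qed.

End CircleMeanC.

(** * Power series on the disk *)

Section ComplexLimits.
Variable R : realType.
Local Notation C := R[i].
Local Notation modc := (@Normc.normc R).
Context {T : Type} {F : set_system T} {FF : ProperFilter F}.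
Implicit Types (f g : T -> C) (l m : C).

Lemma cvgC_cst l : ((fun=> l) : T -> C^o) @ F --> (l : C^o).
Proof. exact: cvg_cst. Qed.

Lemma cvgCD f g l m : (f x : C^o) @[x --> F] --> (l : C^o) ->
  (g x : C^o) @[x --> F] --> (m : C^o) ->
  (f x + g x : C^o) @[x --> F] --> (l + m : C^o).
Proof.
move=> /cvgC_ReIm[rf jf] /cvgC_ReIm[rg jg]; apply/cvgC_ReIm.
rewrite cReD cImD; split.
  by under eq_fun do rewrite cReD; exact: cvgD.
by under eq_fun do rewrite cImD; exact: cvgD.
Qed.

Lemma cvgCM f g l m : (f x : C^o) @[x --> F] --> (l : C^o) ->
  (g x : C^o) @[x --> F] --> (m : C^o) ->
  (f x * g x : C^o) @[x --> F] --> (l * m : C^o).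
Proof.
move=> /cvgC_ReIm[rf jf] /cvgC_ReIm[rg jg]; apply/cvgC_ReIm.
rewrite cReM cImM; split.
  by under eq_fun do rewrite cReM; apply: cvgB; exact: cvgM.
by under eq_fun do rewrite cImM; apply: cvgD; exact: cvgM.
Qed.

Lemma cvgCN f l : (f x : C^o) @[x --> F] --> (l : C^o) ->
  (- f x : C^o) @[x --> F] --> (- l : C^o).
Proof.
move=> /cvgC_ReIm[rf jf]; apply/cvgC_ReIm; rewrite cReN cImN; split.
  by under eq_fun do rewrite cReN; exact: cvgN.
by under eq_fun do rewrite cImN; exact: cvgN.
Qed.

Lemma cvgCB f g l m : (f x : C^o) @[x --> F] --> (l : C^o) ->
  (g x : C^o) @[x --> F] --> (m : C^o) ->
  (f x - g x : C^o) @[x --> F] --> (l - m : C^o).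
Proof. by move=> fl gm; exact: (cvgCD fl (cvgCN gm)). Qed.

Lemma cvgC_sum (I : Type) (s : seq I) (f : I -> T -> C) (l : I -> C) :
  (forall i, (f i x : C^o) @[x --> F] --> (l i : C^o)) ->
  (\sum_(i <- s) f i x : C^o) @[x --> F] --> (\sum_(i <- s) l i : C^o).
Proof.
move=> fl; elim: s => [|i s IH].
  by under eq_fun do rewrite big_nil; rewrite big_nil; exact: cvgC_cst.
by under eq_fun do rewrite big_cons; rewrite big_cons;
  exact: (cvgCD (fl i) IH).
Qed.

Lemma cvgC_unique f l m : (f x : C^o) @[x --> F] --> (l : C^o) ->
  (f x : C^o) @[x --> F] --> (m : C^o) -> l = m.
Proof.
move=> /cvgC_ReIm[rf jf] /cvgC_ReIm[rg jg]; apply: complex_eqP.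
  exact: (cvg_unique _ rf rg).
exact: (cvg_unique _ jf jg).
Qed.

Lemma cvgC_modc_le f l (M : R) : (f x : C^o) @[x --> F] --> (l : C^o) ->
  (\forall x \near F, modc (f x) <= M) -> modc l <= M.
Proof.
move=> /cvg_modc fl fM; rewrite -(cvg_lim _ fl)//.
by apply: limr_le => //; apply: cvgP fl.
Qed.

Lemma cvgC_near_eq f g l : (\forall x \near F, f x = g x) ->
  (g x : C^o) @[x --> F] --> (l : C^o) -> (f x : C^o) @[x --> F] --> (l : C^o).
Proof.
move=> fg; apply: cvg_trans; apply: near_eq_cvg.
by move: fg; apply: filterS => x ->.
Qed.

Lemma cvgC_squeeze f l (h : T -> R) : (\forall x \near F, modc (f x - l) <= h x) ->
  h x @[x --> F] --> (0 : R) -> (f x : C^o) @[x --> F] --> (l : C^o).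
Proof.
move=> fh h0; apply/cvgC_modc; apply/cvgrPdist_lt => e e0.
move/cvgrPdist_lt : h0 => /(_ e e0); move: fh; apply: filterS2 => x fh.
rewrite !sub0r !normrN (ger0_norm (modc_ge0 _)).
by apply: le_lt_trans; apply: le_trans fh (ler_norm _).
Qed.

End ComplexLimits.

(** * Partial sums, geometric tails, and Cauchy and Parseval formulas on inner circles *)

Section PowerSeries.
Variable R : realType.
Local Notation C := R[i].
Local Notation modc := (@Normc.normc R).
Implicit Types (c d : nat -> C) (f g : C -> C).

Definition psum c n (z : C) : C := \sum_(0 <= k < n) c k * z ^+ k.

Definition has_coefs f c := forall z, in_disk z ->
  ((psum c)^~ z : nat -> C^o) @ \oo --> (f z : C^o).

Lemma modc_circle (r t : R) : 0 <= r -> modc (r%:C * expi t) = r.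
Proof. by move=> r0; rewrite modcM modc_expi mulr1 modc_real ger0_norm. Qed.

Lemma in_disk_circle (r t : R) : 0 <= r < 1 -> in_disk (r%:C * expi t).
Proof. by case/andP=> r0 r1; rewrite /in_disk modc_circle. Qed.

Lemma sum_geometric_le (q : R) n : 0 <= q < 1 ->
  \sum_(0 <= k < n) q ^+ k <= (1 - q)^-1.
Proof.
case/andP=> q0 q1; rewrite -[leRHS]mul1r ler_pdivlMr ?subr_gt0//.
rewrite mulrC -opprB mulNr big_mkord -subrX1 opprB.
by rewrite lerBlDr lerDl exprn_ge0.
Qed.

Lemma psum_shift c m n z : (m <= n)%N ->
  psum c n z - psum c m z = \sum_(m <= k < n) c k * z ^+ k.
Proof. by move=> mn; rewrite /psum (big_cat_nat (leq0n m) mn)/= addrAC subrr add0r. Qed.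

Lemma sum_geometric_shift_le (q : R) m n : 0 <= q < 1 ->
  \sum_(m <= k < n) q ^+ k <= q ^+ m * (1 - q)^-1.
Proof.
move=> q01; have [nm|mn] := leqP n m.
  rewrite big_geq// mulr_ge0 ?exprn_ge0 ?invr_ge0; case/andP: q01 => //.
  by move=> q0 q1; rewrite subr_ge0 ltW.
rewrite -{1}[m]add0n big_addn; under eq_bigr do rewrite exprD mulrC.
rewrite -mulr_sumr ler_wpM2l//; last exact: sum_geometric_le.
by rewrite exprn_ge0//; case/andP: q01.
Qed.

(** Each term [c k * r ^+ k] is a difference of two consecutive partial sums at [r], and these form
    a convergent, hence bounded, sequence. *)
Lemma has_coefs_bounded f c (r : R) : has_coefs f c -> 0 <= r < 1 ->
  exists M, 0 <= M /\ forall k, modc (c k) * r ^+ k <= M.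
Proof.
move=> fc r01; have r0 : 0 <= r by case/andP: r01.
have dr : in_disk (r%:C) by rewrite -[r%:C]mulr1 -expi0; exact: in_disk_circle.
have := fc _ dr => /cvg_modc /cvgP /cvg_seq_bounded [M [_ HM]].
have HM' n : modc (psum c n r%:C) <= `|M| + 1.
  have := HM (`|M| + 1) (ltr_pwDr ltr01 (ler_norm _)) n I.
  by rewrite /= ger0_norm// modc_ge0.
exists ((`|M| + 1) *+ 2); split; first by rewrite mulrn_wge0// addr_ge0.
move=> k; have -> : modc (c k) * r ^+ k = modc (psum c k.+1 r%:C - psum c k r%:C).
  rewrite psum_shift// big_nat1 modcM modcX modc_real ger0_norm//.
by rewrite (le_trans (modcD _ _))// modcN mulr2n lerD.
Qed.

(** Comparison with a geometric series: where [modc z = q * r], the term of index [k] is at most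
    [M * q ^+ k]. *)
Lemma psum_tail_le c (r q M : R) m n z : 0 <= q < 1 ->
  (forall k, modc (c k) * r ^+ k <= M) -> modc z = q * r -> (m <= n)%N ->
  modc (psum c n z - psum c m z) <= M * (q ^+ m * (1 - q)^-1).
Proof.
move=> q01 cM zq mn; rewrite psum_shift//.
have M0 : 0 <= M by have := cM 0; apply: le_trans; rewrite expr0 mulr1 modc_ge0.
apply: le_trans (modc_sum _ _ _) _.
apply: (@le_trans _ _ (\sum_(m <= k < n) M * q ^+ k)).
  apply: ler_sum => k _; rewrite modcM modcX zq exprMn mulrCA mulrC.
  by rewrite ler_wpM2r// exprn_ge0//; case/andP: q01.
by rewrite -mulr_sumr ler_wpM2l// sum_geometric_shift_le.
Qed.

Lemma cvg_psum_tail c (r q M : R) n z (l : C) : 0 <= q < 1 ->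
  (forall k, modc (c k) * r ^+ k <= M) -> modc z = q * r ->
  ((psum c)^~ z : nat -> C^o) @ \oo --> (l : C^o) ->
  modc (l - psum c n z) <= M * (q ^+ n * (1 - q)^-1).
Proof.
move=> q01 cM zq cl; pose proof (h := cvgCB cl (@cvgC_cst _ _ _ _ (psum c n z))).
apply: (cvgC_modc_le h).
by exists n => // N /= nN; exact: (psum_tail_le q01 cM zq).
Qed.

Lemma cvg_geometric_tail (M q : R) : 0 <= q < 1 ->
  M * (q ^+ n * (1 - q)^-1) @[n --> \oo] --> (0 : R).
Proof.
case/andP=> q0 q1; have -> : 0 = M * (0 * (1 - q)^-1) by rewrite mul0r mulr0.
by apply: cvgMr; apply: cvgMl; apply: cvg_expr; rewrite ger0_norm.
Qed.

Lemma in_disk_radius (z : C) : in_disk z ->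
  exists r q : R, [/\ 0 < r, r < 1, 0 <= q < 1 & modc z = q * r].
Proof.
(* The midpoint of [modc z] and 1 leaves room for a ratio [q < 1] inside and stays within the
   disk. *)
move=> z1; exists ((1 + modc z) / 2), (modc z / ((1 + modc z) / 2)).
have := modc_ge0 z; move: z1; rewrite /in_disk; set s := modc z => s1 s0.
have p : 0 < (1 + s) / 2 by lra.
split; [by []|lra| |by rewrite mulfVK// gt_eqF].
by rewrite divr_ge0 ?(ltW p)//= ltr_pdivrMr//; lra.
Qed.

Lemma modc_psum_le c (r q M : R) n z : 0 <= q < 1 ->
  (forall k, modc (c k) * r ^+ k <= M) -> modc z <= q * r ->
  modc (psum c n z) <= M * (1 - q)^-1.
Proof.
move=> q01 cM zq; have q0 : 0 <= q by case/andP: q01.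
have M0 : 0 <= M by have := cM 0; apply: le_trans; rewrite expr0 mulr1 modc_ge0.
apply: le_trans (modc_sum _ _ _) _.
apply: (@le_trans _ _ (\sum_(0 <= k < n) M * q ^+ k)).
  apply: ler_sum => k _; rewrite modcM modcX.
  apply: (@le_trans _ _ (modc (c k) * (q * r) ^+ k)).
    by rewrite ler_wpM2l ?modc_ge0// lerXn2r// ?nnegrE ?modc_ge0// (le_trans (modc_ge0 z)).
  by rewrite exprMn mulrCA mulrC ler_wpM2r// exprn_ge0.
by rewrite -mulr_sumr ler_wpM2l// sum_geometric_le.
Qed.

(** One constant serves all partial sums and their limit; it is the majorant whenever a mean over an
    inner circle is computed from the means of the partial sums. *)
Lemma has_coefs_locally_bounded f c (s : R) : has_coefs f c -> 0 <= s < 1 ->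
  exists M : R, (forall n z, modc z <= s -> modc (psum c n z) <= M) /\
    (forall z, modc z <= s -> modc (f z) <= M).
Proof.
move=> fc s01; have ds : in_disk s%:C by rewrite -[s%:C]mulr1 -expi0; exact: in_disk_circle.
have [r [q [r0 r1 q01 sE]]] := in_disk_radius ds.
have {}sE : s = q * r by rewrite -sE modc_real ger0_norm//; case/andP: s01.
have [|M [M0 cM]] := @has_coefs_bounded f c r fc; first by rewrite ltW.
have pM n z : modc z <= s -> modc (psum c n z) <= M * (1 - q)^-1.
  by rewrite sE => /(modc_psum_le n q01 cM).
exists (M * (1 - q)^-1); split=> // z zs.
apply: (@cvgC_modc_le _ _ \oo _ (fun n => psum c n z)).
  by apply: fc; rewrite /in_disk (le_lt_trans zs)//; case/andP: s01.
by apply: nearW => n; exact: pM.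
Qed.

Lemma psum_circle c n (r t : R) :
  psum c n (r%:C * expi t) = psum (fun k => c k * r%:C ^+ k) n (expi t).
Proof. by apply: eq_bigr => k _; rewrite exprMn mulrA. Qed.

Lemma circle_measurable_psum c n : circle_measurableC (fun t : R => psum c n (expi t)).
Proof.
apply: circle_measurableC_sum => k; apply: circle_measurableCM.
  exact: circle_measurableC_cst.
by apply: circle_measurableCX; exact: circle_measurableC_expi.
Qed.

Lemma modc_psum_circle c n (t : R) :
  modc (psum c n (expi t)) <= \sum_(0 <= k < n) modc (c k).
Proof.
apply: le_trans (modc_sum _ _ _) _; apply: ler_sum => k _.
by rewrite modcM modcX modc_expi expr1n mulr1.
Qed.

Lemma circle_measurable_expiX k : circle_measurableC (fun t : R => (expi t ^+ k)^*).
Proof.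
by apply/circle_measurableCJ/circle_measurableCX; exact: circle_measurableC_expi.
Qed.

Lemma modc_expiXJ k (t : R) : modc (expi t ^+ k)^* = 1.
Proof. by rewrite modcJ modcX modc_expi expr1n. Qed.

Lemma circle_meanC_psum c n k :
  circle_meanC (fun t : R => psum c n (expi t) * (expi t ^+ k)^*) =
  if (k < n)%N then c k else 0.
Proof.
have ii (j : nat) : circle_integrableC (fun t : R => expi t ^+ j * (expi t ^+ k)^*).
  apply: (@circle_boundedC_integrable _ 1).
    apply: circle_measurableCM; last exact: circle_measurable_expiX.
    by apply: circle_measurableCX; exact: circle_measurableC_expi.
  by move=> t _; rewrite modcM modc_expiXJ modcX modc_expi expr1n mulr1.
under eq_circle_meanC do rewrite /psum mulr_suml.
rewrite (@circle_meanC_sum _ _ _ (fun j t => c j * expi t ^+ j * (expi t ^+ k)^*)).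
  rewrite -(@eq_bigr _ _ _ _ _ _ (fun j => c j * (j == k)%:R)) => [|j _]; last first.
    under [RHS]eq_circle_meanC do rewrite -mulrA.
    by rewrite circle_meanCZ// circle_meanC_expi.
  case: ifPn => kn.
    rewrite (bigD1_seq k)//= ?iota_uniq ?mem_index_iota// eqxx mulr1 big1 ?addr0//.
    by move=> j /negbTE ->; rewrite mulr0.
  rewrite big_nat_cond big1// => j /andP[/andP[_ jn] _].
  by rewrite (_ : (j == k) = false) ?mulr0//; apply: contraNF kn => /eqP <-.
by move=> j; under eq_fun do rewrite -mulrA; exact: circle_integrableCZ.
Qed.

Lemma circle_meanC_psum2 c d n :
  circle_meanC (fun t : R => psum c n (expi t) * (psum d n (expi t))^*) =
  \sum_(0 <= k < n) c k * (d k)^*.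
Proof.
have ii j : circle_integrableC (fun t : R => psum c n (expi t) * (expi t ^+ j)^*).
  apply: (@circle_boundedC_integrable _ (\sum_(0 <= k < n) modc (c k))).
    apply: circle_measurableCM; last exact: circle_measurable_expiX.
    exact: circle_measurable_psum.
  by move=> t _; rewrite modcM modc_expiXJ mulr1 modc_psum_circle.
have E t : psum c n (expi t) * (psum d n (expi t))^* =
    \sum_(0 <= k < n) (d k)^* * (psum c n (expi t) * (expi t ^+ k)^*).
  rewrite {2}/psum rmorph_sum mulr_sumr; apply: eq_bigr => k _.
  by rewrite rmorphM mulrCA.
rewrite (eq_circle_meanC E) circle_meanC_sum => [|j]; last exact: circle_integrableCZ.
rewrite big_nat [RHS]big_nat; apply: eq_bigr => k /andP[_ kn].
by rewrite circle_meanCZ// circle_meanC_psum kn mulrC.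
Qed.

Lemma circle_mean_psum c n :
  circle_mean (fun t : R => modc (psum c n (expi t)) ^+ 2) =
  \sum_(0 <= k < n) modc (c k) ^+ 2.
Proof.
apply: complexI; rewrite -circle_meanC_real.
under eq_circle_meanC do rewrite -mulcJ.
by rewrite circle_meanC_psum2 rmorph_sum; apply: eq_bigr => k _; rewrite mulcJ.
Qed.

Section Circle.
Variables (f : C -> C) (c : nat -> C) (r : R).
Hypotheses (fc : has_coefs f c) (r01 : 0 <= r < 1).

Lemma circle_measurable_coefs : circle_measurableC (fun t => f (r%:C * expi t)).
Proof.
apply: (@circle_measurableC_cvg _ (fun n t => psum c n (r%:C * expi t))).
  by move=> n; under eq_fun do rewrite psum_circle; exact: circle_measurable_psum.
by move=> t _; apply: fc; exact: in_disk_circle.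
Qed.

(** Cauchy's coefficient formula: the corresponding mean of the partial sum with [n] terms is
    constant in [n] once [k < n]. *)
Lemma circle_meanC_coefs k :
  circle_meanC (fun t => f (r%:C * expi t) * (expi t ^+ k)^*) = c k * r%:C ^+ k.
Proof.
have [M [pM fM]] := has_coefs_locally_bounded fc r01.
have r0 : 0 <= r by case/andP: r01.
apply: (@cvgC_unique _ _ \oo _ (fun n => circle_meanC (fun t =>
  psum c n (r%:C * expi t) * (expi t ^+ k)^*))).
  apply: (@circle_meanC_bounded _ M) => [n|t _|n t _].
  - under eq_fun do rewrite psum_circle; apply: circle_measurableCM.
      exact: circle_measurable_psum.
    exact: circle_measurable_expiX.
  - exact: (cvgCM (fc (in_disk_circle t r01)) (@cvgC_cst _ _ _ _ _)).
  - by rewrite modcM modc_expiXJ mulr1 pM// modc_circle.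
apply: cvgC_near_eq (@cvgC_cst _ _ _ _ _); exists k.+1 => // n /= kn.
under eq_circle_meanC do rewrite psum_circle.
by rewrite circle_meanC_psum kn.
Qed.

(** Parseval's identity on the circle of radius [r], carried from the partial sums to [f] by bounded
    convergence. *)
Lemma circle_mean_coefs :
  \sum_(0 <= k < n) modc (c k) ^+ 2 * r ^+ (2 * k) @[n --> \oo] -->
  circle_mean (fun t => modc (f (r%:C * expi t)) ^+ 2).
Proof.
have [M [pM fM]] := has_coefs_locally_bounded fc r01.
have r0 : 0 <= r by case/andP: r01.
have [||||_ cm] := @circle_mean_dominated _
  (fun n t => modc (psum c n (r%:C * expi t)) ^+ 2)
  (fun t => modc (f (r%:C * expi t)) ^+ 2) (fun=> M ^+ 2).
- move=> n; apply: circle_measurableC_sqr.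
  by under eq_fun do rewrite psum_circle; exact: circle_measurable_psum.
- apply: aeW => t _; pose proof (h := cvg_modc (fc (in_disk_circle t r01))).
  by rewrite expr2; under eq_fun do rewrite expr2; exact: cvgM.
- apply: (@circle_bounded_integrable _ `|M ^+ 2|) => //.
- apply: aeW => t n _; rewrite ger0_norm ?sqr_ge0// lerXn2r ?nnegrE ?modc_ge0//.
    by apply: le_trans (modc_ge0 _) (pM 0%N 0 _); rewrite modc0.
  by rewrite pM// modc_circle.
move: cm; apply: cvg_trans; apply: near_eq_cvg; apply: nearW => n.
under eq_circle_mean do rewrite psum_circle.
rewrite circle_mean_psum; apply: eq_bigr => k _.
by rewrite modcM modcX modc_real ger0_norm// exprMn -exprM mulnC.
Qed.

End Circle.

Lemma has_coefs_unique f c d : has_coefs f c -> has_coefs f d -> c =1 d.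
Proof.
move=> fc fd k; have h2 : (0 <= (2^-1 : R) < 1) by apply/andP; split; lra.
have := circle_meanC_coefs fc h2 k; rewrite (circle_meanC_coefs fd h2 k).
move/mulIf => -> //; rewrite expf_neq0// -modc_eq0 modc_real normr_eq0.
by rewrite invr_eq0 pnatr_eq0.
Qed.

End PowerSeries.

(** * Limits and products of power series; [H2] in terms of coefficients *)

Section AnalyticFunctions.
Variable R : realType.
Local Notation C := R[i].
Local Notation modc := (@Normc.normc R).
Implicit Types (c d : nat -> C) (f g : C -> C).

(* Vitali's theorem in the easy case where pointwise convergence is given: the
   Cauchy formula on a fixed circle makes the coefficients converge. *)
Lemma has_coefs_limit (f_ : nat -> C -> C) (c_ : nat -> nat -> C) f :
  (forall m, has_coefs (f_ m) (c_ m)) ->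
  (forall z, in_disk z -> (f_ m z : C^o) @[m --> \oo] --> (f z : C^o)) ->
  (forall r : R, 0 <= r < 1 ->
    exists M : R, forall m z, modc z <= r -> modc (f_ m z) <= M) ->
  exists c, has_coefs f c /\
    (forall k, (c_ m k : C^o) @[m --> \oo] --> (c k : C^o)).
Proof.
move=> fc ff fM.
have cl (r : R) k : 0 < r < 1 -> exists l : C,
    (c_ m k : C^o) @[m --> \oo] --> (l : C^o).
  move=> /andP[r0 r1]; have r01 : 0 <= r < 1 by rewrite ltW.
  have [M bM] := fM _ r01.
  have rk0 : r%:C ^+ k != 0 by rewrite expf_neq0// -modc_eq0 modc_real normr_eq0 gt_eqF.
  pose g t := f (r%:C * expi t) * (expi t ^+ k)^*.
  exists (circle_meanC g * (r%:C ^+ k)^-1).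
  have h : (circle_meanC (fun t => f_ m (r%:C * expi t) * (expi t ^+ k)^*) : C^o)
      @[m --> \oo] --> (circle_meanC g : C^o).
    apply: (@circle_meanC_bounded _ M) => [m|t _|m t _].
    - apply: circle_measurableCM; last exact: circle_measurable_expiX.
      exact: circle_measurable_coefs (fc m) r01.
    - exact: (cvgCM (ff _ (in_disk_circle t r01)) (@cvgC_cst _ _ _ _ _)).
    - by rewrite modcM modc_expiXJ mulr1 bM// modc_circle// ltW.
  apply: cvgC_near_eq (cvgCM h (@cvgC_cst _ _ _ _ (r%:C ^+ k)^-1)).
  by apply: nearW => m; rewrite (circle_meanC_coefs (fc m) r01) mulfK.
(* The limit of the coefficients does not depend on the circle on which it is computed, so one
   arbitrary radius is enough here. *)
have h2 : (0 < (2^-1 : R) < 1) by apply/andP; split; lra.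
have {h2}cl k : exists l : C, (c_ m k : C^o) @[m --> \oo] --> (l : C^o) by exact: cl h2.
have [c cc] := choice cl; exists c; split => // z z1.
have [r [q [r0 r1 q01 zE]]] := in_disk_radius z1.
have r01 : 0 <= r < 1 by rewrite ltW.
have [M bM] := fM _ r01.
(* Cauchy's estimate on the circle of radius [r], uniform in [m]. *)
have cM m k : modc (c_ m k) * r ^+ k <= M.
  have -> : modc (c_ m k) * r ^+ k = modc (c_ m k * r%:C ^+ k).
    by rewrite modcM modcX modc_real ger0_norm// ltW.
  rewrite -(circle_meanC_coefs (fc m) r01); apply: circle_meanC_le => [|t _].
    apply: (@circle_boundedC_integrable _ M) => [|t _].
      apply: circle_measurableCM; last exact: circle_measurable_expiX.
      exact: circle_measurable_coefs (fc m) r01.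
    by rewrite modcM modc_expiXJ mulr1 bM// modc_circle// ltW.
  by rewrite modcM modc_expiXJ mulr1 bM// modc_circle// ltW.
(* For fixed [n] the tail of [f_ m] is bounded independently of [m]; letting [m] tend to infinity
   first gives the same bound for [f z - psum c n z]. *)
apply: (@cvgC_squeeze _ _ _ _ _ _ (fun n => M * (q ^+ n * (1 - q)^-1))); last first.
  exact: cvg_geometric_tail.
apply: nearW => n; rewrite modcB.
have pc : (psum (c_ m) n z : C^o) @[m --> \oo] --> (psum c n z : C^o).
  by apply: cvgC_sum => k; exact: (cvgCM (cc k) (@cvgC_cst _ _ _ _ _)).
pose proof (h := cvgCB (ff z z1) pc).
apply: (cvgC_modc_le h); apply: nearW => m.
exact: cvg_psum_tail q01 (cM m) zE (fc m z z1).
Qed.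

Lemma has_coefs_poly (p : {poly C}) : has_coefs (horner p) (fun k => p`_k).
Proof.
move=> z _; apply: cvgC_near_eq (@cvgC_cst _ _ _ _ _).
exists (size p) => // n /= pn; rewrite /psum big_mkord.
by rewrite (horner_coef_wide _ pn).
Qed.

Lemma psum_poly c n z : psum c n z = (\poly_(k < n) c k).[z].
Proof. by rewrite horner_poly /psum big_mkord. Qed.

Lemma has_coefsD f g c d : has_coefs f c -> has_coefs g d ->
  has_coefs (fun z => f z + g z) (fun k => c k + d k).
Proof.
move=> fc gd z z1; apply: cvgC_near_eq (cvgCD (fc z z1) (gd z z1)).
by apply: nearW => n; rewrite /psum -big_split/=; under eq_bigr do rewrite mulrDl.
Qed.

Lemma has_coefsZ f c (a : C) : has_coefs f c ->
  has_coefs (fun z => a * f z) (fun k => a * c k).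
Proof.
move=> fc z z1; apply: cvgC_near_eq (cvgCM (@cvgC_cst _ _ _ _ a) (fc z z1)).
by apply: nearW => n; rewrite /psum mulr_sumr; under eq_bigr do rewrite -mulrA.
Qed.

Lemma eq_has_coefs f g c d : (forall z, in_disk z -> f z = g z) -> c =1 d ->
  has_coefs g d -> has_coefs f c.
Proof.
move=> fg cd gd z z1; rewrite fg//; apply: cvgC_near_eq (gd z z1).
by apply: nearW => n; apply: eq_bigr => k _; rewrite cd.
Qed.

(** Products of partial sums are polynomials, locally bounded and pointwise convergent, so
    [has_coefs_limit] yields the power series without summing a Cauchy product. *)
Lemma analytic_diskM f g : analytic_disk f -> analytic_disk g ->
  analytic_disk (fun z => f z * g z).
Proof.
move=> [c fc] [d gd].
have [|||e [he _]] := @has_coefs_limit (fun n z => psum c n z * psum d n z)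
  (fun n k => (\poly_(k < n) c k * \poly_(k < n) d k)`_k) (fun z => f z * g z).
- move=> n z z1; have := @has_coefs_poly (\poly_(k < n) c k * \poly_(k < n) d k) z z1.
  by rewrite hornerM -!psum_poly.
- by move=> z z1; exact: (cvgCM (fc z z1) (gd z z1)).
- move=> r r01; have [M [pM _]] := has_coefs_locally_bounded fc r01.
  have [N [pN _]] := has_coefs_locally_bounded gd r01.
  exists (M * N) => m z zr; rewrite modcM ler_pM ?modc_ge0//; first exact: pM.
  exact: pN.
by exists e.
Qed.

Lemma cvgC_shiftS (u : nat -> C) (l : C) : (u n.+1 : C^o) @[n --> \oo] --> (l : C^o) ->
  (u n : C^o) @[n --> \oo] --> (l : C^o).
Proof.
by move=> /cvgC_ReIm[a b]; apply/cvgC_ReIm; split; rewrite -cvg_shiftS.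
Qed.

Lemma has_coefs_shift f c : has_coefs f c ->
  has_coefs (fun z => z * f z) (fun k => if k is j.+1 then c j else 0).
Proof.
move=> fc z z1; apply: cvgC_shiftS.
apply: cvgC_near_eq (cvgCM (@cvgC_cst _ _ _ _ z) (fc z z1)).
apply: nearW => n; rewrite /psum big_nat_recl// mul0r add0r mulr_sumr.
by apply: eq_bigr => k _; rewrite exprS mulrCA.
Qed.

Lemma has_coefs0 f c : has_coefs f c -> c 0%N = f 0.
Proof.
move=> fc; have d0 : in_disk (0 : C) by rewrite /in_disk modc0 ltr01.
apply: (@cvgC_unique _ _ \oo _ (fun n => psum c n 0)); last exact: fc.
apply: cvgC_near_eq (@cvgC_cst _ _ _ _ _); exists 1%N => // -[//|n] _.
rewrite /psum big_nat_recl// expr0 mulr1 big1 ?addr0// => k _.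
by rewrite exprS mul0r mulr0.
Qed.

Definition l2_le (M : R) c := forall n, \sum_(0 <= k < n) modc (c k) ^+ 2 <= M.

Lemma abs_summable_cvg (u : nat -> R) (M : R) :
  (forall n, \sum_(0 <= k < n) `|u k| <= M) ->
  exists l : R, \sum_(0 <= k < n) u k @[n --> \oo] --> l.
Proof.
move=> uM; suff : cvgn (series u) by move=> /cvg_ex[l ?]; exists l.
apply: normed_cvg; apply: nondecreasing_is_cvgn.
  apply/nondecreasing_seqP => n; rewrite -subr_ge0.
  have -> : [normed series u] n.+1 = [normed series u] n + `|u n|.
    by rewrite /series [LHS]big_nat_recr.
  by rewrite addrAC subrr add0r.
by exists M => _ [n _ <-]; exact: uM.
Qed.

Lemma abs_summable_cvgC (d : nat -> C) (M : R) :
  (forall n, \sum_(0 <= k < n) modc (d k) <= M) ->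
  exists l : C, (\sum_(0 <= k < n) d k : C^o) @[n --> \oo] --> (l : C^o).
Proof.
move=> dM.
have [|l ll] := @abs_summable_cvg (fun k => complex.Re (d k)) M.
  by move=> n; apply: le_trans (dM n); apply: ler_sum => k _; exact: Re_le_modc.
have [|m mm] := @abs_summable_cvg (fun k => complex.Im (d k)) M.
  by move=> n; apply: le_trans (dM n); apply: ler_sum => k _; exact: Im_le_modc.
exists (l +i* m); apply/cvgC_ReIm; split.
  rewrite (_ : (fun _ => _) = fun n => \sum_(0 <= k < n) complex.Re (d k))//.
  by apply/funext => n; exact: (big_morph (@complex.Re R) (@cReD R) erefl).
rewrite (_ : (fun _ => _) = fun n => \sum_(0 <= k < n) complex.Im (d k))//.
by apply/funext => n; exact: (big_morph (@complex.Im R) (@cImD R) erefl).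
Qed.

Lemma bounded_has_coefs (M : R) c : (forall k, modc (c k) <= M) ->
  exists f, has_coefs f c.
Proof.
move=> cM.
have cz z : exists l : C, in_disk z -> ((psum c)^~ z : nat -> C^o) @ \oo --> (l : C^o).
  have [z1|z1] := ltP (modc z) 1; last by exists 0; rewrite /in_disk ltNge z1.
  have B n : \sum_(0 <= k < n) modc (c k * z ^+ k) <= M * (1 - modc z)^-1.
    apply: (@le_trans _ _ (\sum_(0 <= k < n) M * modc z ^+ k)).
      apply: ler_sum => k _; rewrite modcM modcX ler_wpM2r//.
      by rewrite exprn_ge0 ?modc_ge0.
    rewrite -mulr_sumr ler_wpM2l ?sum_geometric_le ?modc_ge0//.
    exact: le_trans (modc_ge0 _) (cM 0%N).
  by have [l ll] := abs_summable_cvgC B; exists l.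
by have [f fc] := choice cz; exists f.
Qed.

Lemma l2_le_modc (M : R) c k : l2_le M c -> modc (c k) <= Num.sqrt M.
Proof.
move=> cM; rewrite -[leLHS]ger0_norm ?modc_ge0// -sqrtr_sqr ler_wsqrtr//.
apply: le_trans (cM k.+1); rewrite big_nat_recr//= lerDr.
by apply: sumr_ge0 => j _; exact: sqr_ge0.
Qed.

Lemma mem_H2 f c (M : R) : has_coefs f c -> (forall z, ~ in_disk z -> f z = 0) ->
  l2_le M c -> H2 f.
Proof.
move=> fc f0 cM; split; [by exists c|exact: f0|exists M => r r01].
pose proof (h := circle_mean_coefs fc r01); rewrite -(cvg_lim _ h)//.
apply: limr_le; first exact: cvgP h.
apply: nearW => n; apply: le_trans (cM n); apply: ler_sum => k _.
case/andP: r01 => r0 r1.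
by rewrite ler_piMr ?sqr_ge0// exprn_ile1// ltW.
Qed.

(** Parseval bounds every finite sum with the weights [r ^+ (2 * k)]; letting [r] run through the
    values 1 - 1/(j + 1) removes the weights. *)
Lemma H2_coefs_bound f c (M : R) : has_coefs f c ->
  (forall r : R, 0 <= r < 1 ->
    circle_mean (fun t => modc (f (r%:C * expi t)) ^+ 2) <= M) -> l2_le M c.
Proof.
move=> fc fM n.
have B (r : R) : 0 <= r < 1 -> \sum_(0 <= k < n) modc (c k) ^+ 2 * r ^+ (2 * k) <= M.
  move=> r01; apply: le_trans (fM r r01).
  pose proof (h := circle_mean_coefs fc r01); rewrite -(cvg_lim _ h)//.
  apply: nondecreasing_cvgn_le; last exact: cvgP h.
  apply/nondecreasing_seqP => m; rewrite big_nat_recr//= lerDl.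
  by rewrite mulr_ge0 ?sqr_ge0// exprn_ge0//; case/andP: r01.
pose s (j : nat) : R := 1 - j.+1%:R^-1.
have s01 j : 0 <= s j < 1.
  by rewrite subr_ge0 invf_le1 ?ler1n//= ltrBlDr ltrDl invr_gt0 ltr0n.
have s1 : s j @[j --> \oo] --> (1 : R).
  rewrite -[X in _ --> X]subr0; apply: cvgB; first exact: cvg_cst.
  exact: cvg_harmonic.
have h : \sum_(0 <= k < n) modc (c k) ^+ 2 * s j ^+ (2 * k) @[j --> \oo]
    --> \sum_(0 <= k < n) modc (c k) ^+ 2.
  rewrite -[X in _ --> X](@eq_bigr _ _ _ _ _ _ (fun k => modc (c k) ^+ 2 * 1 ^+ (2 * k))).
    elim: (index_iota 0 n) => [|k ks IH].
      by under eq_fun do rewrite big_nil; rewrite big_nil; exact: cvg_cst.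
    under eq_fun do rewrite big_cons; rewrite big_cons; apply: cvgD => //.
    apply: cvgMr; have : continuous (fun x : R => x ^+ (2 * k)) by exact: exprn_continuous.
    by move=> /(_ 1); apply: cvg_comp.
  by move=> k _; rewrite expr1n mulr1.
rewrite -(cvg_lim _ h)//; apply: limr_le; first exact: cvgP h.
by apply: nearW => j; exact: B.
Qed.

Lemma H2_coefs f : H2 f -> exists c M, has_coefs f c /\ l2_le M c.
Proof.
by case=> -[c fc] _ [M fM]; exists c, M; split => //; exact: H2_coefs_bound fc fM.
Qed.

(** Restores the normalisation built into [H2] for functions that are given by a formula, or whose
    values off the disk are arbitrary. *)
Definition cutoff f (z : C) : C := if modc z < 1 then f z else 0.

Lemma cutoff_in f z : in_disk z -> cutoff f z = f z.
Proof. by rewrite /cutoff /in_disk => ->. Qed.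

Lemma cutoff_out f z : ~ in_disk z -> cutoff f z = 0.
Proof. by rewrite /cutoff /in_disk; case: ifP. Qed.

Lemma has_coefs_cutoff f c : has_coefs f c -> has_coefs (cutoff f) c.
Proof. by apply: eq_has_coefs => // z z1; exact: cutoff_in. Qed.

(** The Riesz-Fischer direction: it produces elements of [H2] with prescribed coefficients, such as
    Toeplitz images and backward shifts. *)
Lemma l2_H2 (M : R) c : l2_le M c -> exists f, H2 f /\ has_coefs f c.
Proof.
move=> cM; have [f fc] := bounded_has_coefs (fun k => l2_le_modc k cM).
exists (cutoff f); split; last exact: has_coefs_cutoff.
exact: mem_H2 (has_coefs_cutoff fc) (@cutoff_out f) cM.
Qed.

Lemma H2_bounded f c (M : R) : has_coefs f c ->
  (forall z, ~ in_disk z -> f z = 0) ->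
  (forall z, in_disk z -> modc (f z) <= M) -> H2 f /\ l2_le (M ^+ 2) c.
Proof.
move=> fc f0 fM; have cM : l2_le (M ^+ 2) c.
  have M0 : 0 <= M.
    by apply: le_trans (modc_ge0 _) (fM 0 _); rewrite /in_disk modc0 ltr01.
  apply: (H2_coefs_bound fc) => r r01; rewrite -[leRHS]circle_mean_cst.
  have mf := circle_measurableC_sqr (circle_measurable_coefs fc r01).
  have B t : modc (f (r%:C * expi t)) ^+ 2 <= M ^+ 2.
    by rewrite lerXn2r ?nnegrE ?modc_ge0// fM//; exact: in_disk_circle.
  apply: circle_mean_le => //; last exact: circle_integrable_cst.
  apply/circle_integrableW/(@circle_bounded_integrable _ (M ^+ 2)) => // t _.
  by rewrite ger0_norm ?sqr_ge0.
by split => //; exact: mem_H2 cM.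
Qed.

End AnalyticFunctions.

(** * Boundary functions as L2 limits *)

Section RapidlyCauchy.
Variable R : realType.
Local Notation C := R[i].
Local Notation modc := (@Normc.normc R).
Local Notation mu := (@lebesgue_measure R).
Local Notation D := (`[0 : R, pi *+ 2]%classic).

(** Cauchy-Schwarz with the weights 2^-(k+1), whose sum is at most 1; here by induction from (x +
    y)^2 <= 2 x^2 + 2 y^2. *)
Lemma sqr_sum_le (x : nat -> R) n :
  (\sum_(0 <= k < n) x k) ^+ 2 <= \sum_(0 <= k < n) 2 ^+ k.+1 * x k ^+ 2.
Proof.
elim: n x => [|n IH] x; first by rewrite !big_geq// expr0n.
rewrite !big_nat_recl//; set X := \sum_(0 <= _ < n) _.
have -> : \sum_(0 <= i < n) 2 ^+ i.+2 * x i.+1 ^+ 2 =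
    2 * \sum_(0 <= i < n) 2 ^+ i.+1 * x i.+1 ^+ 2.
  by rewrite mulr_sumr; apply: eq_bigr => i _; rewrite [in LHS]exprS mulrA.
have := IH (fun i => x i.+1); rewrite -/X; set Y := \sum_(0 <= _ < n) _ => XY.
by have := sqr_ge0 (x 0%N - X); rewrite !expr2 in XY *; nra.
Qed.

Lemma modc_sqrD_le (x y : C) : modc (x + y) ^+ 2 <= 2 * modc x ^+ 2 + 2 * modc y ^+ 2.
Proof.
have h : modc (x + y) ^+ 2 <= (modc x + modc y) ^+ 2.
  by rewrite lerXn2r ?nnegrE ?addr_ge0 ?modc_ge0// modcD.
by apply: le_trans h _; have := sqr_ge0 (modc x - modc y); rewrite !expr2; nra.
Qed.

Lemma circle_integralE (u : R -> R) : mu.-integrable D (EFin \o u) ->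
  (\int[mu]_(t in D) (u t)%:E = ((pi *+ 2) * circle_mean u)%:E)%E.
Proof.
move=> iu; rewrite /circle_mean mulrA divff ?mul1r; last by rewrite gt_eqF ?pi2_gt0.
by rewrite fineK//; exact: integrable_fin_num.
Qed.

Variable s_ : nat -> R -> C.
Hypothesis ms : forall n, circle_measurableC (s_ n).
Hypothesis bs : forall n, exists M : R, forall t, modc (s_ n t) <= M.
Hypothesis cs : forall n,
  circle_mean (fun t => modc (s_ n.+1 t - s_ n t) ^+ 2) <= 4^-1 ^+ n.+1.

Let d n t := s_ n.+1 t - s_ n t.
(** The summands of [sqr_sum_le]. The rate 1/4 in the hypothesis leaves room for these weights: the
    means of [w n] are still at most [2^-1 ^+ n.+1]. *)
Let w n t : R := 2 ^+ n.+1 * modc (d n t) ^+ 2.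

Let md n : circle_measurableC (d n).
Proof.
rewrite /d; apply: circle_measurableCD => //.
rewrite (_ : (fun t => - s_ n t) = fun t => (- 1) * s_ n t).
  by apply: circle_measurableCM => //; exact: circle_measurableC_cst.
by apply/funext => t; rewrite mulN1r.
Qed.

Let mw n : measurable_fun D (w n).
Proof.
apply: measurable_funM; first exact: measurable_cst.
exact: circle_measurableC_sqr.
Qed.

Let sqr_bounded_integrable (u : R -> C) (M : R) : circle_measurableC u ->
  (forall t, modc (u t) <= M) -> mu.-integrable D (EFin \o (fun t => modc (u t) ^+ 2)).
Proof.
move=> mu_ uM; apply: (@circle_bounded_integrable _ (M ^+ 2)).
  exact: circle_measurableC_sqr.
move=> t _; rewrite ger0_norm ?sqr_ge0// lerXn2r ?nnegrE ?modc_ge0//.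
exact: le_trans (modc_ge0 _) (uM 0).
Qed.

Let id2 n : mu.-integrable D (EFin \o (fun t => modc (d n t) ^+ 2)).
Proof.
have [M sM] := bs n; have [N sN] := bs n.+1.
apply: (@sqr_bounded_integrable _ (N + M)) => // t.
by rewrite (le_trans (modcD _ _))// lerD ?modcN.
Qed.

Let W t : \bar R := (\sum_(0 <= k <oo) (w k t)%:E)%E.

Let w0 n t : 0 <= w n t.
Proof. by apply: mulr_ge0; [apply: exprn_ge0|exact: sqr_ge0]. Qed.

Let integral_w n : (\int[mu]_(t in D) (w n t)%:E <= ((pi *+ 2) * 2^-1 ^+ n.+1)%:E)%E.
Proof.
have iw : mu.-integrable D (EFin \o w n).
  rewrite (_ : _ \o _ = fun t => (2 ^+ n.+1)%R%:E *
    (modc (d n t) ^+ 2)%R%:E)%E//.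
  by apply: integrableZl => //; exact: id2.
rewrite circle_integralE// lee_fin circle_meanZ; last exact/circle_integrableW/id2.
rewrite ler_wpM2l ?(ltW (pi2_gt0 R))//.
apply: (@le_trans _ _ (2 ^+ n.+1 * 4^-1 ^+ n.+1)).
  by rewrite ler_wpM2l ?exprn_ge0// cs.
rewrite -exprMn (_ : 2 * 4^-1 = 2^-1 :> R)//.
by field.
Qed.

(** Sum and integral are exchanged for nonnegative terms, and the geometric bounds on the integrals
    of [w n] add up to at most [pi *+ 2]. *)
Let iW : mu.-integrable D W.
Proof.
apply/integrableP; split.
  apply: (@ge0_emeasurable_sum _ _ _ _ _ xpredT) => [k x _ _|k _].
    by rewrite lee_fin w0.
  by apply/measurable_EFinP; exact: mw.
under eq_integral => t _.
  rewrite gee0_abs; last by apply: nneseries_ge0 => k _ _; rewrite lee_fin w0.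
  over.
rewrite integral_nneseries//; last 2 first.
- by move=> n; apply/measurable_EFinP; exact: mw.
- by move=> n t _; rewrite lee_fin w0.
apply: (@le_lt_trans _ _ (pi *+ 2)%:E); last by rewrite ltry.
apply: lime_le.
  by apply: is_cvg_nneseries => n _ _; apply: integral_ge0 => t _; rewrite lee_fin w0.
apply: nearW => n; apply: (@le_trans _ _ (\sum_(0 <= k < n) ((pi *+ 2) * 2^-1 ^+ k.+1)%:E)%E).
  by apply: lee_sum => k _; exact: integral_w.
rewrite sumEFin lee_fin -mulr_sumr ler_piMr ?(ltW (pi2_gt0 R))//.
under eq_bigr do rewrite exprS.
rewrite -mulr_sumr; have := @sum_geometric_le R 2^-1 n.
have h2 : (0 <= (2^-1 : R) < 1) by apply/andP; split; lra.
move=> /(_ h2); have -> : (1 - 2^-1 : R)^-1 = 2 by field.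
by move=> h; lra.
Qed.

(** Where [W] is finite, the squared partial sums of the moduli of the increments are at most [W].
    Hence the increments are absolutely summable there, and [2 * modc (s_ 0 t) ^+ 2 + 2 * W t]
    dominates all [modc (s_ n t) ^+ 2]. *)
Lemma rapidly_cauchy_limit : exists (u : R -> C) (g : R -> R),
  [/\ mu.-integrable D (EFin \o g),
      {ae mu, forall t, D t -> (s_ n t : C^o) @[n --> \oo] --> (u t : C^o)} &
      {ae mu, forall t n, D t -> modc (s_ n t) ^+ 2 <= g t}].
Proof.
have Wfin : {ae mu, forall t, D t -> W t \is a fin_num}.
  by apply: integrable_ae; [exact: measurable_itv|exact: iW].
have partial t n : W t \is a fin_num ->
    (\sum_(0 <= k < n) modc (d k t)) ^+ 2 <= fine (W t).
  move=> fW; apply: le_trans (sqr_sum_le _ _) _; rewrite -lee_fin fineK// -sumEFin.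
  by apply: (@nneseries_lim_ge R (fun k => (w k t)%:E) xpredT 0 n) => k _ _; rewrite lee_fin w0.
have sE n t : s_ n t = s_ 0%N t + \sum_(0 <= k < n) d k t.
  by rewrite telescope_sumr// addrC subrK.
have cvs t : exists l : C, W t \is a fin_num -> (s_ n t : C^o) @[n --> \oo] --> (l : C^o).
  case: (boolP (W t \is a fin_num)) => [fW|]; last by exists 0.
  (* A sum X with X^2 <= W satisfies X <= 1 + W. *)
  have [|l dl] := @abs_summable_cvgC R (fun k => d k t) (1 + fine (W t)).
    move=> n; have := partial t n fW; set X := \sum_(0 <= _ < n) _.
    by have := sqr_ge0 (X - 1); rewrite !expr2; nra.
  exists (s_ 0%N t + l) => _; apply: cvgC_near_eq (cvgCD (@cvgC_cst _ _ _ _ (s_ 0%N t)) dl).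
  exact: nearW.
have [u uW] := choice cvs.
pose g t : R := 2 * modc (s_ 0%N t) ^+ 2 + 2 * fine (W t).
exists u, g; split.
- have i0 : mu.-integrable D (EFin \o (fun t => modc (s_ 0%N t) ^+ 2)).
    by have [M sM] := bs 0%N; exact: (@sqr_bounded_integrable _ M).
  have iF : mu.-integrable D (EFin \o (fun t => fine (W t))).
    apply: le_integrable (iW) => //.
      apply/measurable_EFinP; apply: measurableT_comp; first exact: fine_measurable.
      by case/integrableP : iW.
    by move=> t _ /=; case: (W t) => [r| |] /=; rewrite ?normr0 ?leey.
  rewrite (_ : _ \o g = (fun t => 2%R%:E * (modc (s_ 0%N t) ^+ 2)%R%:E) \+
     (fun t => 2%R%:E * (fine (W t))%:E))%E//.
  by apply: integrableD => //; exact: integrableZl.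
- by move: Wfin; apply: filterS => t Wt Dt; apply: uW; exact: Wt.
- move: Wfin; apply: filterS => t Wt n Dt; rewrite sE.
  apply: le_trans (modc_sqrD_le _ _) _; rewrite lerD2l ler_wpM2l//.
  apply: le_trans (partial t n (Wt Dt)).
  rewrite lerXn2r ?nnegrE ?modc_ge0//; first by apply: sumr_ge0 => k _; exact: modc_ge0.
  exact: modc_sum.
Qed.

End RapidlyCauchy.

(** * Boundary functions along a fast subsequence of Taylor polynomials *)

Section L2Boundary.
Variable R : realType.
Local Notation C := R[i].
Local Notation modc := (@Normc.normc R).
Local Notation mu := (@lebesgue_measure R).
Local Notation D := (`[0 : R, pi *+ 2]%classic).

Lemma l2_rapid (M : R) (c : nat -> C) : l2_le M c ->
  exists n_ : nat -> nat, [/\ forall k, (k <= n_ k)%N, {homo n_ : j k / (j <= k)%N} &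
    forall k m, (n_ k <= m)%N -> \sum_(n_ k <= j < m) modc (c j) ^+ 2 <= 4^-1 ^+ k.+1].
Proof.
move=> cM; pose S n := \sum_(0 <= j < n) modc (c j) ^+ 2.
have ndS : nondecreasing_seq S.
  by apply/nondecreasing_seqP => n; rewrite /S big_nat_recr//= lerDl sqr_ge0.
have cS : cvgn S by apply: nondecreasing_is_cvgn => //; exists M => _ [n _ <-]; exact: cM.
have SE m n : (m <= n)%N -> S n - S m = \sum_(m <= j < n) modc (c j) ^+ 2.
  by move=> mn; rewrite /S (big_cat_nat (leq0n m) mn)/= addrAC subrr add0r.
have ex k : exists N, forall m, (N <= m)%N ->
    \sum_(N <= j < m) modc (c j) ^+ 2 <= 4^-1 ^+ k.+1.
  have e0 : 0 < 4^-1 ^+ k.+1 :> R by rewrite exprn_gt0.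
  have /cvgrPdist_lt /(_ _ e0) [N _ HN] := cS.
  exists N => m Nm; rewrite -SE//.
  have := HN N (leqnn N); rewrite /= ger0_norm ?subr_ge0; last exact: nondecreasing_cvgn_le.
  by have := nondecreasing_cvgn_le ndS cS m; lra.
have [N HN] := choice ex.
(* The summand [k] gives [k <= n_ k]; adding all [N j] up to [k] makes [n_] monotone and at least
   [N k]. *)
pose n_ k := (k + \sum_(0 <= j < k.+1) N j)%N.
have NN k : (N k <= n_ k)%N by rewrite /n_ big_nat_recr//= addnA leq_addl.
exists n_; split => [k||k m km]; first exact: leq_addr.
  apply: homo_leq => [//|? ? ?|k]; first exact: leq_trans.
  by rewrite /n_ leq_add// [leqRHS]big_nat_recr//= leq_addr.
have Nm := leq_trans (NN k) km.
apply: le_trans (HN k m Nm).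
rewrite [leRHS](big_cat_nat (NN k) km)/= lerDr.
by apply: sumr_ge0 => j _; exact: sqr_ge0.
Qed.

Lemma big_nat_drop (V : nmodType) (F : nat -> V) (m n : nat) : (m <= n)%N ->
  (forall j, (j < m)%N -> F j = 0) ->
  \sum_(0 <= j < n) F j = \sum_(m <= j < n) F j.
Proof.
move=> mn F0; rewrite (big_cat_nat (leq0n m) mn)/= big1_seq ?add0r// => j.
by rewrite mem_index_iota => /andP[_ jm]; exact: F0.
Qed.

(** [u] is the boundary function with Taylor coefficients [c]. The majorant [g] bounds the squares,
    so both the means of squares and the means against bounded kernels pass to the limit; a
    subsequence suffices, because those limits are identified by other means. *)
Definition subseq_limit (c : nat -> C) (u : R -> C) (n_ : nat -> nat) (g : R -> R) :=
  [/\ forall k, (k <= n_ k)%N, mu.-integrable D (EFin \o g),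
      {ae mu, forall t, D t ->
         (psum c (n_ k) (expi t) : C^o) @[k --> \oo] --> (u t : C^o)} &
      {ae mu, forall t k, D t -> modc (psum c (n_ k) (expi t)) ^+ 2 <= g t}].

Lemma l2_boundary (M : R) (c : nat -> C) : l2_le M c ->
  exists u n_ g, subseq_limit c u n_ g.
Proof.
move=> /l2_rapid[n_ [kn hn nc]].
have [|||u [g [ig ae1 ae2]]] := @rapidly_cauchy_limit R (fun k t => psum c (n_ k) (expi t)).
- by move=> n; exact: circle_measurable_psum.
- by move=> n; eexists => t; exact: modc_psum_circle.
- move=> k; have hk := hn _ _ (leqnSn k).
  apply: le_trans (nc k _ hk).
  (* Erasing the coefficients below [n_ k] writes the increment as a partial sum again, so that
     Parseval applies to it. *)
  pose e j := if (n_ k <= j)%N then c j else 0.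
  have E t : psum c (n_ k.+1) (expi t) - psum c (n_ k) (expi t) = psum e (n_ k.+1) (expi t).
    rewrite psum_shift// /psum (big_nat_drop hk) => [|j jk]; last first.
      by rewrite /e leqNgt jk mul0r.
    by rewrite big_nat [RHS]big_nat; apply: eq_bigr => j /andP[kj _]; rewrite /e kj.
  under eq_circle_mean do rewrite E.
  rewrite circle_mean_psum (big_nat_drop hk) => [|j jk]; last first.
    by rewrite /e leqNgt jk modc0 expr0n.
  rewrite le_eqVlt; apply/orP; left; apply/eqP; rewrite big_nat [RHS]big_nat.
  by apply: eq_bigr => j /andP[kj _]; rewrite /e kj.
by exists u, n_, g.
Qed.

Variables (c : nat -> C) (u : R -> C) (n_ : nat -> nat) (g : R -> R).
Hypothesis cu : subseq_limit c u n_ g.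

Lemma subseq_limit_integrable :
  circle_integrableC u /\ circle_integrable (fun t => modc (u t) ^+ 2).
Proof.
have [kn ig ae1 ae2] := cu; split.
  (* The inequality x <= 1 + x^2 turns the majorant of the squares into a majorant of the moduli. *)
  have i1 : mu.-integrable D (EFin \o (fun t => 1 + g t)).
    rewrite (_ : _ \o _ = (EFin \o (fun=> 1%R)) \+ (EFin \o g))%E//.
    apply: integrableD => //.
    by apply: (@circle_bounded_integrable _ 1) => //; rewrite normr1.
  have [|||//] := @circle_meanC_dominated _ (fun k t => psum c (n_ k) (expi t)) u
     (fun t => 1 + g t) _ _ i1.
  - by move=> k; exact: circle_measurable_psum.
  - exact: ae1.
  - move: ae2; apply: filterS => t + k Dt => /(_ k Dt).
    set x := modc _; have := sqr_ge0 (x - 1); rewrite !expr2; nra.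
have [|||//] := @circle_mean_dominated _ (fun k t => modc (psum c (n_ k) (expi t)) ^+ 2)
   (fun t => modc (u t) ^+ 2) g _ _ ig.
- by move=> k; apply: circle_measurableC_sqr; exact: circle_measurable_psum.
- move: ae1; apply: filterS => t + Dt => /(_ Dt) h.
  by rewrite expr2; under eq_fun do rewrite expr2; apply: cvgM; exact: cvg_modc.
- move: ae2; apply: filterS => t + k Dt => /(_ k Dt).
  by rewrite ger0_norm ?sqr_ge0.
Qed.

Lemma subseq_limit_mean2 :
  \sum_(0 <= k < n_ j) modc (c k) ^+ 2 @[j --> \oo] -->
  circle_mean (fun t => modc (u t) ^+ 2).
Proof.
have [kn ig ae1 ae2] := cu.
have [|||_ h] := @circle_mean_dominated _ (fun k t => modc (psum c (n_ k) (expi t)) ^+ 2)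
   (fun t => modc (u t) ^+ 2) g _ _ ig.
- by move=> k; apply: circle_measurableC_sqr; exact: circle_measurable_psum.
- move: ae1; apply: filterS => t + Dt => /(_ Dt) h.
  by rewrite expr2; under eq_fun do rewrite expr2; apply: cvgM; exact: cvg_modc.
- move: ae2; apply: filterS => t + k Dt => /(_ k Dt).
  by rewrite ger0_norm ?sqr_ge0.
by move: h; under eq_fun do rewrite circle_mean_psum.
Qed.

(** The kernels in question are the Poisson kernel, which leads to the Poisson formula, and the
    conjugate monomials, which lead to the Fourier coefficients. *)
Lemma subseq_limit_meanC (K : R -> C) (B : R) : circle_measurableC K ->
  (forall t, D t -> modc (K t) <= B) ->
  circle_integrableC (fun t => u t * K t) /\
  (circle_meanC (fun t => psum c (n_ j) (expi t) * K t) : C^o) @[j --> \oo] -->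
  (circle_meanC (fun t => u t * K t) : C^o).
Proof.
have [kn ig ae1 ae2] := cu => mK KB.
have i1 : mu.-integrable D (EFin \o (fun t => B * (1 + g t))).
  rewrite (_ : _ \o _ = fun t => B%:E * ((EFin \o (fun=> 1%R)) \+ (EFin \o g)) t)%E//.
  apply: integrableZl => //; apply: integrableD => //.
  by apply: (@circle_bounded_integrable _ 1) => //; rewrite normr1.
apply: (circle_meanC_dominated _ _ i1).
- move=> k; apply: circle_measurableCM => //; exact: circle_measurable_psum.
- move: ae1; apply: filterS => t + Dt => /(_ Dt) h.
  exact: (cvgCM h (@cvgC_cst _ _ _ _ _)).
- move: ae2; apply: filterS => t + k Dt => /(_ k Dt).
  rewrite modcM mulrC => h; rewrite ler_pM ?modc_ge0 ?KB//.
  move: h; set x := modc _; have := sqr_ge0 (x - 1); rewrite !expr2; nra.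
Qed.

End L2Boundary.

(** * Radial limits of Poisson integrals *)

Section PoissonKernel.
Variable R : realType.
Local Notation C := R[i].
Local Notation modc := (@Normc.normc R).
Implicit Types (z : C) (s t : R).

(** Since [expi s] is unimodular, this is e^{is} / (e^{is} - z), the Cauchy kernel with respect to
    normalised arc length. *)
Definition cauchy_kernel z s : C := (1 - z * (expi s)^*)^-1.

Definition poisson_kernel z s : R := (1 - modc z ^+ 2) / modc (expi s - z) ^+ 2.

Lemma expiJ s : expi s * (expi s)^* = 1 :> C.
Proof. by rewrite mulcJ modc_expi expr1n. Qed.

Lemma cauchy_denom_neq0 z s : in_disk z -> 1 - z * (expi s)^* != 0.
Proof.
move=> z1; rewrite subr_eq0; apply/eqP => h; move: z1; rewrite /in_disk.
have : modc 1 = modc (z * (expi s)^*) by rewrite -h.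
by rewrite modcM modcJ modc_expi mulr1 modc1 => <-; rewrite ltxx.
Qed.

Lemma cvg_cauchy_kernel z s : in_disk z ->
  (\sum_(0 <= k < n) z ^+ k * (expi s ^+ k)^* : C^o) @[n --> \oo] -->
  (cauchy_kernel z s : C^o).
Proof.
move=> z1; set q := z * (expi s)^*.
have q1 : modc q = modc z by rewrite modcM modcJ modc_expi mulr1.
have q0 : 1 - q != 0 by exact: cauchy_denom_neq0.
apply: (@cvgC_squeeze _ _ _ _ _ _ (fun n => modc z ^+ n * modc (1 - q)^-1)).
  apply: nearW => n.
  have -> : \sum_(0 <= k < n) z ^+ k * (expi s ^+ k)^* = (1 - q ^+ n) / (1 - q).
    apply: (mulIf q0); rewrite mulfVK// -[1 - q ^+ n]opprB subrX1 big_mkord.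
    rewrite -(mulNr (q - 1)) opprB mulrC; congr (_ * _); apply: eq_bigr => k _.
    by rewrite /q exprMn rmorphXn.
  rewrite /cauchy_kernel -/q -[X in _ - X]mul1r -mulrBl addrAC subrr add0r.
  by rewrite modcM modcN modcX q1.
rewrite -[X in _ --> X](mul0r (modc (1 - q)^-1)); apply: cvgMl.
by apply: cvg_expr; rewrite ger0_norm// modc_ge0.
Qed.

Lemma modc_cauchy_sum_le z s n : in_disk z ->
  modc (\sum_(0 <= k < n) z ^+ k * (expi s ^+ k)^*) <= (1 - modc z)^-1.
Proof.
move=> z1; apply: le_trans (modc_sum _ _ _) _.
rewrite (_ : \sum_(0 <= k < n) _ = \sum_(0 <= k < n) modc z ^+ k).
  by apply: sum_geometric_le; rewrite modc_ge0.
by apply: eq_bigr => k _; rewrite modcM modc_expiXJ mulr1 modcX.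
Qed.

Lemma circle_measurable_cauchy_sum z n :
  circle_measurableC (fun s => \sum_(0 <= k < n) z ^+ k * (expi s ^+ k)^*).
Proof.
apply: circle_measurableC_sum => k; apply: circle_measurableCM.
  exact: circle_measurableC_cst.
exact: circle_measurable_expiX.
Qed.

Lemma circle_measurable_cauchy z : in_disk z ->
  circle_measurableC (cauchy_kernel z).
Proof.
move=> z1; apply: (@circle_measurableC_cvg _
  (fun n s => \sum_(0 <= k < n) z ^+ k * (expi s ^+ k)^*)) => [n|s _].
  exact: circle_measurable_cauchy_sum.
exact: cvg_cauchy_kernel.
Qed.

Lemma modc_cauchy_le z s : in_disk z -> modc (cauchy_kernel z s) <= (1 - modc z)^-1.
Proof.
move=> z1; pose proof (h := cvg_cauchy_kernel (s := s) z1).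
apply: (cvgC_modc_le h).
by apply: nearW => n; exact: modc_cauchy_sum_le.
Qed.

Lemma modc_expi_sub z s : modc (expi s - z) = modc (1 - z * (expi s)^*).
Proof.
rewrite -[RHS]mul1r -(modc_expi s) -modcM mulrBr mulr1 mulrCA.
by rewrite expiJ mulr1.
Qed.

(** With q = z e^{-is}: (1 - |q|^2) / |1 - q|^2 = 1 / (1 - q) + 1 / (1 - conj q) - 1. Measurability,
    the upper bound and the means of the Poisson kernel are read off from the Cauchy kernel in this
    way. *)
Lemma poisson_cauchy z s : in_disk z ->
  (poisson_kernel z s)%:C = cauchy_kernel z s + (cauchy_kernel z s)^* - 1.
Proof.
move=> z1; have q0 := cauchy_denom_neq0 s z1.
rewrite /poisson_kernel modc_expi_sub rmorphM /= fmorphV /= -mulcJ rmorphB /=.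
have -> : (modc z ^+ 2)%:C = (z * (expi s)^*) * (z * (expi s)^*)^*.
  by rewrite mulcJ modcM modcJ modc_expi mulr1.
rewrite /cauchy_kernel fmorphV /= rmorphB rmorph1 /=.
have := q0; rewrite -conjC_eq0 rmorphB rmorph1 /=.
move: q0; set q := z * _ => q0 q0'.
by field; rewrite q0 q0'.
Qed.

Lemma poisson_ge0 z s : in_disk z -> 0 <= poisson_kernel z s.
Proof.
rewrite /in_disk => z1; apply: mulr_ge0; last by rewrite invr_ge0 sqr_ge0.
by rewrite subr_ge0 exprn_ile1 ?modc_ge0// ltW.
Qed.

Lemma herglotz_cauchy z s : in_disk z ->
  (expi s + z) / (expi s - z) = 2 * cauchy_kernel z s - 1.
Proof.
move=> z1; have q0 := cauchy_denom_neq0 s z1.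
have e0 := expi_neq0 s; have ee := expiJ s.
have -> : expi s - z = expi s * (1 - z * (expi s)^*).
  by rewrite mulrBr mulr1 mulrCA ee mulr1.
have -> : expi s + z = expi s * (1 + z * (expi s)^*).
  by rewrite mulrDr mulr1 mulrCA ee mulr1.
rewrite /cauchy_kernel; move: q0; set q := z * _ => q0; field.
by rewrite q0 e0.
Qed.

Lemma Re_herglotz z s : in_disk z ->
  complex.Re ((expi s + z) / (expi s - z)) = poisson_kernel z s.
Proof.
move=> z1; rewrite herglotz_cauchy//.
transitivity (complex.Re (poisson_kernel z s)%:C); last by [].
rewrite poisson_cauchy// !cReD !cReN cReJ cReM; case: (cauchy_kernel z s) => c d /=; ring.
Qed.

Lemma poisson_le z s : in_disk z -> poisson_kernel z s <= 2 * (1 - modc z)^-1 + 1.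
Proof.
move=> z1; apply: le_trans (ler_norm _) _; rewrite -modc_real poisson_cauchy//.
apply: le_trans (modcD _ _) _; rewrite modcN modc1 lerD2r.
apply: le_trans (modcD _ _) _; rewrite modcJ.
by have := modc_cauchy_le s z1; lra.
Qed.

Lemma circle_measurable_poisson z : in_disk z ->
  circle_measurableC (fun s => (poisson_kernel z s)%:C).
Proof.
move=> z1; under [X in circle_measurableC X]eq_fun do rewrite poisson_cauchy//.
have h := circle_measurable_cauchy z1.
apply: circle_measurableCD; last exact: circle_measurableC_cst.
by apply: circle_measurableCD => //; exact: circle_measurableCJ.
Qed.

(** In the geometric expansion of the kernel only the term [k = j] survives integration. *)
Lemma circle_mean_cauchy z j : in_disk z ->
  circle_meanC (fun s => expi s ^+ j * cauchy_kernel z s) = z ^+ j.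
Proof.
move=> z1.
apply: (@cvgC_unique _ _ \oo _ (fun n => circle_meanC (fun s => expi s ^+ j *
   \sum_(0 <= k < n) z ^+ k * (expi s ^+ k)^*))).
  apply: (@circle_meanC_bounded _ (1 - modc z)^-1) => [n|s _|n s _].
  - apply: circle_measurableCM; last exact: circle_measurable_cauchy_sum.
    by apply: circle_measurableCX; exact: circle_measurableC_expi.
  - exact: (cvgCM (@cvgC_cst _ _ _ _ _) (cvg_cauchy_kernel z1)).
  - by rewrite modcM modcX modc_expi expr1n mul1r modc_cauchy_sum_le.
apply: cvgC_near_eq (@cvgC_cst _ _ _ _ _); exists j.+1 => // n /= jn.
have ii k : circle_integrableC (fun s => z ^+ k * (expi s ^+ j * (expi s ^+ k)^*)).
  apply: circle_integrableCZ; apply: (@circle_boundedC_integrable _ 1) => [|s _].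
    apply: circle_measurableCM; last exact: circle_measurable_expiX.
    by apply: circle_measurableCX; exact: circle_measurableC_expi.
  by rewrite modcM modc_expiXJ modcX modc_expi expr1n mulr1.
transitivity (circle_meanC (fun s =>
  \sum_(0 <= k < n) z ^+ k * (expi s ^+ j * (expi s ^+ k)^*))).
  apply: eq_circle_meanC => s; rewrite mulr_sumr; apply: eq_bigr => k _.
  by rewrite mulrCA.
rewrite circle_meanC_sum//.
have E k : circle_meanC (fun s => z ^+ k * (expi s ^+ j * (expi s ^+ k)^*)) =
    z ^+ k * (j == k)%:R.
  rewrite circle_meanCZ ?circle_meanC_expi//.
  apply: (@circle_boundedC_integrable _ 1) => [|s _].
    apply: circle_measurableCM; last exact: circle_measurable_expiX.
    by apply: circle_measurableCX; exact: circle_measurableC_expi.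
  by rewrite modcM modc_expiXJ modcX modc_expi expr1n mulr1.
under eq_bigr do rewrite E.
rewrite (bigD1_seq j)//= ?iota_uniq ?mem_index_iota// eqxx mulr1 big1 ?addr0//.
by move=> k /negbTE kj; rewrite eq_sym kj mulr0.
Qed.

(** The conjugate kernel expands in nonnegative powers of [expi s], so the mean vanishes unless [j]
    and the index of the term are both 0. *)
Lemma circle_mean_cauchyJ z j : in_disk z ->
  circle_meanC (fun s => expi s ^+ j * (cauchy_kernel z s)^*) = (j == 0%N)%:R.
Proof.
move=> z1.
apply: (@cvgC_unique _ _ \oo _ (fun n => circle_meanC (fun s => expi s ^+ j *
   (\sum_(0 <= k < n) z ^+ k * (expi s ^+ k)^*)^*))).
  apply: (@circle_meanC_bounded _ (1 - modc z)^-1) => [n|s _|n s _].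
  - apply: circle_measurableCM.
      by apply: circle_measurableCX; exact: circle_measurableC_expi.
    exact/circle_measurableCJ/circle_measurable_cauchy_sum.
  - exact: (cvgCM (@cvgC_cst _ _ _ _ _) (cvg_conjc (cvg_cauchy_kernel z1))).
  - by rewrite modcM modcX modc_expi expr1n mul1r modcJ modc_cauchy_sum_le.
apply: cvgC_near_eq (@cvgC_cst _ _ _ _ _); exists 1%N => // -[//|n] _.
have i1 m : circle_integrableC (fun s => expi s ^+ m).
  apply: (@circle_boundedC_integrable _ 1) => [|s _].
    by apply: circle_measurableCX; exact: circle_measurableC_expi.
  by rewrite modcX modc_expi expr1n.
transitivity (circle_meanC (fun s => \sum_(0 <= k < n.+1) (z ^+ k)^* * expi s ^+ (j + k))).
  apply: eq_circle_meanC => s; rewrite rmorph_sum mulr_sumr; apply: eq_bigr => k _.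
  by rewrite rmorphM /= conjCK mulrCA exprD.
rewrite circle_meanC_sum => [|k]; last exact: circle_integrableCZ.
have E k : circle_meanC (fun s => (z ^+ k)^* * expi s ^+ (j + k)) =
    (z ^+ k)^* * (j + k == 0)%N%:R.
  rewrite circle_meanCZ//; congr (_ * _); rewrite -circle_meanC_expi.
  by apply: eq_circle_meanC => s; rewrite expr0 conjC1 mulr1.
under eq_bigr do rewrite E.
rewrite big_nat_recl// expr0 conjC1 mul1r addn0 big1 ?addr0// => k _.
by rewrite addnS mulr0.
Qed.

(** In the decomposition of [poisson_cauchy] the contributions of the conjugate kernel and of the
    constant -1 cancel. *)
Lemma circle_mean_poisson_expi z j : in_disk z ->
  circle_meanC (fun s => expi s ^+ j * (poisson_kernel z s)%:C) = z ^+ j.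
Proof.
move=> z1; have mc := circle_measurable_cauchy z1.
have me : circle_measurableC (fun s : R => expi s ^+ j).
  by apply: circle_measurableCX; exact: circle_measurableC_expi.
have i1 : circle_integrableC (fun s => expi s ^+ j * cauchy_kernel z s).
  apply: (@circle_boundedC_integrable _ (1 - modc z)^-1) => [|s _].
    exact: circle_measurableCM.
  by rewrite modcM modcX modc_expi expr1n mul1r modc_cauchy_le.
have i2 : circle_integrableC (fun s => expi s ^+ j * (cauchy_kernel z s)^*).
  apply: (@circle_boundedC_integrable _ (1 - modc z)^-1) => [|s _].
    by apply: circle_measurableCM => //; exact: circle_measurableCJ.
  by rewrite modcM modcX modc_expi expr1n mul1r modcJ modc_cauchy_le.
have i3 : circle_integrableC (fun s => (- 1) * expi s ^+ j :> C).
  apply/circle_integrableCZ/(@circle_boundedC_integrable _ 1) => // s _.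
  by rewrite modcX modc_expi expr1n.
transitivity (circle_meanC (fun s => expi s ^+ j * cauchy_kernel z s +
   expi s ^+ j * (cauchy_kernel z s)^* + (- 1) * expi s ^+ j)).
  by apply: eq_circle_meanC => s; rewrite poisson_cauchy// !mulrDr mulrC mulrN1 mulN1r.
rewrite circle_meanCD//; last exact: circle_integrableCD.
rewrite circle_meanCD// circle_mean_cauchy// circle_mean_cauchyJ//.
rewrite circle_meanCZ; last first.
  by apply: (@circle_boundedC_integrable _ 1) => // s _; rewrite modcX modc_expi expr1n.
have -> : circle_meanC (fun s => expi s ^+ j) = (j == 0%N)%:R :> C.
  by rewrite -circle_meanC_expi; apply: eq_circle_meanC => s; rewrite expr0 conjC1 mulr1.
by rewrite mulN1r addrK.
Qed.

Lemma circle_mean_poisson z : in_disk z -> circle_mean (poisson_kernel z) = 1.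
Proof.
move=> z1; apply: complexI; rewrite -circle_meanC_real.
rewrite -[RHS](expr0 z) -(circle_mean_poisson_expi 0 z1).
by apply: eq_circle_meanC => s; rewrite expr0 mul1r.
Qed.

Lemma poisson_psum c n z : in_disk z ->
  circle_meanC (fun s => psum c n (expi s) * (poisson_kernel z s)%:C) = psum c n z.
Proof.
move=> z1.
have ii k : circle_integrableC (fun s => expi s ^+ k * (poisson_kernel z s)%:C).
  apply: (@circle_boundedC_integrable _ (2 * (1 - modc z)^-1 + 1)) => [|s _].
    apply: circle_measurableCM; last exact: circle_measurable_poisson.
    by apply: circle_measurableCX; exact: circle_measurableC_expi.
  rewrite modcM modcX modc_expi expr1n mul1r modc_real ger0_norm ?poisson_ge0//.
  exact: poisson_le.
transitivity (circle_meanC (fun s =>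
  \sum_(0 <= k < n) c k * (expi s ^+ k * (poisson_kernel z s)%:C))).
  apply: eq_circle_meanC => s; rewrite /psum mulr_suml; apply: eq_bigr => k _.
  by rewrite mulrA.
rewrite circle_meanC_sum => [|k]; last exact: circle_integrableCZ.
by apply: eq_bigr => k _; rewrite circle_meanCZ// circle_mean_poisson_expi.
Qed.

(** Each Taylor polynomial satisfies the formula by [poisson_psum]; along [n_] one side tends to
    [f z], the other to the mean of [u] against the kernel. *)
Lemma poisson_integral f c u n_ g z : has_coefs f c -> subseq_limit c u n_ g ->
  in_disk z ->
  circle_integrableC (fun s => u s * (poisson_kernel z s)%:C) /\
  f z = circle_meanC (fun s => u s * (poisson_kernel z s)%:C).
Proof.
move=> fc cu z1.
have [|iu cv] := @subseq_limit_meanC _ _ _ _ _ cu _ (2 * (1 - modc z)^-1 + 1)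
   (circle_measurable_poisson z1).
  by move=> s _; rewrite modc_real ger0_norm ?poisson_ge0//; exact: poisson_le.
split => //; apply: (@cvgC_unique _ _ \oo _ (fun j => psum c (n_ j) z)).
  have [kn _ _ _] := cu.
  apply: (@cvg_comp _ _ _ n_ ((psum c)^~ z : nat -> C^o) _ \oo); last exact: fc.
  by move=> A [N _ NA]; exists N => // k /= Nk; apply: NA; rewrite /= (leq_trans Nk).
by move: cv; under eq_fun do rewrite poisson_psum//.
Qed.

End PoissonKernel.

(** * Kernels with quadratic decay at a Lebesgue point *)

Section ApproximateIdentity.
Variable R : realType.
Local Notation mu := (@lebesgue_measure R).
Local Open Scope ereal_scope.

(** In the application [phi] is |v - v(t)|, with small averages around a Lebesgue point [t], and [k]
    is a multiple of the Poisson kernel with [h = 1 - r]. The two kernel bounds say k(s) <= min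
    (1/h, h / (s - t)^2). *)
Variables (phi k : R -> R) (t rho0 eps h : R).
Local Notation B := (ball t).
Hypotheses (mphi : measurable_fun (B rho0) phi) (phi0 : forall s, (0 <= phi s)%R).
Hypotheses (mk : measurable_fun (B rho0) k) (k0 : forall s, B rho0 s -> (0 <= k s)%R).
Hypotheses (h0 : (0 < h)%R) (eps0 : (0 <= eps)%R) (rho00 : (0 < rho0)%R).
Hypothesis kh : forall s, B rho0 s -> (k s <= h^-1)%R.
Hypothesis kx : forall s, B rho0 s -> ((s - t) ^+ 2 * k s <= h)%R.
Hypothesis phi_avg : forall rho, (0 < rho)%R -> (rho <= rho0)%R ->
  \int[mu]_(s in B rho) (phi s)%:E <= (eps * (rho *+ 2))%:E.

Let mB rho : measurable (B rho).
Proof. exact: measurable_ball. Qed.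

Let sB r r' : (r <= r')%R -> B r `<=` B r'.
Proof. exact: le_ball. Qed.

Let mkphi E : measurable E -> E `<=` B rho0 ->
  measurable_fun E (fun s => (k s * phi s)%:E).
Proof.
move=> mE EB; apply/measurable_EFinP; apply: (measurable_funS (mB rho0)) => //.
exact: measurable_funM.
Qed.

Let piece E rho b : measurable E -> (0 < rho)%R -> (rho <= rho0)%R -> (0 <= b)%R ->
  E `<=` B rho -> (forall s, E s -> (k s <= b)%R) ->
  \int[mu]_(s in E) (k s * phi s)%:E <= (b * (eps * (rho *+ 2)))%:E.
Proof.
move=> mE rho_gt0 rr0 b0 EB kb; have EB0 := subset_trans EB (sB rr0).
have mp F : measurable F -> F `<=` B rho0 -> measurable_fun F (fun s => (phi s)%:E).
  by move=> mF FB; apply/measurable_EFinP; apply: (measurable_funS (mB rho0)).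
apply: (@le_trans _ _ (\int[mu]_(s in E) (b%:E * (phi s)%:E))).
  apply: ge0_le_integral => //.
  - by move=> s Es; rewrite lee_fin mulr_ge0// k0//; exact: EB0.
  - exact: mkphi.
  - by apply: measurable_funeM; exact: mp.
  - by move=> s Es; rewrite -EFinM lee_fin ler_wpM2r// kb.
rewrite ge0_integralZl_EFin//; [|by move=> s _; rewrite lee_fin|exact: mp].
rewrite EFinM lee_wpmul2l ?lee_fin//; apply: le_trans (phi_avg rho_gt0 rr0).
have key := @ge0_subset_integral _ _ _ mu E (B rho) mE (mB rho).
apply: key; last exact: EB; last by move=> s _; rewrite lee_fin.
exact: (mp _ (mB rho) (sB rr0)).
Qed.

(* Dyadic decomposition: the shell between radii [2 ^ J h] and [2 ^ (J + 1) h]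
   contributes at most [4 eps / 2 ^ J]. *)
Lemma approximate_identity_bound :
  \int[mu]_(s in B rho0) (k s * phi s)%:E <= (10 * eps)%:E.
Proof.
(* The value 10 - 8 = 2 at [J = 0] pays for the ball of radius [h], where [k] is at most 1/h; from
   [J] to [J.+1] the bound grows by 4 eps / 2^J, the share of one shell. *)
have claim J rho : (0 < rho)%R -> (rho <= rho0)%R -> (rho <= 2 ^+ J * h)%R ->
    \int[mu]_(s in B rho) (k s * phi s)%:E <= (eps * (10 - 8 * (2 ^+ J)^-1))%:E.
  elim: J rho => [|J IH] rho rho_gt0 rr0 rJ.
    have hV0 : (0 <= h^-1)%R by rewrite invr_ge0 ltW.
    have kb s : B rho s -> (k s <= h^-1)%R by move=> rs; apply: kh; exact: sB rs.
    apply: le_trans (piece (mB rho) rho_gt0 rr0 hV0 (@subset_refl _ _) kb) _.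
    rewrite lee_fin expr0 invr1 mulrCA ler_wpM2l// mulr1.
    move: rJ; rewrite expr0 mul1r => rh; rewrite mulrC ler_pdivrMr//.
    by rewrite mulr2n; lra.
  have [rJ'|Jr] := leP rho (2 ^+ J * h)%R.
    apply: le_trans (IH _ rho_gt0 rr0 rJ') _; rewrite lee_fin ler_wpM2l//.
    rewrite lerD2l lerN2 ler_wpM2l// lef_pV2 ?posrE ?exprn_gt0//.
    by rewrite exprS ler_peMl ?exprn_ge0// ler1n.
  set rho' := (2 ^+ J * h)%R in Jr.
  have rho'0 : (0 < rho')%R by rewrite mulr_gt0// exprn_gt0.
  have rr0' : (rho' <= rho0)%R by rewrite (le_trans (ltW Jr)).
  have mDf : measurable (B rho `\` B rho') by exact: measurableD.
  rewrite -(setDUK (sB (ltW Jr))) (@ge0_integral_setU _ _ _ mu _ _ (mB rho') mDf)//; last 3 first.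
  - by rewrite setDUK; [exact: (mkphi (mB rho) (sB rr0))|exact: sB (ltW Jr)].
  - move=> s; rewrite setDUK; last exact: sB (ltW Jr).
    by move=> rs; rewrite lee_fin mulr_ge0// k0//; exact: sB rs.
  - by apply/disj_setPS => s [? []].
  have IH' := IH _ rho'0 rr0' (lexx _).
  have b0 : (0 <= h / rho' ^+ 2)%R by rewrite divr_ge0 ?(ltW h0)// sqr_ge0.
  have kb s : (B rho `\` B rho') s -> (k s <= h / rho' ^+ 2)%R.
    move=> [rs nr's]; have Bs : B rho0 s by exact: sB rs.
    rewrite ler_pdivlMr ?exprn_gt0//; apply: le_trans (kx Bs).
    rewrite mulrC ler_wpM2r ?k0//.
    have : (rho' <= `|s - t|)%R.
      by rewrite leNgt; apply/negP => hs; apply: nr's; rewrite /ball/= distrC.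
    by move=> hs; rewrite -[leRHS]real_normK ?num_real// lerXn2r ?nnegrE// ltW.
  apply: le_trans (leeD IH' (piece mDf rho_gt0 rr0 b0 (@subDsetl _ _ _) kb)) _.
  have p0 : (0 < 2 ^+ J :> R)%R by rewrite exprn_gt0.
  rewrite -EFinD lee_fin.
  have -> : (h / rho' ^+ 2 * (eps * (rho *+ 2)) = eps * (2 * rho / (2 ^+ J * rho')))%R.
    by rewrite /rho' mulr2n; field; rewrite !gt_eqF.
  rewrite -mulrDr ler_wpM2l//.
  have E : (2 * rho / (2 ^+ J * rho') <= 4 * (2 ^+ J)^-1)%R.
    rewrite ler_pdivrMr ?mulr_gt0// [leRHS](_ : _ = 4 * rho')%R; last first.
      by field; rewrite gt_eqF.
    by move: rJ; rewrite exprS -mulrA -/rho'; lra.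
  by rewrite exprS invfM; lra.
have [N HN] : exists N, (rho0 <= 2 ^+ N * h)%R.
  exists (Num.truncn (rho0 / h)).+1; rewrite -ler_pdivrMr//.
  apply: le_trans (ltW (truncnS_gt _)) _.
  by rewrite -natrX ler_nat ltnW// ltn_expl.
apply: le_trans (claim N _ rho00 (lexx _) HN) _.
rewrite lee_fin mulrC ler_wpM2r// lerBlDr lerDl.
by rewrite mulr_ge0// invr_ge0 exprn_ge0.
Qed.

End ApproximateIdentity.

(** * Cosine estimates for the Poisson kernel, and averages at Lebesgue points *)

Section RadialLimit.
Variable R : realType.
Local Notation C := R[i].
Local Notation modc := (@Normc.normc R).
Local Notation mu := (@lebesgue_measure R).
Implicit Types (s t r x : R).

(** The law of cosines, arranged as a sum of two terms that are both nonnegative for [0 <= r]. *)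
Lemma modc_expi_dist r s t :
  modc (expi s - r%:C * expi t) ^+ 2 = (1 - r) ^+ 2 + 2 * r * (1 - cos (s - t)).
Proof.
rewrite sqr_modc /expi cosB /=.
have := cos2Dsin2 s; have := cos2Dsin2 t; move: (cos s) (sin s) (cos t) (sin t) => a b c d.
move=> cd ab.
transitivity ((a ^+ 2 + b ^+ 2) + r ^+ 2 * (c ^+ 2 + d ^+ 2) - 2 * r * (a * c + b * d)).
  ring.
by rewrite ab cd; ring.
Qed.

(** With y = |x| / 2 one has 1 - cos x = 2 sin(y)^2, and the mean value theorem on [0, y], contained
    in [0, 1/2], gives sin y >= cos(1/2) y. Hence the constant cos(1/2)^2 / 2. *)
Lemma cos_le_quadratic : exists k : R, 0 < k /\ k <= 1 /\
  forall x, `|x| <= 1 -> k * x ^+ 2 <= 1 - cos x.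
Proof.
have ph := pihalf_ge1 R.
have c0 : 0 < cos (2^-1 : R) by apply: cos_gt0_pihalf; apply/andP; split; lra.
have c1 : cos (2^-1 : R) <= 1 by exact: cos_le1.
exists (cos (2^-1) ^+ 2 / 2); split; first by rewrite divr_gt0// exprn_gt0.
split; first by rewrite expr2; nra.
move=> x x1; pose y := `|x| / 2.
have -> : cos x = 1 - 2 * sin y ^+ 2.
  have -> : cos x = cos `|x| by have [//|_] := ger0P x; rewrite cosN.
  have -> : `|x| = y + y by rewrite /y; field.
  by rewrite cosD; have := cos2Dsin2 y; rewrite !expr2; lra.
have y0 : 0 <= y by rewrite /y divr_ge0.
have y1 : y <= 2^-1 by rewrite /y; lra.
have sy : cos (2^-1) * y <= sin y.
  have [c] := @MVT_segment R (@sin R) (@cos R) 0 y y0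
    (fun x _ => is_derive_sin x) (continuous_subspaceT (@continuous_sin R)).
  rewrite in_itv/= => /andP[c0' cy]; rewrite sin0 !subr0 => ->.
  rewrite ler_wpM2r// leNgt ltr_cos ?in_itv/= -?leNgt; first lra.
  - by apply/andP; split; lra.
  - by apply/andP; split; lra.
have -> : x ^+ 2 = 4 * y ^+ 2.
  by rewrite -[LHS]real_normK ?num_real// /y; field.
have : (cos (2^-1) * y) ^+ 2 <= sin y ^+ 2.
  by rewrite lerXn2r ?nnegrE ?mulr_ge0 ?(ltW c0)// (le_trans _ sy)// mulr_ge0// ltW.
by rewrite exprMn; lra.
Qed.

(** The cosine decreases on [0, pi]; beyond pi, |x| is replaced by 2 pi - |x|, which is still at
    least [rho]. *)
Lemma cos_far rho x : 0 < rho -> rho <= pi -> rho <= `|x| -> `|x| <= pi *+ 2 - rho ->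
  cos x <= cos rho.
Proof.
move=> r0 rp rx xr.
have -> : cos x = cos `|x| by have [//|_] := ger0P x; rewrite cosN.
have pp := pi_gt0 R; move: xr; rewrite mulr2n => xr.
have key y : rho <= y -> y <= pi -> cos y <= cos rho.
  by move=> ry yp; rewrite leNgt ltr_cos ?in_itv/= -?leNgt//; apply/andP; split; lra.
have [xp|px] := leP `|x| pi; first exact: key.
have -> : cos `|x| = cos (pi *+ 2 - `|x|).
  by rewrite addrC cosD2pi cosN.
by apply: key; rewrite mulr2n; lra.
Qed.

Lemma cos_lt1 rho : 0 < rho -> rho <= pi -> cos rho < 1 :> R.
Proof.
move=> r0 rp; rewrite -cos0 ltr_cos ?in_itv/= ?lexx ?pi_ge0//.
by rewrite ltW.
Qed.

Lemma lebesgue_pt_avg (V : R -> R) t e : lebesgue_pt V t -> 0 < e ->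
  exists rho, 0 < rho /\ forall r, 0 < r -> r <= rho ->
    (\int[mu]_(s in ball t r) `|V s - V t|%:E <= (e * (r *+ 2))%:E)%E.
Proof.
move=> Vt e0.
have /fine_cvgP[_ /cvgrPdist_lt /(_ e e0)] := Vt.
have /fine_cvgP[fV _] := Vt.
move=> fe; have : \forall r \near (0 : R)^'+, davg V t r \is a fin_num /\ fine (davg V t r) < e.
  near=> r; split; first by near: r.
  have : `|0 - fine (davg V t r)| < e by near: r.
  by rewrite sub0r normrN; apply: le_lt_trans; exact: ler_norm.
move=> [rho /= rho0 Hr]; exists (rho / 2); split; first by rewrite divr_gt0.
move=> r r0 rr.
have [|//|fin lt] := Hr r.
  by rewrite /= sub0r normrN gtr0_norm//; lra.
have : (davg V t r <= e%:E)%E by rewrite -(fineK fin) lee_fin ltW.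
rewrite /davg /iavg /= lebesgue_measure_ball ?(ltW r0)//.
rewrite inver gt_eqF ?mulrn_wgt0// => h.
rewrite mulrC EFinM -lee_pdivrMl ?mulrn_wgt0//.
Unshelve. all: by end_near. Qed.

End RadialLimit.

(** * Fatou's theorem on radial limits *)

Section Fatou.
Variable R : realType.
Local Notation C := R[i].
Local Notation modc := (@Normc.normc R).
Local Notation mu := (@lebesgue_measure R).
Local Notation D := (`[0 : R, pi *+ 2]%classic).
Implicit Types (s t r x : R).

Lemma circle_measurable_poissonR (z : C) : in_disk z ->
  measurable_fun D (poisson_kernel z).
Proof. by move=> z1; case: (circle_measurable_poisson z1). Qed.

Lemma integrable_poissonM (v : R -> R) (z : C) : in_disk z ->
  mu.-integrable D (EFin \o v) ->
  mu.-integrable D (EFin \o (fun s => v s * poisson_kernel z s)).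
Proof.
move=> z1 iv; pose B := 2 * (1 - modc z)^-1 + 1.
have B0 : 0 <= B by apply: le_trans (poisson_ge0 0 z1) (poisson_le 0 z1).
have mv : measurable_fun D v by apply/measurable_EFinP; exact: measurable_int iv.
have iB : mu.-integrable D (fun s => (B%:E * (v s)%:E)%E) by exact: integrableZl.
apply: le_integrable iB => //.
- apply/measurable_EFinP; apply: measurable_funM => //.
  exact: circle_measurable_poissonR.
- move=> s _ /=.
  have Ps : `|poisson_kernel z s| <= `|B|.
    by rewrite !ger0_norm ?poisson_ge0//; exact: poisson_le.
  by rewrite lee_fin normrM [leRHS]normrM mulrC ler_wpM2r.
Qed.

Lemma poisson_kernel_circle r s t : 0 <= r ->
  poisson_kernel (r%:C * expi t) s =
  (1 - r ^+ 2) / ((1 - r) ^+ 2 + 2 * r * (1 - cos (s - t))).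
Proof. by move=> r0; rewrite /poisson_kernel modc_circle// modc_expi_dist. Qed.

(** Rests on 1 - r^2 <= 2 (1 - r) and, as r >= 1/2, on 2 r x >= x. The parameter [y] is a convenient
    lower bound for the denominator: (1 - r)^2, a multiple of (s - t)^2, or a constant. *)
Lemma poisson_kernel_div_le r x y : 2^-1 <= r -> r < 1 -> 0 <= x -> 0 < y ->
  y <= (1 - r) ^+ 2 + x -> (1 - r ^+ 2) / ((1 - r) ^+ 2 + 2 * r * x) <= 2 * (1 - r) / y.
Proof.
move=> r2 r1 x0 y0 yx.
have r0 : 0 < r by apply: lt_le_trans r2; rewrite invr_gt0.
have rx : x <= 2 * r * x by rewrite ler_peMl// mulrC -ler_pdivrMr// mul1r.
have yQ : y <= (1 - r) ^+ 2 + 2 * r * x by apply: le_trans yx _; rewrite lerD2l.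
have E : 1 - r ^+ 2 <= 2 * (1 - r).
  by rewrite expr2; nra.
have E0 : 0 <= 1 - r ^+ 2 by rewrite subr_ge0 exprn_ile1// ltW.
have Q0 : 0 < (1 - r) ^+ 2 + 2 * r * x by exact: lt_le_trans yQ.
apply: ler_pM => //; first by rewrite invr_ge0 ltW.
by rewrite lef_pV2.
Qed.

(** The factor [k / 2] normalises the kernel to the two bounds required by
    [approximate_identity_bound] with [h = 1 - r]. *)
Lemma poisson_near_le k r s t : 2^-1 <= r -> r < 1 -> 0 < k -> k <= 1 ->
  k * (s - t) ^+ 2 <= 1 - cos (s - t) ->
  k / 2 * poisson_kernel (r%:C * expi t) s <= (1 - r)^-1 /\
  (s - t) ^+ 2 * (k / 2 * poisson_kernel (r%:C * expi t) s) <= 1 - r.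
Proof.
move=> r2 r1 k0 k1 kx.
have r0 : 0 <= r by apply: le_trans r2; rewrite invr_ge0.
have h0 : 0 < 1 - r by rewrite subr_gt0.
have c0 : 0 <= 1 - cos (s - t) by rewrite subr_ge0 cos_le1.
have k2 : 0 <= k / 2 by rewrite divr_ge0// ltW.
rewrite poisson_kernel_circle//; split.
  have y0 : 0 < (1 - r) ^+ 2 by rewrite exprn_gt0.
  have yx : (1 - r) ^+ 2 <= (1 - r) ^+ 2 + (1 - cos (s - t)) by rewrite lerDl.
  apply: le_trans (ler_wpM2l k2 (poisson_kernel_div_le r2 r1 c0 y0 yx)) _.
  have -> : k / 2 * (2 * (1 - r) / (1 - r) ^+ 2) = k * (1 - r)^-1.
    by field; rewrite gt_eqF.
  by rewrite ler_piMl// invr_ge0 ltW.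
have [->|st] := eqVneq ((s - t) ^+ 2) 0; first by rewrite mul0r ltW.
have y0 : 0 < k * (s - t) ^+ 2 by rewrite mulr_gt0// lt_neqAle eq_sym st sqr_ge0.
have yx : k * (s - t) ^+ 2 <= (1 - r) ^+ 2 + (1 - cos (s - t)).
  by apply: le_trans kx _; rewrite lerDr sqr_ge0.
apply: le_trans (ler_wpM2l (sqr_ge0 _) (ler_wpM2l k2 (poisson_kernel_div_le r2 r1 c0 y0 yx))) _.
rewrite le_eqVlt; apply/orP; left; apply/eqP; move: st; set w := (s - t) ^+ 2 => st.
by field; rewrite st gt_eqF.
Qed.

Lemma poisson_far_le m r s t : 2^-1 <= r -> r < 1 -> 0 < m ->
  m <= 1 - cos (s - t) -> poisson_kernel (r%:C * expi t) s <= 2 * (1 - r) / m.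
Proof.
move=> r2 r1 m0 mc; have r0 : 0 <= r by apply: le_trans r2; rewrite invr_ge0.
have c0 : 0 <= 1 - cos (s - t) by rewrite subr_ge0 cos_le1.
have yx : m <= (1 - r) ^+ 2 + (1 - cos (s - t)).
  by apply: le_trans mc _; rewrite lerDr sqr_ge0.
by rewrite poisson_kernel_circle//; exact: poisson_kernel_div_le r2 r1 c0 m0 yx.
Qed.

Lemma le_circle_mean_integral (x : R -> R) (b : R) : (forall s, D s -> 0 <= x s) ->
  mu.-integrable D (EFin \o x) ->
  (\int[mu]_(s in D) (x s)%:E <= b%:E)%E -> circle_mean x <= b.
Proof.
move=> x0 ix xb; have p1 : 1 <= pi *+ 2 :> R.
  by have := pi_ge2 R; lra.
have m0 : 0 <= circle_mean x by exact: circle_mean_ge0.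
move: xb; rewrite circle_integralE// lee_fin; apply: le_trans.
by rewrite ler_peMl.
Qed.

(** As the kernel has mean 1, the error is at most the mean of |v - v(t)| against it. Near [t] this
    is small by the Lebesgue point property and the dyadic bound; away from [t] the kernel tends to
    0 uniformly. *)
Lemma poisson_radial_limit (v : R -> R) t : mu.-integrable D (EFin \o v) ->
  0 < t < pi *+ 2 -> lebesgue_pt (v \_ D) t ->
  circle_mean (fun s => v s * poisson_kernel (r%:C * expi t) s) @[r --> (1 : R)^'-]
  --> v t.
Proof.
move=> iv /andP[t0 t2] Vt; set V := v \_ D in Vt.
have VE s : D s -> V s = v s by move=> Ds; rewrite /V patchE mem_set.
have Dt : D t by rewrite /= in_itv/= !ltW.
pose phi s := `|V s - V t|.
have mv : measurable_fun D v by apply/measurable_EFinP; exact: measurable_int iv.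
have mV : measurable_fun D V.
  by apply: eq_measurable_fun mv => s /set_mem Ds; rewrite VE.
have mphi : measurable_fun D phi.
  by apply: measurableT_comp => //; exact: measurable_funB.
have phi0 s : 0 <= phi s by exact: normr_ge0.
have iphi : mu.-integrable D (EFin \o phi).
  have ivt : mu.-integrable D (EFin \o (fun=> v t)).
    by apply: (@circle_bounded_integrable _ `|v t|).
  have iB : mu.-integrable D (fun s => ((v s)%:E - (v t)%:E)%E) by exact: integrableB.
  apply: le_integrable iB => //; first exact/measurable_EFinP.
  by move=> s Ds; rewrite /= /phi !VE// normr_id.
have [k [k0 [k1 kcos]]] := cos_le_quadratic R.
apply/cvgrPdist_lt => e e0.
(* Chosen so that the factor 10 of the dyadic bound and the factor 2 / k that undoes the
   normalisation give e / 4. *)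
have eps0 : 0 < e * k / 80 by rewrite divr_gt0// mulr_gt0.
have [rho1 [rho10 Hrho1]] := lebesgue_pt_avg Vt eps0.
(* [rho1] serves the averages, 1 the quadratic bound for the cosine, and the last two entries keep
   the ball inside the interval. *)
pose rho := Num.min (Num.min rho1 1) (Num.min t (pi *+ 2 - t)).
have rho0 : 0 < rho by rewrite !lt_min rho10 ltr01 t0 subr_gt0 t2.
have : rho <= rho by [].
rewrite {2}/rho !le_min => /andP[/andP[rr1 rl1] /andP[rt rt2]].
have rpi : rho <= pi by have := pi_ge2 R; lra.
have BD : ball t rho `<=` D.
  by move=> s; rewrite /ball/= ltr_distl in_itv/= => /andP[]; lra.
have mB : measurable (ball t rho) by exact: measurable_ball.
have mDB : measurable (D `\` ball t rho) by apply: measurableD => //; exact: measurable_circle.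
set m := 1 - cos rho.
have m0 : 0 < m by rewrite subr_gt0 cos_lt1.
pose T := fine (\int[mu]_(s in D) (phi s)%:E)%E.
have T0 : 0 <= T by rewrite fine_ge0//; apply: integral_ge0 => s _; rewrite lee_fin.
have TE : (\int[mu]_(s in D) (phi s)%:E)%E = T%:E.
  by rewrite fineK//; exact: integrable_fin_num iphi.
(* The first entry ensures r > 1/2, the second bounds the far part by e / 4; [T + 1] keeps the
   denominator positive when [T] is 0. *)
pose del := Num.min 2^-1 (e / 4 * m / (2 * (T + 1))).
have T1 : 0 < 2 * (T + 1) by lra.
have del0 : 0 < del.
  by rewrite lt_min invr_gt0 ltr0n/= divr_gt0// mulr_gt0// divr_gt0.
near=> r.
have r1 : r < 1 by near: r; exact: nbhs_left_lt.
have rdel : 1 - del < r by near: r; apply: nbhs_left_gt; rewrite ltrBlDr ltrDl.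
have : 1 - r < del by lra.
rewrite lt_min => /andP[r2 rT].
have r2' : 2^-1 <= r.
  by move: r2; rewrite ltrBlDr -ltrBlDl => /ltW; apply: le_trans; lra.
have r01 : 0 <= r < 1 by rewrite r1 (le_trans _ r2')// invr_ge0.
pose z := r%:C * expi t; have z1 : in_disk z by exact: in_disk_circle.
have h0 : 0 < 1 - r by rewrite subr_gt0.
pose P := poisson_kernel z.
have P0 s : 0 <= P s by exact: poisson_ge0.
have mP : measurable_fun D P by exact: circle_measurable_poissonR.
have near_part : (\int[mu]_(s in ball t rho) (P s * phi s)%:E <= (e / 4)%:E)%E.
  have Pk s : ball t rho s -> k / 2 * P s <= (1 - r)^-1 /\
      (s - t) ^+ 2 * (k / 2 * P s) <= 1 - r.
    rewrite /ball/= distrC => st; apply: poisson_near_le => //.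
    by apply: kcos; exact: ltW (lt_le_trans st rl1).
  have AI := @approximate_identity_bound R phi (fun s => k / 2 * P s) t rho (e * k / 80) (1 - r)
    (measurable_funS (@measurable_circle R) BD mphi) phi0.
  have {AI} : (\int[mu]_(s in ball t rho) (k / 2 * P s * phi s)%:E <= (10 * (e * k / 80))%:E)%E.
    apply: AI => //.
    - apply: (measurable_funS (@measurable_circle R) BD).
      by apply: measurable_funM => //; exact: measurable_cst.
    - by move=> s _; rewrite mulr_ge0// divr_ge0// ltW.
    - exact: ltW.
    - by move=> s /Pk[].
    - by move=> s /Pk[].
    - by move=> r' r'0 r'r; apply: Hrho1 => //; exact: le_trans r'r rr1.
  move=> AI.
  have -> : (\int[mu]_(s in ball t rho) (P s * phi s)%:E =
      (2 / k)%:E * \int[mu]_(s in ball t rho) (k / 2 * P s * phi s)%:E)%E.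
    rewrite -ge0_integralZl_EFin//.
    - apply: eq_integral => s _; rewrite -EFinM; congr EFin; field.
      by rewrite gt_eqF.
    - by move=> s _; rewrite lee_fin mulr_ge0// mulr_ge0// divr_ge0// ltW.
    - apply/measurable_EFinP; apply: (measurable_funS (@measurable_circle R) BD).
      by apply: measurable_funM => //; apply: measurable_funM => //; exact: measurable_cst.
    - by rewrite divr_ge0// ltW.
  apply: (@le_trans _ _ ((2 / k)%:E * (10 * (e * k / 80))%:E)%E).
    by rewrite lee_wpmul2l// lee_fin divr_ge0// ltW.
  rewrite -EFinM lee_fin le_eqVlt; apply/orP; left; apply/eqP; field.
  by rewrite gt_eqF.
have far_part : (\int[mu]_(s in D `\` ball t rho) (P s * phi s)%:E <= (e / 4)%:E)%E.
  have Pfar s : (D `\` ball t rho) s -> P s <= 2 * (1 - r) / m.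
    move=> [Ds nB]; have st : rho <= `|s - t|.
      by rewrite leNgt; apply/negP => hs; apply: nB; rewrite /ball/= distrC.
    have st2 : `|s - t| <= pi *+ 2 - rho.
      move: Ds; rewrite /= in_itv/= ler_norml => /andP[s0 s2]; apply/andP; split.
        by lra.
      by lra.
    by apply: poisson_far_le => //; rewrite lerD2l lerN2; exact: cos_far st st2.
  apply: (@le_trans _ _ ((2 * (1 - r) / m)%:E * \int[mu]_(s in D) (phi s)%:E)%E).
    have mphi' : measurable_fun (D `\` ball t rho) (fun s => (phi s)%:E).
      by apply/measurable_EFinP; exact: measurable_funS mphi.
    have b0 : 0 <= 2 * (1 - r) / m by rewrite divr_ge0 ?mulr_ge0 ?(ltW h0) ?(ltW m0).
    apply: (@le_trans _ _ ((2 * (1 - r) / m)%:E * \int[mu]_(s in D `\` ball t rho) (phi s)%:E)%E).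
      rewrite -ge0_integralZl_EFin//; last by move=> s _; rewrite lee_fin.
      apply: ge0_le_integral => //.
      - by move=> s _; rewrite lee_fin mulr_ge0.
      - apply/measurable_EFinP; apply: measurable_funM.
          exact: measurable_funS mP.
        by apply/measurable_EFinP.
      - by apply: measurable_funeM.
      - by move=> s Ds; rewrite -EFinM lee_fin ler_wpM2r// Pfar.
    rewrite lee_wpmul2l ?lee_fin//.
    have key := @ge0_subset_integral _ _ _ mu _ D mDB (@measurable_circle R).
    apply: key; last exact: subDsetl; last by move=> s _; rewrite lee_fin.
    exact/measurable_EFinP.
  rewrite TE -EFinM lee_fin.
  have hT : (1 - r) * (2 * (T + 1)) <= e / 4 * m by rewrite -ler_pdivlMr// ltW.
  have -> : 2 * (1 - r) / m * T = (2 * (1 - r) * T) / m by ring.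
  rewrite ler_pdivrMr//; apply: le_trans hT.
  have -> : (1 - r) * (2 * (T + 1)) = 2 * (1 - r) * T + 2 * (1 - r) by ring.
  by rewrite lerDl mulr_ge0// ltW.
have iPphi := integrable_poissonM z1 iphi.
have tot : circle_mean (fun s => phi s * P s) <= e / 2.
  apply: le_circle_mean_integral => //; first by move=> s _; rewrite mulr_ge0.
  rewrite -(setDUK BD) (@ge0_integral_setU _ _ _ mu _ _ mB mDB); last 3 first.
  - by rewrite setDUK//; case/integrableP : iPphi => + _; exact.
  - by move=> s _; rewrite lee_fin mulr_ge0.
  - by apply/disj_setPS => s [? []].
  have -> : e / 2 = e / 4 + e / 4 by field.
  rewrite EFinD; apply: leeD; under eq_integral do rewrite mulrC.
    exact: near_part.
  exact: far_part.
have iw := integrable_poissonM z1 iv.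
have civ := circle_integrableW iw.
have ciP : circle_integrable (fun s => - v t * P s).
  apply/circle_integrableZ/circle_integrableW.
  apply: (@circle_bounded_integrable _ (2 * (1 - modc z)^-1 + 1)) => // s _.
  by rewrite ger0_norm// poisson_le.
have E : circle_mean (fun s => v s * P s) - v t =
    circle_mean (fun s => v s * P s + (- v t) * P s).
  rewrite circle_meanD// circle_meanZ.
    by rewrite /P circle_mean_poisson// mulr1.
  apply/circle_integrableW.
  apply: (@circle_bounded_integrable _ (2 * (1 - modc z)^-1 + 1)) => // s _.
  by rewrite ger0_norm// poisson_le.
rewrite distrC E.
have cw := circle_integrableD civ ciP.
have cphi := circle_integrableW iPphi.
have ab s : D s -> `|v s * P s + - v t * P s| = phi s * P s.
  by move=> Ds; rewrite -mulrDl normrM (ger0_norm (P0 s)) /phi !VE.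
apply: (@le_lt_trans _ _ (e / 2)); last by rewrite ltr_pdivrMr// ltr_pMr// ltr1n.
apply: le_trans tot; rewrite ler_norml; apply/andP; split.
  rewrite -circle_meanN//; apply: circle_mean_le => //.
    exact: circle_integrableN.
  by move=> s Ds; rewrite -ab// lerNl ler_normr lexx orbT.
by apply: circle_mean_le => // s Ds; rewrite -ab// ler_norm.
Unshelve. all: by end_near. Qed.

Lemma ae_circle_interior : {ae mu, forall t, D t -> 0 < t < pi *+ 2}.
Proof.
exists [set 0; pi *+ 2]; split.
- by apply: measurableU; exact: measurable_set1.
- by apply: countable_lebesgue_measure0; apply: finite_set_countable; exact: finite_set2.
move=> t /= h; apply: contrapT => nt; apply: h; rewrite in_itv/= => /andP[t0 t2].
by apply/andP; split; rewrite lt_neqAle ?t0 ?t2 andbT; apply/eqP => E; apply: nt;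
  [left|right].
Qed.

(** Almost every [t] is interior, is a Lebesgue point of integrable representatives [v1], [v2] of
    the real and imaginary parts of [u], and is a point where these agree with [u]. Inside the
    Poisson mean the representatives may replace [u]. *)
Lemma radial_limit_ae (f : C -> C) c u n_ g : has_coefs f c -> subseq_limit c u n_ g ->
  {ae mu, forall t, D t ->
    (f (r%:C * expi t) : C^o) @[r --> (1 : R)^'-] --> (u t : C^o)}.
Proof.
move=> fc cu; have [[[v1 iv1 uv1] [v2 iv2 uv2]] _] := subseq_limit_integrable cu.
have l1 := lebesgue_differentiation (integrable_locally_restrict (@measurable_circle R) iv1).
have l2 := lebesgue_differentiation (integrable_locally_restrict (@measurable_circle R) iv2).
move: uv1 uv2 => uv1 uv2.
have : {ae mu, forall t, (D t -> complex.Re (u t) = v1 t) /\ (D t -> complex.Im (u t) = v2 t)}.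
  by move: uv1 uv2; apply: filterS2.
have : {ae mu, forall t, lebesgue_pt (v1 \_ D) t /\ lebesgue_pt (v2 \_ D) t}.
  by move: l1 l2; apply: filterS2.
apply: filterS3 ae_circle_interior => t Di [p1 p2] [E1 E2] Dt.
have t01 := Di Dt.
have H1 := poisson_radial_limit iv1 t01 p1.
have H2 := poisson_radial_limit iv2 t01 p2.
have fE r : 0 <= r < 1 -> f (r%:C * expi t) =
   circle_mean (fun s => v1 s * poisson_kernel (r%:C * expi t) s) +i*
   circle_mean (fun s => v2 s * poisson_kernel (r%:C * expi t) s).
  move=> r01; have [_ ->] := poisson_integral fc cu (in_disk_circle t r01).
  congr (_ +i* _); apply: circle_mean_ae.
    by move: uv1; apply: filterS => s E Ds; rewrite cReM /= mulr0 subr0 E.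
  by move: uv2; apply: filterS => s E Ds; rewrite cImM /= mulr0 add0r E.
have near01 : \forall r \near (1 : R)^'-, 0 <= r < 1.
  near=> r; apply/andP; split; last by near: r; exact: nbhs_left_lt.
  by apply: ltW; near: r; apply: nbhs_left_gt; exact: ltr01.
apply/cvgC_ReIm; rewrite E1// E2//; split.
  apply: cvg_trans H1; apply: near_eq_cvg.
  by move: near01; apply: filterS => r r01; rewrite fE.
apply: cvg_trans H2; apply: near_eq_cvg.
by move: near01; apply: filterS => r r01; rewrite fE.
Unshelve. all: by end_near. Qed.

End Fatou.

(** * The inner product of boundary functions *)

Section Boundary.
Variable R : realType.
Local Notation C := R[i].
Local Notation modc := (@Normc.normc R).
Local Notation mu := (@lebesgue_measure R).
Local Notation D := (`[0 : R, pi *+ 2]%classic).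
Implicit Types (f g h : C -> C) (u v w : R -> C).

Definition radial f (t : R) (l : C) :=
  (f (r%:C * expi t) : C^o) @[r --> (1 : R)^'-] --> (l : C^o).

Lemma bv_radial f t l : radial f t l -> bv f t = l.
Proof. by move=> fl; exact: (cvg_lim (@norm_hausdorff _ C^o) fl). Qed.

Lemma near_in_disk (t : R) : \forall r \near (1 : R)^'-, in_disk (r%:C * expi t).
Proof.
near=> r; apply: in_disk_circle; apply/andP; split; last by near: r; exact: nbhs_left_lt.
by apply: ltW; near: r; apply: nbhs_left_gt; exact: ltr01.
Unshelve. all: by end_near. Qed.

Definition circle_L2 u :=
  circle_integrableC u /\ circle_integrable (fun t => modc (u t) ^+ 2).

(** Dominated convergence for the constant sequence [w] delivers integrability of its almost
    everywhere limit [x]. *)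
Lemma circle_integrable_dominated (x y w : R -> R) : measurable_fun D w ->
  {ae mu, forall t, D t -> x t = w t} -> circle_integrable y ->
  {ae mu, forall t, D t -> `|x t| <= y t} -> circle_integrable x.
Proof.
move=> mw xw [y' iy yy'] xy.
have [|||//] := @circle_mean_dominated _ (fun=> w) x y' _ _ iy.
- by move=> _.
- by move: xw; apply: filterS => t xw Dt; rewrite xw//; exact: cvg_cst.
- have : {ae mu, forall t, (D t -> y t = y' t) /\ (D t -> x t = w t)}.
    by move: yy' xw; apply: filterS2.
  move: xy; apply: filterS2 => t xy [yE xE] _ Dt.
  by rewrite -xE// -yE// xy.
Qed.

Lemma circle_integrable_aemeasurable (x : R -> R) : circle_integrable x ->
  exists2 w, measurable_fun D w & {ae mu, forall t, D t -> x t = w t}.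
Proof.
by move=> [w iw xw]; exists w => //; apply/measurable_EFinP; exact: measurable_int iw.
Qed.

(** The modulus is at most [modc (u t) ^+ 2 + modc (v t) ^+ 2]; measurability is that of expressions
    in representatives [w1] to [w4] of the four real components. *)
Lemma circle_L2M u v : circle_L2 u -> circle_L2 v ->
  circle_integrableC (fun t => u t * (v t)^*).
Proof.
move=> [[ru iu] u2] [[rv iv] v2].
have [w1 m1 e1] := circle_integrable_aemeasurable ru.
have [w2 m2 e2] := circle_integrable_aemeasurable iu.
have [w3 m3 e3] := circle_integrable_aemeasurable rv.
have [w4 m4 e4] := circle_integrable_aemeasurable iv.
have e12 : {ae mu, forall t, D t -> complex.Re (u t) = w1 t /\ complex.Im (u t) = w2 t}.
  by move: e1 e2; apply: filterS2 => t a b Dt; split; [exact: a|exact: b].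
have e34 : {ae mu, forall t, D t -> complex.Re (v t) = w3 t /\ complex.Im (v t) = w4 t}.
  by move: e3 e4; apply: filterS2 => t a b Dt; split; [exact: a|exact: b].
have iuv := circle_integrableD u2 v2.
have B t : modc (u t * (v t)^*) <= modc (u t) ^+ 2 + modc (v t) ^+ 2.
  rewrite modcM modcJ; have := sqr_ge0 (modc (u t) - modc (v t)).
  by have := sqr_ge0 (modc (u t) + modc (v t)); rewrite !expr2; lra.
split.
- apply: (@circle_integrable_dominated _ _ (fun t => w1 t * w3 t + w2 t * w4 t) _ _ iuv).
  + by apply: measurable_funD; exact: measurable_funM.
  + move: e12 e34; apply: filterS2 => t a b Dt.
    by rewrite cReM cReJ cImJ (a Dt).1 (a Dt).2 (b Dt).1 (b Dt).2; ring.
  + by apply: aeW => t _; apply: le_trans (B t); exact: Re_le_modc.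
- apply: (@circle_integrable_dominated _ _ (fun t => w2 t * w3 t - w1 t * w4 t) _ _ iuv).
  + by apply: measurable_funB; exact: measurable_funM.
  + move: e12 e34; apply: filterS2 => t a b Dt.
    by rewrite cImM cReJ cImJ (a Dt).1 (a Dt).2 (b Dt).1 (b Dt).2; ring.
  + by apply: aeW => t _; apply: le_trans (B t); exact: Im_le_modc.
Qed.

Lemma circle_L2_ae u v : circle_L2 v -> {ae mu, forall t, D t -> u t = v t} ->
  circle_L2 u.
Proof.
move=> [iv v2] uv; split; first exact: circle_integrableC_ae uv.
by apply: circle_integrable_ae v2 _; move: uv; apply: filterS => t uv Dt; rewrite uv.
Qed.

(** Since radial limits exist almost everywhere and equal [u], the value of [lim] in [bv] is the
    intended one there. All later facts about [bv] on [H2] rest on this. *)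
Lemma H2_boundary f : H2 f -> exists c u n_ y M,
  [/\ has_coefs f c, l2_le M c, subseq_limit c u n_ y,
      {ae mu, forall t, D t -> radial f t (u t)} &
      {ae mu, forall t, D t -> bv f t = u t}].
Proof.
move=> /H2_coefs[c [M [fc cM]]]; have [u [n_ [g cu]]] := l2_boundary cM.
exists c, u, n_, g, M; have rf := radial_limit_ae fc cu; split => //.
by move: rf; apply: filterS => t ru Dt; apply: bv_radial; exact: ru.
Qed.

Lemma H2_radial f : H2 f -> {ae mu, forall t, D t -> radial f t (bv f t)}.
Proof.
move=> /H2_boundary[c [u [n_ [g [M [_ _ _ ru bu]]]]]].
by move: ru bu; apply: filterS2 => t ru bu Dt; rewrite bu//; exact: ru.
Qed.

Lemma bv_L2 f : H2 f -> circle_L2 (bv f).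
Proof.
move=> /H2_boundary[c [u [n_ [g [M [_ _ cu _ bu]]]]]].
exact: circle_L2_ae (subseq_limit_integrable cu) bu.
Qed.

Definition ip f g : C := inner (bv f) (bv g).
Definition sqnorm f : R := circle_mean (fun t => modc (bv f t) ^+ 2).

Lemma sqnorm_ge0 f : 0 <= sqnorm f.
Proof. by apply: circle_mean_ge0 => t _; exact: sqr_ge0. Qed.

Lemma normH2E f : normH2 f = Num.sqrt (sqnorm f).
Proof. by []. Qed.

Lemma ip_integrable f g : H2 f -> H2 g ->
  circle_integrableC (fun t => bv f t * (bv g t)^*).
Proof. by move=> Hf Hg; apply: circle_L2M; exact: bv_L2. Qed.

Lemma ipxx f : ip f f = (sqnorm f)%:C.
Proof.
by rewrite /ip /inner -circle_meanC_real; apply: eq_circle_meanC => t; rewrite mulcJ.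
Qed.

Lemma ipC f g : H2 f -> H2 g -> ip g f = (ip f g)^*.
Proof.
move=> Hf Hg; rewrite /ip /inner -circle_meanCJ; last exact: ip_integrable.
by apply: eq_circle_meanC => t; rewrite rmorphM /= conjCK mulrC.
Qed.

Lemma bvD_ae f g : H2 f -> H2 g ->
  {ae mu, forall t, D t -> bv (fun z => f z + g z) t = bv f t + bv g t}.
Proof.
move=> /H2_radial rf /H2_radial rg; move: rf rg; apply: filterS2 => t rf rg Dt.
by apply: bv_radial; exact: (cvgCD (rf Dt) (rg Dt)).
Qed.

Lemma bvZ_ae (k : C) f : H2 f ->
  {ae mu, forall t, D t -> bv (fun z => k * f z) t = k * bv f t}.
Proof.
move=> /H2_radial; apply: filterS => t rf Dt.
by apply: bv_radial; exact: (cvgCM (@cvgC_cst _ _ _ _ k) (rf Dt)).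
Qed.

Lemma H2D f g : H2 f -> H2 g -> H2 (fun z => f z + g z).
Proof.
move=> Hf Hg; have [c [M [fc cM]]] := H2_coefs Hf.
have [d [N [gd dN]]] := H2_coefs Hg; have [_ f0 _] := Hf; have [_ g0 _] := Hg.
apply: (mem_H2 (M := 2 * M + 2 * N) (has_coefsD fc gd)) => [z nz|n].
  by rewrite f0// g0// addr0.
apply: (@le_trans _ _ (\sum_(0 <= k < n) (2 * modc (c k) ^+ 2 + 2 * modc (d k) ^+ 2))).
  by apply: ler_sum => k _; exact: modc_sqrD_le.
by rewrite big_split/= -!mulr_sumr lerD// ler_wpM2l.
Qed.

Lemma H2Z (k : C) f : H2 f -> H2 (fun z => k * f z).
Proof.
move=> Hf; have [c [M [fc cM]]] := H2_coefs Hf; have [_ f0 _] := Hf.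
have fk := has_coefsZ (a := k) fc.
have key := @mem_H2 R (fun z => k * f z) _ (modc k ^+ 2 * M) fk.
apply: key => [z nz|n].
  by rewrite f0// mulr0.
under eq_bigr do rewrite modcM exprMn.
by rewrite -mulr_sumr ler_wpM2l// sqr_ge0.
Qed.

Lemma ipDl f g h : H2 f -> H2 g -> H2 h ->
  ip (fun z => f z + g z) h = ip f h + ip g h.
Proof.
move=> Hf Hg Hh; rewrite /ip /inner -circle_meanCD; do ?exact: ip_integrable.
apply: circle_meanC_ae; move: (bvD_ae Hf Hg); apply: filterS => t E Dt.
by rewrite E// mulrDl.
Qed.

Lemma ipZl (k : C) f h : H2 f -> H2 h -> ip (fun z => k * f z) h = k * ip f h.
Proof.
move=> Hf Hh; rewrite /ip /inner -circle_meanCZ; last exact: ip_integrable.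
apply: circle_meanC_ae; move: (bvZ_ae k Hf); apply: filterS => t E Dt.
by rewrite E// mulrA.
Qed.

Lemma ipDr f g h : H2 f -> H2 g -> H2 h ->
  ip h (fun z => f z + g z) = ip h f + ip h g.
Proof.
move=> Hf Hg Hh; rewrite (ipC (H2D Hf Hg) Hh) ipDl// rmorphD /= -!ipC//.
Qed.

Lemma ipZr (k : C) f h : H2 f -> H2 h -> ip h (fun z => k * f z) = k^* * ip h f.
Proof. by move=> Hf Hh; rewrite (ipC (H2Z k Hf) Hh) ipZl// rmorphM /= -ipC. Qed.

(** The squared norm of f - x <f, g> g is nonnegative for every real x. Taking x = 1 / |g|^2 gives
    the inequality; if |g| = 0, a large x forces <f, g> = 0. *)
Lemma ip_cauchy_schwarz f g : H2 f -> H2 g ->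
  modc (ip f g) ^+ 2 <= sqnorm f * sqnorm g.
Proof.
move=> Hf Hg; set I := modc (ip f g) ^+ 2.
have I0 : 0 <= I by exact: sqr_ge0.
have F0 := sqnorm_ge0 f; have G0 := sqnorm_ge0 g.
have key (x : R) : 0 <= sqnorm f - 2 * x * I + x ^+ 2 * I * sqnorm g.
  pose l : C := - (x%:C * ip f g).
  have Hl := H2Z l Hg.
  have : 0 <= sqnorm (fun z => f z + l * g z) by exact: sqnorm_ge0.
  rewrite -ler0c -ipxx ipDl//; last exact: H2D.
  rewrite !ipDr// !ipZl// !ipZr// !ipxx (ipC Hf Hg) -ler0c.
  suff -> : (sqnorm f - 2 * x * I + x ^+ 2 * I * sqnorm g)%:C =
    (sqnorm f)%:C + l^* * ip f g + (l * (ip f g)^* + l * (l^* * (sqnorm g)%:C)) by [].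
  have lE : l^* = - (x%:C * (ip f g)^*).
    by rewrite /l rmorphN rmorphM /= conj_Creal//; apply/complex_realP; exists x.
  have IE : I%:C = ip f g * (ip f g)^* by rewrite mulcJ.
  have gen (F y J G : R) : (F - 2 * y * J + y ^+ 2 * J * G)%:C =
      F%:C - 2 * y%:C * J%:C + y%:C ^+ 2 * J%:C * G%:C.
    by apply: complex_eqP => /=; ring.
  by rewrite gen IE lE /l; ring.
have [G1|G1] := eqVneq (sqnorm g) 0.
  rewrite G1 mulr0; have [//|I1] := leP I 0.
  have := key ((sqnorm f + 1) / (2 * I)); rewrite G1 mulr0 addr0.
  have -> : 2 * ((sqnorm f + 1) / (2 * I)) * I = sqnorm f + 1 by field; rewrite gt_eqF.
  by lra.
have G2 : 0 < sqnorm g by rewrite lt_neqAle eq_sym G1.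
have := key (sqnorm g)^-1.
have -> : sqnorm f - 2 * (sqnorm g)^-1 * I + (sqnorm g)^-1 ^+ 2 * I * sqnorm g =
  (sqnorm f * sqnorm g - I) / sqnorm g by field.
by rewrite pmulr_lge0 ?invr_gt0// subr_ge0.
Qed.

(** Parseval's identity on the boundary: dominated convergence identifies the limit along [n_], and
    the partial sums increase to a finite limit, which must be the same. *)
Lemma sqnorm_coefs f c : H2 f -> has_coefs f c ->
  \sum_(0 <= k < n) modc (c k) ^+ 2 @[n --> \oo] --> sqnorm f.
Proof.
move=> /H2_boundary[d [u [n_ [g [M [fd dM cu ru bu]]]]]] fc.
have -> : c = d by apply/funext; exact: has_coefs_unique fc fd.
have E : sqnorm f = circle_mean (fun t => modc (u t) ^+ 2).
  by apply: circle_mean_ae; move: bu; apply: filterS => t bu Dt; rewrite bu.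
have ndS : nondecreasing_seq (fun n => \sum_(0 <= k < n) modc (d k) ^+ 2).
  by apply/nondecreasing_seqP => n; rewrite big_nat_recr//= lerDl sqr_ge0.
have /cvg_ex[l cl] : cvgn (fun n => \sum_(0 <= k < n) modc (d k) ^+ 2).
  by apply: nondecreasing_is_cvgn => //; exists M => _ [n _ <-]; exact: dM.
have cn : (\sum_(0 <= k < n_ j) modc (d k) ^+ 2) @[j --> \oo] --> l.
  have [kn _ _ _] := cu.
  apply: (@cvg_comp _ _ _ n_ (fun n => \sum_(0 <= k < n) modc (d k) ^+ 2) _ \oo); last exact: cl.
  by move=> A [N _ NA]; exists N => // k /= Nk; apply: NA; rewrite /= (leq_trans Nk).
by rewrite E -(cvg_unique _ cn (subseq_limit_mean2 cu)).
Qed.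

Lemma sqnorm_l2_le f c (M : R) : H2 f -> has_coefs f c -> l2_le M c -> sqnorm f <= M.
Proof.
move=> Hf fc cM; have h := sqnorm_coefs Hf fc; rewrite -(cvg_lim _ h)//.
by apply: limr_le; [exact: cvgP h|apply: nearW].
Qed.

Lemma l2_le_sqnorm f c : H2 f -> has_coefs f c -> l2_le (sqnorm f) c.
Proof.
move=> Hf fc n; have h := sqnorm_coefs Hf fc; rewrite -(cvg_lim _ h)//.
apply: nondecreasing_cvgn_le; last exact: cvgP h.
by apply/nondecreasing_seqP => m; rewrite big_nat_recr//= lerDl sqr_ge0.
Qed.

Lemma H2_eq_coefs f g c : H2 f -> H2 g -> has_coefs f c -> has_coefs g c -> f = g.
Proof.
move=> [_ f0 _] [_ g0 _] fc gc; apply/funext => z.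
have [z1|z1] := ltP (modc z) 1.
  exact: (@cvgC_unique _ _ \oo _ (fun n => psum c n z) _ _ (fc z z1) (gc z z1)).
have nz : ~ in_disk z by rewrite /in_disk ltNge z1.
by rewrite f0// g0.
Qed.

Lemma H2_coefs_eq0 f c : H2 f -> has_coefs f c -> (forall k, c k = 0) ->
  f = fun=> 0.
Proof.
move=> [_ f0 _] fc c0; apply/funext => z.
have [z1|z1] := ltP (modc z) 1; last by apply: f0; rewrite /in_disk ltNge z1.
apply: (@cvgC_unique _ _ \oo _ (fun n => psum c n z)); first exact: fc.
apply: cvgC_near_eq (@cvgC_cst _ _ _ _ _); apply: nearW => n.
by rewrite /psum big1// => k _; rewrite c0 mul0r.
Qed.

Lemma sqnorm_eq0 f : H2 f -> sqnorm f = 0 -> f = fun=> 0.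
Proof.
move=> Hf f0; have [c [M [fc cM]]] := H2_coefs Hf.
apply: (H2_coefs_eq0 Hf fc) => k.
apply/eqP; rewrite -modc_eq0 eq_le modc_ge0 andbT.
by have := l2_le_modc k (l2_le_sqnorm Hf fc); rewrite f0 sqrtr0.
Qed.

Definition monomial (k : nat) : C -> C := cutoff (fun z => z ^+ k).

Lemma has_coefs_monomial k : has_coefs (monomial k) (fun j => (j == k)%:R).
Proof.
apply: has_coefs_cutoff.
apply: (eq_has_coefs _ _ (@has_coefs_poly R 'X^k)) => [z _|j].
  by rewrite hornerXn.
by rewrite coefXn.
Qed.

Lemma H2_monomial k : H2 (monomial k).
Proof.
have [|//] := @H2_bounded R (monomial k) _ 1 (@has_coefs_monomial k) (@cutoff_out _ _).
move=> z z1; rewrite /monomial cutoff_in// modcX exprn_ile1 ?modc_ge0//.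
exact: ltW.
Qed.

Lemma radial_monomial k t : radial (monomial k) t (expi t ^+ k).
Proof.
apply/cvgC_modc.
have h : (1 - r ^+ k) @[r --> (1 : R)^'-] --> (0 : R).
  have -> : 0 = 1 - 1 ^+ k :> R by rewrite expr1n subrr.
  apply: cvg_at_left_filter; apply: cvgB; first exact: cvg_cst.
  exact: exprn_continuous.
move: h; apply: cvg_trans; apply: near_eq_cvg; near=> r.
have r1 : r < 1 by near: r; exact: nbhs_left_lt.
have r0 : 0 < r by near: r; apply: nbhs_left_gt; exact: ltr01.
apply: esym; rewrite /monomial cutoff_in; last by apply: in_disk_circle; rewrite (ltW r0).
rewrite exprMn -[X in _ - X]mul1r -mulrBl modcM modcX modc_expi expr1n mulr1.
have -> : r%:C ^+ k - 1 = (r ^+ k - 1)%:C by rewrite rmorphB rmorphXn rmorph1.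
rewrite modc_real ler0_norm ?opprB//.
by rewrite subr_le0 exprn_ile1// ltW.
Unshelve. all: by end_near. Qed.

Lemma bv_monomial k t : bv (monomial k) t = expi t ^+ k.
Proof. exact/bv_radial/radial_monomial. Qed.

(** Fourier coefficients of the boundary function are Taylor coefficients: this is exact for partial
    sums with more than [k] terms, and the subsequence passes to the limit. *)
Lemma ip_monomial f c k : H2 f -> has_coefs f c -> ip f (monomial k) = c k.
Proof.
move=> /H2_boundary[d [u [n_ [g [M [fd dM cu ru bu]]]]]] fc.
rewrite (has_coefs_unique fc fd k).
have [|_ cv] := @subseq_limit_meanC _ _ _ _ _ cu (fun t => (expi t ^+ k)^*) 1
  (@circle_measurable_expiX R k).
  by move=> t _; rewrite modc_expiXJ.
have -> : ip f (monomial k) = circle_meanC (fun t => u t * (expi t ^+ k)^*).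
  by apply: circle_meanC_ae; move: bu; apply: filterS => t bu Dt; rewrite bv_monomial bu.
apply: cvgC_unique cv _.
have [kn _ _ _] := cu.
apply: cvgC_near_eq (@cvgC_cst _ _ _ _ _); exists k.+1 => // j /= kj.
by rewrite circle_meanC_psum (leq_trans kj).
Qed.

Lemma H2_shift f : H2 f -> H2 (Sshift f).
Proof.
move=> Hf; have [c [M [fc cM]]] := H2_coefs Hf; have [_ f0 _] := Hf.
apply: (mem_H2 (M := M) (has_coefs_shift fc)) => [z nz|[|n]].
- by rewrite /Sshift f0// mulr0.
- by rewrite big_geq// (le_trans _ (cM 0%N))// big_geq.
- by rewrite big_nat_recl// modc0 expr0n add0r.
Qed.

Lemma bv_shift_ae f : H2 f ->
  {ae mu, forall t, D t -> bv (Sshift f) t = expi t * bv f t}.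
Proof.
move=> /H2_radial; apply: filterS => t rf Dt; apply: bv_radial.
have rt : radial (monomial 1) t (expi t) by exact: radial_monomial.
apply: cvgC_near_eq (cvgCM rt (rf Dt)).
move: (near_in_disk t); apply: filterS => r r1.
by rewrite /Sshift /monomial cutoff_in// expr1.
Qed.

End Boundary.

(** * Co-analytic Toeplitz operators *)

Section Toeplitz.
Variable R : realType.
Local Notation C := R[i].
Local Notation modc := (@Normc.normc R).
Local Notation mu := (@lebesgue_measure R).
Local Notation D := (`[0 : R, pi *+ 2]%classic).
Implicit Types (f g h : C -> C) (c : nat -> C).

(** The Taylor polynomial as an element of [H2]: unlike [psum], it vanishes off the disk. *)
Definition trunc c n (z : C) : C := \sum_(0 <= k < n) c k * monomial k z.

Lemma trunc0 c : trunc c 0 = fun=> 0.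
Proof. by apply/funext => z; rewrite /trunc big_geq. Qed.

Lemma truncS c n : trunc c n.+1 = fun z => trunc c n z + c n * monomial n z.
Proof. by apply/funext => z; rewrite /trunc big_nat_recr. Qed.

Lemma H2_0 : H2 (fun=> 0 : C).
Proof.
have := H2Z 0 (H2_monomial R 0).
have E : (fun z => 0 * monomial 0 z) = (fun=> 0 : C).
  by apply/funext => z; rewrite mul0r.
by rewrite E.
Qed.

Lemma H2_trunc c n : H2 (trunc c n).
Proof.
elim: n => [|n IH]; first by rewrite trunc0; exact: H2_0.
by rewrite truncS; apply: H2D => //; apply: H2Z; exact: H2_monomial.
Qed.

Lemma has_coefs_trunc c n :
  has_coefs (trunc c n) (fun k => if (k < n)%N then c k else 0).
Proof.
elim: n => [|n IH].
  have := has_coefsZ (a := 0) (@has_coefs_monomial R 0); apply: eq_has_coefs.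
    by move=> z _; rewrite trunc0 mul0r.
  by move=> k; rewrite mul0r.
rewrite truncS.
have := has_coefsD IH (has_coefsZ (a := c n) (@has_coefs_monomial R n)).
apply: eq_has_coefs => // k; rewrite ltnS leq_eqVlt.
by have [->|kn] := eqVneq k n; rewrite /= ?ltnn ?mulr1 ?add0r// mulr0 addr0.
Qed.

Lemma ip0l g : H2 g -> ip (fun=> 0) g = 0.
Proof.
move=> Hg; have := ipZl 0 Hg Hg; rewrite mul0r.
have E : (fun z => 0 * g z) = (fun=> 0 : C) by apply/funext => z; rewrite mul0r.
by rewrite E.
Qed.

Lemma ip0r g : H2 g -> ip g (fun=> 0) = 0.
Proof. by move=> Hg; rewrite (ipC H2_0 Hg) ip0l// conjC0. Qed.

(** Needed for [F] the identity and for [F] the multiplication by [a]. *)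
Lemma ip_truncr f c n (F : (C -> C) -> C -> C) :
  H2 f -> (forall g, H2 g -> H2 (F g)) -> F (fun=> 0) = (fun=> 0) ->
  (forall (k : C) g h, F (fun z => g z + k * h z) = fun z => F g z + k * F h z) ->
  ip f (F (trunc c n)) = \sum_(0 <= k < n) (c k)^* * ip f (F (monomial k)).
Proof.
move=> Hf HF F0 FL; elim: n => [|n IH].
  by rewrite trunc0 F0 ip0r// big_geq.
have Hm := HF _ (H2_monomial R n); have Ht := HF _ (H2_trunc c n).
rewrite truncS FL ipDr//; last exact: H2Z.
by rewrite IH ipZr// big_nat_recr.
Qed.

Lemma ip_trunc f c d n : H2 f -> has_coefs f d ->
  ip f (trunc c n) = \sum_(0 <= k < n) (c k)^* * d k.
Proof.
move=> Hf fd; rewrite (@ip_truncr f c n id)//.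
by apply: eq_bigr => k _; rewrite (ip_monomial k Hf fd).
Qed.

Definition remainder f c n (z : C) : C := f z + (-1) * trunc c n z.

Lemma H2_remainder f c n : H2 f -> H2 (remainder f c n).
Proof. by move=> Hf; apply: H2D => //; apply: H2Z; exact: H2_trunc. Qed.

Lemma sqnorm_remainder f c n : H2 f -> has_coefs f c ->
  sqnorm (remainder f c n) <= sqnorm f - \sum_(0 <= k < n) modc (c k) ^+ 2.
Proof.
move=> Hf fc; have Hr := H2_remainder c n Hf.
have rc := has_coefsD fc (has_coefsZ (a := -1) (@has_coefs_trunc c n)).
apply: (sqnorm_l2_le Hr rc) => m; have cf := l2_le_sqnorm Hf fc.
have E k : modc (c k + -1 * (if (k < n)%N then c k else 0)) ^+ 2 =
    if (k < n)%N then 0 else modc (c k) ^+ 2.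
  by case: ifP => _; rewrite mulN1r ?subrr ?subr0 ?modc0 ?expr0n.
under eq_bigr do rewrite E.
rewrite lerBrDr; have [mn|nm] := leqP m n.
  rewrite big_nat big1 ?add0r; first exact: cf.
  by move=> k /andP[_ km]; rewrite (leq_trans km mn).
apply: le_trans (cf m); rewrite (big_nat_drop (ltnW nm)) => [|j ->//].
rewrite [leRHS](big_cat_nat (leq0n n) (ltnW nm))/= [leRHS]addrC lerD2r.
rewrite big_nat [leRHS]big_nat; apply: ler_sum => k /andP[nk _].
by rewrite ltnNge nk.
Qed.

Lemma sqnorm_remainder_cvg f c : H2 f -> has_coefs f c ->
  sqnorm (remainder f c n) @[n --> \oo] --> (0 : R).
Proof.
move=> Hf fc.
have h : sqnorm f - \sum_(0 <= k < n) modc (c k) ^+ 2 @[n --> \oo] --> (0 : R).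
  rewrite -[X in _ --> X](subrr (sqnorm f)); apply: cvgB; first exact: cvg_cst.
  exact: (sqnorm_coefs Hf fc).
apply: (squeeze_cvgr _ (cvg_cst 0) h).
by apply: nearW => n; rewrite sqnorm_ge0 sqnorm_remainder.
Qed.

Variables (a : C -> C) (A : R).
Hypotheses (an_a : analytic_disk a) (aA : forall z, in_disk z -> modc (a z) <= A).

Definition amul h (z : C) : C := a z * h z.

(** [a] may be nonzero off the disk, so it is [cutoff a] that lies in [H2]; radial limits see only
    the disk and are the same for both. *)
Lemma radial_bv_bounded :
  {ae mu, forall t, D t -> radial a t (bv a t)} /\
  {ae mu, forall t, D t -> modc (bv a t) <= A}.
Proof.
have [c ac] := an_a.
have [|Ha _] := @H2_bounded R (cutoff a) c A (has_coefs_cutoff ac) (@cutoff_out _ a).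
  by move=> z z1; rewrite cutoff_in// aA.
have ra : {ae mu, forall t, D t -> radial a t (bv a t)}.
  move: (H2_radial Ha); apply: filterS => t rt Dt.
  have h : radial a t (bv (cutoff a) t).
    apply: cvgC_near_eq (rt Dt); move: (near_in_disk t); apply: filterS => r r1.
    by rewrite cutoff_in.
  by rewrite (bv_radial h).
split=> //; move: ra; apply: filterS => t rt Dt.
have h := rt Dt; apply: (@cvgC_modc_le _ _ _ _ _ _ _ h).
by move: (near_in_disk t); apply: filterS => r r1; exact: aA.
Qed.

Lemma A_ge0 : 0 <= A.
Proof. by apply: le_trans (modc_ge0 _) (aA (z := 0) _); rewrite /in_disk modc0. Qed.

Lemma H2_amul h : H2 h -> H2 (amul h).
Proof.
move=> Hh; have [anh h0 _] := Hh; have [d [M [hd dM]]] := H2_coefs Hh.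
have [e ae_] := analytic_diskM an_a anh.
have [_ _ [N hN]] := Hh.
split; [by exists e|by move=> z nz; rewrite /amul h0// mulr0|].
exists (A ^+ 2 * N) => r r01.
have mh := circle_measurable_coefs hd r01.
have mah := circle_measurable_coefs ae_ r01.
have [M1 [_ B1]] := has_coefs_locally_bounded hd r01.
have [M2 [_ B2]] := has_coefs_locally_bounded ae_ r01.
have r0 : 0 <= r by case/andP: r01.
have i1 (F : C -> C) (K : R) : circle_measurableC (fun t => F (r%:C * expi t)) ->
    (forall z, modc z <= r -> modc (F z) <= K) ->
    circle_integrable (fun t => modc (F (r%:C * expi t)) ^+ 2).
  move=> mF FK; apply: circle_integrableW; apply: (@circle_bounded_integrable _ (K ^+ 2)).
    exact: circle_measurableC_sqr.
  move=> t _; rewrite ger0_norm ?sqr_ge0// lerXn2r ?nnegrE ?modc_ge0//.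
    by apply: le_trans (modc_ge0 _) (FK 0 _); rewrite modc0.
  by rewrite FK// modc_circle.
apply: le_trans (_ : circle_mean (fun t => A ^+ 2 * modc (h (r%:C * expi t)) ^+ 2) <= _).
  apply: circle_mean_le; first exact: (i1 (amul h) M2 mah B2).
    by apply: circle_integrableZ; exact: (i1 h M1).
  move=> t _; rewrite modcM exprMn ler_wpM2r ?sqr_ge0//.
  by rewrite lerXn2r ?nnegrE ?modc_ge0 ?A_ge0// aA//; exact: in_disk_circle.
rewrite circle_meanZ; last exact: (i1 h M1).
by rewrite ler_wpM2l ?sqr_ge0// hN.
Qed.

Lemma bv_amul_ae h : H2 h ->
  {ae mu, forall t, D t -> bv (amul h) t = bv a t * bv h t}.
Proof.
move=> Hh; have [ra _] := radial_bv_bounded.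
move: ra (H2_radial Hh); apply: filterS2 => t ra rh Dt.
by apply: bv_radial; exact: (cvgCM (ra Dt) (rh Dt)).
Qed.

Lemma sqnorm_amul h : H2 h -> sqnorm (amul h) <= A ^+ 2 * sqnorm h.
Proof.
move=> Hh; have [_ i2] := bv_L2 Hh; have [_ j2] := bv_L2 (H2_amul Hh).
rewrite -circle_meanZ//; apply: ae_circle_mean_le => //.
  exact: circle_integrableZ.
have [_ ba] := radial_bv_bounded.
move: ba (bv_amul_ae Hh); apply: filterS2 => t ba bE Dt.
rewrite bE// modcM exprMn ler_wpM2r ?sqr_ge0//.
by rewrite lerXn2r ?nnegrE ?modc_ge0 ?A_ge0// ba.
Qed.

(** Moving the conjugate of [bv a] across the inner product turns the orthogonality condition in
    [Pplus] into an equation between inner products of [H2] functions. *)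
Lemma inner_toeplitz f g h : H2 f -> H2 g -> H2 h ->
  inner (fun t => (bv a t)^* * bv f t - bv g t) (bv h) = ip f (amul h) - ip g h.
Proof.
move=> Hf Hg Hh; rewrite /ip /inner.
have i1 := ip_integrable Hf (H2_amul Hh).
have i2 := ip_integrable Hg Hh.
rewrite -[X in _ - X]mul1r -mulNr -circle_meanCZ// -circle_meanCD//;
  last exact: circle_integrableCZ.
apply: circle_meanC_ae; move: (bv_amul_ae Hh); apply: filterS => t E Dt.
by rewrite E// rmorphM /=; ring.
Qed.

#[local] Opaque ip sqnorm.

Lemma amul_linear (k : C) g h :
  amul (fun z => g z + k * h z) = fun z => amul g z + k * amul h z.
Proof. by apply/funext => z; rewrite /amul; ring. Qed.

Lemma amul0 : amul (fun=> 0) = fun=> 0.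
Proof. by apply/funext => z; rewrite /amul mulr0. Qed.

Definition toeplitz_image f g := H2 g /\ forall h, H2 h -> ip g h = ip f (amul h).

Lemma toeplitz_image_unique f g g' : toeplitz_image f g -> toeplitz_image f g' ->
  g = g'.
Proof.
move=> [Hg gh] [Hg' gh'].
have Hd := H2D Hg (H2Z (-1) Hg').
have d0 : sqnorm (fun z => g z + (-1) * g' z) = 0.
  apply: complexI; rewrite -ipxx (ipDl Hg (H2Z (-1) Hg') Hd) (ipZl (-1) Hg' Hd).
  by rewrite (gh _ Hd) (gh' _ Hd) mulN1r subrr.
have E := sqnorm_eq0 Hd d0; apply/funext => z.
by have := congr1 (fun F => F z) E; rewrite mulN1r => /eqP; rewrite subr_eq0 => /eqP.
Qed.

(** The coefficients of the image can only be <f, a z^k>. Testing against the truncation of this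
    very sequence bounds it: a partial sum S of the squares satisfies S^2 <= A^2 |f|^2 S. The
    function with these coefficients has the required inner products with polynomials, hence, by
    continuity in norm, with all of [H2]. *)
Lemma toeplitz_image_exists f : H2 f -> exists g, toeplitz_image f g.
Proof.
move=> Hf; pose c k := ip f (amul (monomial k)).
have tr n : forall d, ip f (amul (trunc d n)) = \sum_(0 <= k < n) (d k)^* * c k.
  by move=> d; exact: (@ip_truncr f d n amul Hf H2_amul amul0 amul_linear).
have cB : l2_le (A ^+ 2 * sqnorm f) c.
  move=> n; set S := \sum_(0 <= k < n) _.
  have S0 : 0 <= S by apply: sumr_ge0 => k _; exact: sqr_ge0.
  have Sc : S%:C = ip f (amul (trunc c n)).
    rewrite (tr n c) rmorph_sum; apply: eq_bigr => k _.
    by rewrite mulrC mulcJ.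
  have St : sqnorm (trunc c n) <= S.
    apply: (sqnorm_l2_le (H2_trunc c n) (@has_coefs_trunc c n)) => m.
    have [mn|nm] := leqP m n.
      rewrite /S (big_cat_nat (leq0n m) mn)/=.
      apply: (@le_trans _ _ (\sum_(0 <= k < m) modc (c k) ^+ 2)).
        apply: ler_sum => k _; case: ifP => // _.
        by rewrite modc0 expr0n sqr_ge0.
      by rewrite lerDl sumr_ge0// => k _; exact: sqr_ge0.
    rewrite (big_cat_nat (leq0n n) (ltnW nm))/= [X in _ + X]big_nat [X in _ + X]big1 ?addr0.
      rewrite big_nat /S [leRHS]big_nat; apply: ler_sum => k /andP[_ kn].
      by rewrite kn.
    by move=> k /andP[nk _]; rewrite ltnNge nk modc0 expr0n.
  have := ip_cauchy_schwarz Hf (H2_amul (H2_trunc c n)).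
  rewrite -Sc modc_real (ger0_norm S0) => CS.
  have {}CS : S ^+ 2 <= A ^+ 2 * sqnorm f * S.
    apply: le_trans CS _; rewrite -[leRHS]mulrA [leRHS]mulrCA ler_wpM2l ?sqnorm_ge0//.
    by apply: le_trans (sqnorm_amul (H2_trunc c n)) _; rewrite ler_wpM2l ?sqr_ge0.
  have [S1|S1] := eqVneq S 0.
    by rewrite S1 mulr_ge0 ?sqr_ge0 ?sqnorm_ge0.
  have S2 : 0 < S by rewrite lt_neqAle eq_sym S1.
  by move: CS; rewrite expr2 ler_pM2r.
have [g [Hg gc]] := l2_H2 cB; exists g; split=> [|h Hh]; first exact: Hg.
have [d [M [hd dM]]] := H2_coefs Hh.
pose x := ip g h - ip f (amul h).
pose K := 2 * sqnorm g + 2 * (A ^+ 2 * sqnorm f).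
(* On Taylor polynomials both sides agree, so only the remainder of [h] contributes to the
   difference [x]. *)
have xK n : modc x ^+ 2 <= K * sqnorm (remainder h d n).
  have Hr := H2_remainder d n Hh; have Ht := H2_trunc d n.
  have Har := H2_amul Hr; have Hat := H2_amul Ht.
  have hE : h = fun z => remainder h d n z + 1 * trunc d n z.
    by apply/funext => z; rewrite /remainder mulN1r mul1r subrK.
  have -> : x = ip g (remainder h d n) + - ip f (amul (remainder h d n)).
    have E1 : ip g h = ip g (remainder h d n) + ip g (trunc d n).
      by rewrite {1}hE (ipDr Hr (H2Z 1 Ht) Hg) (ipZr 1 Ht Hg) conjC1 mul1r.
    have E2 : ip f (amul h) = ip f (amul (remainder h d n)) + ip f (amul (trunc d n)).
      by rewrite {1}hE (amul_linear 1 (remainder h d n) (trunc d n))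
        (ipDr Har (H2Z 1 Hat) Hf) (ipZr 1 Hat Hf) conjC1 mul1r.
    by rewrite /x E1 E2 (ip_trunc d n Hg gc) (tr n d) opprD addrACA subrr addr0.
  apply: le_trans (modc_sqrD_le _ _) _; rewrite modcN.
  have h1 := ip_cauchy_schwarz Hg Hr.
  have h2 : modc (ip f (amul (remainder h d n))) ^+ 2 <=
      sqnorm f * (A ^+ 2 * sqnorm (remainder h d n)).
    apply: le_trans (ip_cauchy_schwarz Hf Har) _.
    by rewrite ler_wpM2l ?sqnorm_ge0//; exact: sqnorm_amul.
  rewrite /K [leRHS]mulrDl; apply: lerD.
    by rewrite -mulrA ler_wpM2l.
  by rewrite -mulrA ler_wpM2l// mulrAC mulrC.
have x0 : modc x ^+ 2 <= 0.
  have kc : K * sqnorm (remainder h d n) @[n --> \oo] --> (0 : R).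
    by rewrite -(mulr0 K); apply: cvgMr; exact: sqnorm_remainder_cvg.
  rewrite -(cvg_lim _ kc)//; apply: limr_ge; first exact: cvgP kc.
  by apply: nearW.
have : modc x ^+ 2 == 0 by rewrite eq_le x0 sqr_ge0.
by rewrite sqrf_eq0 modc_eq0 subr_eq0 => /eqP.
Qed.

(** Existence guarantees that the choice in [Pplus] returns a genuine projection and not its default
    value. *)
Lemma coToeplitzP f : H2 f -> toeplitz_image f (coToeplitz a f).
Proof.
move=> Hf; rewrite /coToeplitz /Pplus; set S := [set _ | _].
have [g [Hg gh]] := toeplitz_image_exists Hf.
have Sg : S g.
  by split=> [|h Hh]; [exact: Hg|rewrite (inner_toeplitz Hf Hg Hh) (gh h Hh) subrr].
have [Hx xh] := @xgetPex _ (fun=> 0) S (ex_intro _ g Sg).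
split=> [|h Hh]; first exact: Hx.
have := xh h Hh; rewrite (inner_toeplitz Hf Hx Hh) => E.
exact/esym/(subr0_eq E).
Qed.

Lemma coToeplitz_eq f g : H2 f -> toeplitz_image f g -> coToeplitz a f = g.
Proof. by move=> Hf; apply: toeplitz_image_unique; exact: coToeplitzP. Qed.

End Toeplitz.

(** * Outer functions *)

Section ComplexExponential.
Variable R : realType.
Local Notation C := R[i].
Local Notation modc := (@Normc.normc R).

Section ExpPoly.
Variable F : numFieldType.

(** Its value at 1 is a partial sum of the exponential series at [x]; the formal variable sorts
    products of such sums by total degree. *)
Definition exp_poly (x : F) n : {poly F} := \poly_(k < n) (x ^+ k / k`!%:R).

Lemma fact_neq0 k : k`!%:R != 0 :> F.
Proof. by rewrite pnatr_eq0 -lt0n fact_gt0. Qed.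

Lemma coef_exp_polyM (x y : F) n k : (k < n)%N ->
  (exp_poly x n * exp_poly y n)`_k = (x + y) ^+ k / k`!%:R.
Proof.
move=> kn; rewrite coefM [x + y]addrC exprDn mulr_suml; apply: eq_bigr => j _.
have jk : (j <= k)%N by rewrite -ltnS.
rewrite !coef_poly (leq_ltn_trans jk kn) (leq_ltn_trans (leq_subr _ _) kn).
rewrite -[_ *+ 'C(k, j)]mulr_natr.
have -> : 'C(k, j)%:R = k`!%:R / (j`!%:R * (k - j)`!%:R) :> F.
  have nz : j`!%:R * (k - j)`!%:R != 0 :> F by rewrite mulf_neq0 ?fact_neq0.
  by apply: (mulIf nz); rewrite mulfVK// -!natrM bin_fact.
by field; rewrite !fact_neq0.
Qed.

(** Below degree [n] the product has the coefficients of [exp_poly (x + y) n], so only the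
    coefficients from [n] on are left over. *)
Lemma exp_polyM (x y : F) n :
  (exp_poly x n).[1] * (exp_poly y n).[1] - (exp_poly (x + y) n).[1] =
  \sum_(n <= k < n + n) (exp_poly x n * exp_poly y n)`_k.
Proof.
have sz : (size (exp_poly x n * exp_poly y n)%R <= n + n)%N.
  apply: leq_trans (size_polyMleq _ _) _; apply: leq_trans (leq_pred _) _.
  by apply: leq_add; exact: size_poly.
rewrite -hornerM (horner_coef_wide _ sz) (horner_coef_wide _ (size_poly _ _)).
rewrite -!(big_mkord xpredT (fun k => _`_k * 1 ^+ k)).
rewrite (big_cat_nat (leq0n n) (leq_addr n n))/= addrAC.
have -> : \sum_(0 <= i < n) (exp_poly x n * exp_poly y n)`_i * 1 ^+ i =
   \sum_(0 <= i < n) (exp_poly (x + y) n)`_i * 1 ^+ i.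
  rewrite big_nat [RHS]big_nat; apply: eq_bigr => k /andP[_ kn].
  by rewrite coef_exp_polyM// coef_poly kn.
by rewrite subrr add0r; apply: eq_bigr => k _; rewrite expr1n mulr1.
Qed.

Lemma horner_exp_poly (x : F) n : (exp_poly x n).[1] = \sum_(0 <= k < n) x ^+ k / k`!%:R.
Proof.
by rewrite horner_poly big_mkord; apply: eq_bigr => k _; rewrite expr1n mulr1.
Qed.

End ExpPoly.

Lemma modc_nat n : modc n%:R = n%:R.
Proof. by rewrite -(rmorph_nat (real_complex R)) modc_real ger0_norm. Qed.

Lemma modc_exp_poly_coef (z : C) n k :
  modc ((exp_poly z n)`_k) = (exp_poly (modc z) n)`_k.
Proof.
rewrite !coef_poly; case: ifP => _; last exact: modc0.
by rewrite modcM modcX modcV modc_nat.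
Qed.

(** The defect is a polynomial in [z] and [w] with nonnegative coefficients, so it is dominated by
    its value at the moduli, which tends to 0 by the real exponential law. *)
Lemma modc_exp_polyM_le (z w : C) n :
  modc ((exp_poly z n).[1] * (exp_poly w n).[1] - (exp_poly (z + w) n).[1]) <=
  (exp_poly (modc z) n).[1] * (exp_poly (modc w) n).[1] -
  (exp_poly (modc z + modc w) n).[1].
Proof.
rewrite !exp_polyM; apply: le_trans (modc_sum _ _ _) _; apply: ler_sum => k _.
rewrite !coefM; apply: le_trans (modc_sum _ _ _) _; apply: ler_sum => j _.
by rewrite modcM !modc_exp_poly_coef.
Qed.

Lemma cvg_exp_polyR (x : R) : (exp_poly x n).[1] @[n --> \oo] --> expR x.
Proof.
have := @is_cvg_series_exp_coeff R x; rewrite /expR.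
by under [X in _ -> X @ _ --> _]eq_fun do rewrite horner_exp_poly.
Qed.

Lemma expi_series_coef (y : R) k :
  (0 +i* y) ^+ k / k`!%:R = cos_coeff y k +i* sin_coeff y k.
Proof.
have E : (0 +i* y) ^+ k = ((~~ odd k)%:R * (-1) ^+ k./2 * y ^+ k) +i*
    ((odd k)%:R * (-1) ^+ k.-1./2 * y ^+ k).
  elim: k => [|k IH]; first by rewrite expr0; apply: complex_eqP => /=; rewrite ?expr0; ring.
  rewrite exprS IH; case: k {IH} => [|k].
    by apply: complex_eqP => /=; rewrite ?expr0 ?expr1; ring.
  rewrite /= negbK; case: (boolP (odd k)) => ok; apply: complex_eqP => /=;
    rewrite ?uphalf_half ?ok /= ?exprS ?expr0; ring.
rewrite E /cos_coeff /sin_coeff /= -exprnP.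
have -> : (k`!%:R)^-1 = (k`!%:R^-1 : R)%:C by rewrite fmorphV rmorph_nat.
by apply: complex_eqP => /=; ring.
Qed.

Lemma cvg_exp_polyi (y : R) :
  ((exp_poly (0 +i* y : C) n).[1] : C^o) @[n --> \oo] --> (expi y : C^o).
Proof.
have E n : (exp_poly (0 +i* y : C) n).[1] =
    series (cos_coeff y) n +i* series (sin_coeff y) n.
  rewrite horner_exp_poly; apply: complex_eqP.
    rewrite (big_morph (@complex.Re R) (@cReD R) erefl) /=; apply: eq_bigr => k _.
    by rewrite expi_series_coef.
  rewrite (big_morph (@complex.Im R) (@cImD R) erefl) /=; apply: eq_bigr => k _.
  by rewrite expi_series_coef.
under eq_fun do rewrite E.
apply/cvgC_ReIm; split => /=.
  have := @is_cvg_series_cos_coeff R y; rewrite /expi /= cos.unlock; exact.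
have := @is_cvg_series_sin_coeff R y; rewrite /expi /= sin.unlock; exact.
Qed.

(** For real and for purely imaginary arguments this is the series of the real exponential and of
    cosine and sine; the two combine because the defect of multiplicativity tends to 0. *)
Lemma cvg_exp_poly (z : C) :
  ((exp_poly z n).[1] : C^o) @[n --> \oo] --> (expc z : C^o).
Proof.
case: z => x y; pose zx : C := x%:C; pose zy : C := 0 +i* y.
have zE : x +i* y = zx + zy by apply: complex_eqP => /=; rewrite ?addr0 ?add0r.
have cx : ((exp_poly zx n).[1] : C^o) @[n --> \oo] --> ((expR x)%:C : C^o).
  have E n : (exp_poly zx n).[1] = ((exp_poly x n).[1])%:C.
    rewrite !horner_exp_poly rmorph_sum; apply: eq_bigr => k _.
    by rewrite /zx rmorphM rmorphXn /= fmorphV rmorph_nat.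
  under eq_fun do rewrite E.
  by apply/cvgC_ReIm; split => /=; [exact: cvg_exp_polyR|exact: cvg_cst].
pose proof (cxy := cvgCM cx (@cvg_exp_polyi y)).
have d0 : ((exp_poly (modc zx) n).[1] * (exp_poly (modc zy) n).[1] -
    (exp_poly (modc zx + modc zy) n).[1]) @[n --> \oo] --> (0 : R).
  rewrite -[X in _ --> X](subrr (expR (modc zx + modc zy))) {1}expRD.
  by apply: cvgB; [apply: cvgM; exact: cvg_exp_polyR|exact: cvg_exp_polyR].
have dC : ((exp_poly zx n).[1] * (exp_poly zy n).[1] - (exp_poly (zx + zy) n).[1] : C^o)
    @[n --> \oo] --> (0 : C^o).
  apply: cvgC_squeeze d0; apply: nearW => n; rewrite subr0.
  exact: modc_exp_polyM_le.
pose proof (h := cvgCB cxy dC); move: h; rewrite subr0 /expc /= zE.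
apply: cvg_trans; apply: near_eq_cvg; apply: nearW => n.
by rewrite opprB addrC subrK.
Qed.

Lemma expcD (z w : C) : expc (z + w) = expc z * expc w.
Proof.
case: z w => a b [c d]; rewrite /expc /= expRD expiD rmorphM /=; ring.
Qed.

Lemma expc0 : expc 0 = 1 :> C.
Proof. by rewrite /expc /= expR0 expi0 mulr1. Qed.

Lemma modc_expc (z : C) : modc (expc z) = expR (complex.Re z).
Proof. by rewrite /expc modcM modc_expi mulr1 modc_real ger0_norm// expR_ge0. Qed.

Lemma cvg_expc (w : nat -> C) (l : C) : (w n : C^o) @[n --> \oo] --> (l : C^o) ->
  (expc (w n) : C^o) @[n --> \oo] --> (expc l : C^o).
Proof.
move=> /cvgC_ReIm[wr wi]; apply: cvgCM.
  apply/cvgC_ReIm; split => /=; last exact: cvg_cst.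
  by apply: continuous_cvg => //; exact: continuous_expR.
apply/cvgC_ReIm; split => /=.
  by apply: continuous_cvg => //; exact: continuous_cos.
by apply: continuous_cvg => //; exact: continuous_sin.
Qed.

Lemma analytic_diskD (f g : C -> C) : analytic_disk f -> analytic_disk g ->
  analytic_disk (fun z => f z + g z).
Proof. by move=> [c fc] [d gd]; eexists; exact: has_coefsD fc gd. Qed.

Lemma analytic_diskZ (k : C) (f : C -> C) : analytic_disk f ->
  analytic_disk (fun z => k * f z).
Proof. by move=> [c fc]; eexists; exact: (has_coefsZ (a := k) fc). Qed.

Lemma analytic_disk_cst (k : C) : analytic_disk (fun=> k).
Proof.
exists (fun j => k%:P`_j); apply: (eq_has_coefs _ _ (@has_coefs_poly R k%:P)) => //.
by move=> z _; rewrite hornerC.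
Qed.

Lemma analytic_diskX (f : C -> C) n : analytic_disk f ->
  analytic_disk (fun z => f z ^+ n).
Proof.
move=> af; elim: n => [|n IH]; first exact: analytic_disk_cst.
have E : (fun z => f z ^+ n.+1) = fun z => f z * f z ^+ n.
  by apply/funext => z; rewrite exprS.
rewrite E; exact: (analytic_diskM af IH).
Qed.

(** Partial sums of the exponential series of [f z] are analytic and bounded by [expR M] where [f]
    is bounded by [M], so [has_coefs_limit] applies. *)
Lemma analytic_disk_expc (f : C -> C) : analytic_disk f ->
  analytic_disk (fun z => expc (f z)).
Proof.
move=> af; have [c fc] := af.
have an n : analytic_disk (fun z => (exp_poly (f z) n).[1]).
  elim: n => [|n IH].
    have E : (fun z => (exp_poly (f z) 0).[1]) = fun=> 0 : C.
      by apply/funext => z; rewrite horner_exp_poly big_geq.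
    by rewrite E; exact: analytic_disk_cst.
  have E : (fun z => (exp_poly (f z) n.+1).[1]) =
      fun z => (exp_poly (f z) n).[1] + (n`!%:R)^-1 * f z ^+ n.
    by apply/funext => z; rewrite !horner_exp_poly big_nat_recr//= [X in _ + X]mulrC.
  rewrite E; exact: (analytic_diskD IH (analytic_diskZ _ (analytic_diskX n af))).
have [d dn] := choice an.
have [|||e [he _]] := @has_coefs_limit R (fun n z => (exp_poly (f z) n).[1]) d
  (fun z => expc (f z)).
- exact: dn.
- by move=> z _; exact: cvg_exp_poly.
- move=> r r01; have [M [_ fM]] := has_coefs_locally_bounded fc r01.
  exists (expR M) => m z zr; rewrite horner_exp_poly.
  apply: le_trans (modc_sum _ _ _) _.
  have h := @cvg_exp_polyR M; rewrite -(cvg_lim _ h)//.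
  have M0 : 0 <= M by apply: le_trans (modc_ge0 _) (fM z zr).
  apply: (@le_trans _ _ (exp_poly M m).[1]).
    rewrite horner_exp_poly; apply: ler_sum => k _.
    rewrite modcM modcX modcV modc_nat ler_wpM2r ?invr_ge0//.
    by rewrite lerXn2r ?nnegrE ?modc_ge0// fM.
  apply: (nondecreasing_cvgn_le (u_ := fun n => (exp_poly M n).[1])); last exact: cvgP h.
  apply/nondecreasing_seqP => n; rewrite !horner_exp_poly big_nat_recr//= lerDl.
  by rewrite divr_ge0// exprn_ge0.
by exists e.
Qed.

End ComplexExponential.

(** * Herglotz transforms and injectivity for outer symbols *)

Section Outer.
Variable R : realType.
Local Notation C := R[i].
Local Notation modc := (@Normc.normc R).
Local Notation mu := (@lebesgue_measure R).
Local Notation D := (`[0 : R, pi *+ 2]%classic).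
Implicit Types (u v : R -> R) (z : C).

Definition herglotz v z : C :=
  circle_meanC (fun t => (expi t + z) / (expi t - z) * (v t)%:C).

Lemma circle_measurable_real v : mu.-integrable D (EFin \o v) ->
  circle_measurableC (fun t => (v t)%:C).
Proof.
move=> iv; split => /=; last exact: measurable_cst.
by apply/measurable_EFinP; exact: measurable_int iv.
Qed.

Lemma integrable_normZ v (k : R) : mu.-integrable D (EFin \o v) ->
  mu.-integrable D (EFin \o (fun t => k * `|v t|)).
Proof.
move=> iv; have iN : mu.-integrable D (fun t => `|(EFin \o v) t|%E) by exact: integrable_abse.
by rewrite (_ : _ \o _ = (fun t => k%:E * `|(EFin \o v) t|)%E)//; exact: integrableZl.
Qed.

(** The geometric expansion of the kernel is integrated term by term. The resulting power series,
    with Fourier coefficients of [v], is the source of the analyticity of [herglotz v]. *)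
Lemma cauchy_transform v z : mu.-integrable D (EFin \o v) -> in_disk z ->
  circle_integrableC (fun t => cauchy_kernel z t * (v t)%:C) /\
  (psum (fun k => circle_meanC (fun t => (expi t ^+ k)^* * (v t)%:C)) n z : C^o)
    @[n --> \oo] --> (circle_meanC (fun t => cauchy_kernel z t * (v t)%:C) : C^o).
Proof.
move=> iv z1; have mv := circle_measurable_real iv.
have civ : circle_integrableC (fun t => (v t)%:C).
  by apply: circle_integrableC_real; exact: circle_integrableW.
have ik k : circle_integrableC (fun t => (expi t ^+ k)^* * (v t)%:C).
  have [|||//] := @circle_meanC_dominated _ (fun n t => (expi t ^+ k)^* * (v t)%:C)
    (fun t => (expi t ^+ k)^* * (v t)%:C) (fun t => 1 * `|v t|) _ _ (integrable_normZ 1 iv).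
  - by move=> _; apply: circle_measurableCM => //; exact: circle_measurable_expiX.
  - by apply: aeW => t _; exact: cvgC_cst.
  - by apply: aeW => t _ _; rewrite modcM modc_expiXJ modc_real.
have [|||iK cK] := @circle_meanC_dominated _
  (fun n t => (\sum_(0 <= k < n) z ^+ k * (expi t ^+ k)^*) * (v t)%:C)
  (fun t => cauchy_kernel z t * (v t)%:C) (fun t => (1 - modc z)^-1 * `|v t|)
  _ _ (integrable_normZ _ iv).
- by move=> n; apply: circle_measurableCM => //; exact: circle_measurable_cauchy_sum.
- apply: aeW => t _; exact: (cvgCM (cvg_cauchy_kernel z1) (@cvgC_cst _ _ _ _ _)).
- by apply: aeW => t n _; rewrite modcM modc_real ler_wpM2r// modc_cauchy_sum_le.
split => //; apply: cvgC_near_eq cK; apply: nearW => n.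
transitivity (circle_meanC (fun t => \sum_(0 <= k < n) z ^+ k * ((expi t ^+ k)^* * (v t)%:C))).
  rewrite circle_meanC_sum => [|k]; last exact: circle_integrableCZ.
  by apply: eq_bigr => k _; rewrite circle_meanCZ// mulrC.
apply: eq_circle_meanC => t; rewrite mulr_suml; apply: eq_bigr => k _.
by rewrite mulrA.
Qed.

Lemma herglotz_integrable v z : mu.-integrable D (EFin \o v) -> in_disk z ->
  circle_integrableC (fun t => (expi t + z) / (expi t - z) * (v t)%:C).
Proof.
move=> iv z1; have [iK _] := cauchy_transform iv z1.
have civ : circle_integrableC (fun t => (v t)%:C).
  by apply: circle_integrableC_real; exact: circle_integrableW.
have E : (fun t => (expi t + z) / (expi t - z) * (v t)%:C) =
  fun t => 2 * (cauchy_kernel z t * (v t)%:C) + (-1) * (v t)%:C.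
  by apply/funext => t; rewrite herglotz_cauchy// mulrDl mulrA.
by rewrite E; apply: circle_integrableCD; exact: circle_integrableCZ.
Qed.

Lemma herglotzE v z : mu.-integrable D (EFin \o v) -> in_disk z ->
  herglotz v z = 2 * circle_meanC (fun t => cauchy_kernel z t * (v t)%:C) +
    (- (circle_mean v)%:C).
Proof.
move=> iv z1; have [iK _] := cauchy_transform iv z1.
have civ : circle_integrableC (fun t => (v t)%:C).
  by apply: circle_integrableC_real; exact: circle_integrableW.
rewrite -mulN1r -circle_meanC_real -!circle_meanCZ// -circle_meanCD;
  do ?exact: circle_integrableCZ.
by apply: eq_circle_meanC => t; rewrite herglotz_cauchy// mulrDl mulrA.
Qed.

Lemma analytic_herglotz v : mu.-integrable D (EFin \o v) ->
  analytic_disk (herglotz v).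
Proof.
move=> iv.
have ac : analytic_disk (fun z => circle_meanC (fun t => cauchy_kernel z t * (v t)%:C)).
  by eexists => z z1; have [_ h] := cauchy_transform iv z1; exact: h.
have [c hc] := analytic_diskD (analytic_diskZ 2 ac) (analytic_disk_cst (- (circle_mean v)%:C)).
exists c; apply: eq_has_coefs hc => // z z1.
exact: herglotzE.
Qed.

Lemma herglotzD u v z : mu.-integrable D (EFin \o u) -> mu.-integrable D (EFin \o v) ->
  in_disk z -> herglotz u z + herglotz v z = herglotz (fun t => u t + v t) z.
Proof.
move=> iu iv z1; rewrite /herglotz -circle_meanCD; do ?exact: herglotz_integrable.
by apply: eq_circle_meanC => t; rewrite rmorphD mulrDr.
Qed.

Lemma Re_herglotz_mean v z : mu.-integrable D (EFin \o v) -> in_disk z ->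
  complex.Re (herglotz v z) = circle_mean (fun t => v t * poisson_kernel z t).
Proof.
move=> iv z1; apply: eq_circle_mean => t.
by rewrite cReM /= mulr0 subr0 Re_herglotz// mulrC.
Qed.

(** The real part is the mean of [v] against the Poisson kernel, which is nonnegative with mean
    1. *)
Lemma Re_herglotz_le v z (M : R) : mu.-integrable D (EFin \o v) -> in_disk z ->
  (forall t, v t <= M) -> complex.Re (herglotz v z) <= M.
Proof.
move=> iv z1 vM; rewrite Re_herglotz_mean//.
have iP : circle_integrable (poisson_kernel z).
  apply: circle_integrableW.
  apply: (@circle_bounded_integrable _ (2 * (1 - modc z)^-1 + 1)).
    exact: circle_measurable_poissonR.
  by move=> t _; rewrite ger0_norm ?poisson_ge0//; exact: poisson_le.
have <- : circle_mean (fun t => M * poisson_kernel z t) = M.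
  by rewrite circle_meanZ// circle_mean_poisson// mulr1.
apply: circle_mean_le => [||t _].
- by apply: circle_integrableW; exact: integrable_poissonM.
- exact: circle_integrableZ.
- by rewrite ler_wpM2r// poisson_ge0.
Qed.

Lemma herglotz_cvg0 (v_ : nat -> R -> R) v z : mu.-integrable D (EFin \o v) ->
  (forall n, mu.-integrable D (EFin \o v_ n)) -> in_disk z ->
  (forall n t, `|v_ n t| <= `|v t|) ->
  (forall t, v_ n t @[n --> \oo] --> (0 : R)) ->
  (herglotz (v_ n) z : C^o) @[n --> \oo] --> (0 : C^o).
Proof.
move=> iv iv_ z1 vv v0.
have mK : circle_measurableC (fun t => (expi t + z) / (expi t - z)).
  have E : (fun t => (expi t + z) / (expi t - z)) = fun t => 2 * cauchy_kernel z t + (-1).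
    by apply/funext => t; rewrite herglotz_cauchy.
  rewrite E; apply: circle_measurableCD; last exact: circle_measurableC_cst.
  apply: circle_measurableCM; first exact: circle_measurableC_cst.
  exact: circle_measurable_cauchy.
have [|||_] := @circle_meanC_dominated _
  (fun n t => (expi t + z) / (expi t - z) * (v_ n t)%:C) (fun=> 0)
  (fun t => (2 * (1 - modc z)^-1 + 1) * `|v t|) _ _ (integrable_normZ _ iv).
- move=> n; apply: circle_measurableCM => //; exact: circle_measurable_real.
- apply: aeW => t _; rewrite -(mulr0 ((expi t + z) / (expi t - z))).
  apply: cvgCM; first exact: cvgC_cst.
  by apply/cvgC_ReIm; split => /=; [exact: v0|exact: cvg_cst].
- apply: aeW => t n _; rewrite modcM modc_real ler_pM ?modc_ge0//.
  rewrite herglotz_cauchy//; apply: le_trans (modcD _ _) _.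
  rewrite modcN modc1 lerD2r modcM ler_pM ?modc_ge0 ?modc_cauchy_le//.
  by rewrite modc_nat.
by rewrite circle_meanC_cst.
Qed.

Variable a : C -> C.
Hypotheses (an_a : analytic_disk a) (out_a : outer a).

Lemma outer_neq0 : a 0 != 0.
Proof.
have [lam [u [lam1 iu aE]]] := out_a.
rewrite aE; last by rewrite /in_disk modc0.
by rewrite -modc_eq0 modcM modc_expc lam1 mul1r gt_eqF// expR_gt0.
Qed.

(* [a] times [exp (- H (max (u, - m)))] is [lam * exp (H (min (u + m, 0)))]: it
   is bounded by 1 on the disk because the Poisson kernel is nonnegative. *)
Lemma outer_bounded_approx (k : nat) : exists (lam : C) (h : nat -> C -> C),
  [/\ modc lam = 1, forall m, H2 (h m),
      forall m z, in_disk z -> modc (a z * h m z) <= 1 &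
      forall z, in_disk z -> (a z * h m z : C^o) @[m --> \oo] --> (lam * z ^+ k : C^o)].
Proof.
have [lam [u [lam1 iu aE]]] := out_a.
pose w (m : nat) t := - Num.max (u t) (- m%:R).
pose v (m : nat) t := u t + w m t.
have mu_ : measurable_fun D u by apply/measurable_EFinP; exact: measurable_int iu.
have iw m : mu.-integrable D (EFin \o w m).
  have iB : mu.-integrable D (EFin \o (fun t => 1 * `|u t| + m%:R)).
    rewrite (_ : _ \o _ = (EFin \o (fun t => 1 * `|u t|)%R) \+ (EFin \o (fun=> m%:R)%R))%E//.
    apply: integrableD => //; first exact: integrable_normZ.
    by apply: (@circle_bounded_integrable _ `|m%:R|).
  apply: le_integrable iB => //.
    apply/measurable_EFinP; apply: measurableT_comp => //.
    by apply: measurable_maxr => //; exact: measurable_cst.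
  move=> t _ /=; rewrite lee_fin normrN mul1r [leRHS]ger0_norm ?addr_ge0//.
  have [_|_] := leP (u t) (- m%:R); last by rewrite lerDl.
  by rewrite normrN ger0_norm// lerDr.
have vle m t : v m t <= 0.
  by rewrite /v /w subr_le0 le_max lexx.
have vabs m t : `|v m t| <= `|u t|.
  rewrite ler0_norm// /v /w opprB.
  have [um|um] := leP (u t) (- m%:R); last by rewrite subrr.
  rewrite ler0_norm; last by apply: le_trans um _; rewrite oppr_le0.
  by rewrite gerDr oppr_le0.
(* [v m t] is exactly 0 as soon as [m] is at least |u(t)|. *)
have v0 t : v m t @[m --> \oo] --> (0 : R).
  apply: (@cvg_trans _ ((fun=> 0 : R) @ \oo)); last exact: cvg_cst.
  apply: near_eq_cvg; exists (Num.truncn `|u t|).+1 => // m /= um.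
  have hm : `|u t| <= m%:R.
    by apply: le_trans (ltW (truncnS_gt _)) _; rewrite ler_nat.
  rewrite /v /w max_l ?subrr//; move: hm; rewrite ler_norml => /andP[h _].
  exact: h.
have iv m : mu.-integrable D (EFin \o v m).
  rewrite (_ : _ \o _ = (EFin \o u) \+ (EFin \o w m))%E//; exact: integrableD.
(* This bounds [h m] by [expR m%:R] on the disk, which places it in [H2]. *)
have wle m t : w m t <= m%:R by rewrite /w lerNl le_max lexx orbT.
pose h m : C -> C := cutoff (fun z => z ^+ k * expc (herglotz (w m) z)).
have anh m : analytic_disk (fun z => z ^+ k * expc (herglotz (w m) z)).
  apply: analytic_diskM; last by apply: analytic_disk_expc; exact: analytic_herglotz.
  eexists; apply: (eq_has_coefs _ _ (@has_coefs_poly R 'X^k)); last by move=> j; exact: erefl.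
  by move=> z _; rewrite hornerXn.
have ahE m z : in_disk z -> a z * h m z = lam * z ^+ k * expc (herglotz (v m) z).
  move=> z1; rewrite /h cutoff_in// aE// -(herglotzD iu (iw m) z1) expcD.
  by rewrite -/(herglotz u z); ring.
exists lam, h; split=> [|m|m z z1|z z1]; first exact: lam1.
- have [c hc] := anh m.
  have [|//] := @H2_bounded R (h m) c (expR m%:R) (has_coefs_cutoff hc) (@cutoff_out _ _).
  move=> z z1; rewrite /h cutoff_in// modcM modcX modc_expc.
  rewrite -[leRHS]mul1r ler_pM ?exprn_ge0 ?modc_ge0 ?expR_ge0//.
    by rewrite exprn_ile1 ?modc_ge0// ltW.
  by rewrite ler_expR; apply: Re_herglotz_le.
- rewrite (ahE m z z1) modcM (modcM lam) lam1 mul1r modcX modc_expc.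
  rewrite -[leRHS]mul1r ler_pM ?exprn_ge0 ?modc_ge0 ?expR_ge0//.
    by rewrite exprn_ile1 ?modc_ge0// ltW.
  by rewrite -expR0 ler_expR; apply: Re_herglotz_le.
- have h0 := @herglotz_cvg0 v u z iu iv z1 vabs v0.
  pose proof (e1 := cvg_expc h0); rewrite expc0 in e1.
  pose proof (e2 := cvgCM (@cvgC_cst _ _ _ _ (lam * z ^+ k)) e1).
  rewrite mulr1 in e2; apply: cvgC_near_eq e2; apply: nearW => m.
  exact: (ahE m z z1).
Qed.

(** Split [f] into a Taylor polynomial and a remainder. As [a * h m] is orthogonal to [f] and has
    norm at most 1, its pairing with the polynomial is bounded by the norm of the remainder. When
    [m] grows, its coefficients tend to those of lam z^k, and this pairing becomes c_k times a
    unimodular number; then the remainder tends to 0. *)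
Lemma outer_toeplitz_injective (f : C -> C) : H2 f ->
  (forall h, H2 h -> ip f (amul a h) = 0) -> f = fun=> 0.
Proof.
move=> Hf f0; have [c [M [fc cM]]] := H2_coefs Hf.
apply: (H2_coefs_eq0 Hf fc) => k.
have [lam [h [lam1 Hh hb hc]]] := outer_bounded_approx k.
have phiout m z : ~ in_disk z -> amul a (h m) z = 0.
  by move=> nz; have [_ ho _] := Hh m; rewrite /amul ho// mulr0.
have anphi m : analytic_disk (amul a (h m)).
  by have [ah _ _] := Hh m; exact: analytic_diskM.
have [d phid] := choice anphi.
have Hphi m : H2 (amul a (h m)) /\ l2_le 1 (d m).
  have [] := H2_bounded (phid m) (phiout m) (hb m).
  by rewrite expr1n.
have [|||e [fe de]] := @has_coefs_limit R (fun m => amul a (h m)) d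
  (fun z => lam * z ^+ k).
- exact: phid.
- exact: hc.
- move=> r /andP[r0 r1]; exists 1 => m z zr; apply: hb.
  exact: le_lt_trans zr r1.
have eE : e =1 fun j => lam * (j == k)%:R.
  apply: has_coefs_unique fe _; apply: has_coefsZ.
  apply: (eq_has_coefs _ _ (@has_coefs_poly R 'X^k)) => [z _|j].
    by rewrite hornerXn.
  by rewrite coefXn.
have key N : (k < N)%N -> modc (c k) ^+ 2 <= sqnorm (remainder f c N).
  move=> kN; have Hr := H2_remainder c N Hf; have Ht := H2_trunc c N.
  have B m : modc (\sum_(0 <= j < N) c j * (d m j)^*) ^+ 2 <= sqnorm (remainder f c N).
    have [Hm dm] := Hphi m.
    have fE : f = fun z => remainder f c N z + trunc c N z.
      by apply/funext => z; rewrite /remainder mulN1r subrK.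
    have := f0 _ (Hh m); rewrite {1}fE (ipDl Hr Ht Hm) (ipC Hm Ht).
    rewrite (ip_trunc c N Hm (phid m)) rmorph_sum.
    rewrite (eq_bigr (fun j => c j * (d m j)^*)); last first.
      by move=> j _; rewrite rmorphM /= conjCK.
    move=> /eqP; rewrite addrC addr_eq0 => /eqP ->; rewrite modcN.
    apply: le_trans (ip_cauchy_schwarz Hr Hm) _.
    by rewrite ler_piMr ?sqnorm_ge0// (sqnorm_l2_le Hm (phid m)).
  have cl : (\sum_(0 <= j < N) c j * (d m j)^* : C^o) @[m --> \oo] -->
      (\sum_(0 <= j < N) c j * (e j)^* : C^o).
    apply: cvgC_sum => j.
    exact: (cvgCM (@cvgC_cst _ _ _ _ _) (cvg_conjc (de j))).
  have sE : \sum_(0 <= j < N) c j * (e j)^* = c k * lam^*.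
    rewrite (bigD1_seq k)//= ?iota_uniq ?mem_index_iota//= big1.
      by rewrite eE eqxx mulr1 addr0.
    by move=> j /negbTE jk; rewrite eE jk mulr0 conjC0 mulr0.
  pose proof (cm := cvg_modc cl); rewrite sE modcM modcJ lam1 mulr1 in cm.
  have c2 : modc (\sum_(0 <= j < N) c j * (d m j)^*) ^+ 2 @[m --> \oo] --> modc (c k) ^+ 2.
    by rewrite expr2; under eq_fun do rewrite expr2; exact: cvgM.
  rewrite -(cvg_lim _ c2)//; apply: limr_le; first exact: cvgP c2.
  by apply: nearW.
have : modc (c k) ^+ 2 <= 0.
  have r0 := sqnorm_remainder_cvg Hf fc.
  rewrite -(cvg_lim _ r0)//; apply: limr_ge; first exact: cvgP r0.
  by exists k.+1 => // N /= kN; exact: key.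
move=> ck0; have : modc (c k) ^+ 2 == 0 by rewrite eq_le ck0 sqr_ge0.
by rewrite sqrf_eq0 modc_eq0 => /eqP.
Qed.

End Outer.

(** * The shift on the range space *)

Section ShiftNorm.
Variable R : realType.
Local Notation C := R[i].
Local Notation modc := (@Normc.normc R).
Implicit Types (f g h b : C -> C).
Local Notation e0 := (@monomial R 0).

Lemma ip_shift f g : H2 f -> H2 g -> ip (Sshift f) (Sshift g) = ip f g.
Proof.
move=> Hf Hg; apply: circle_meanC_ae; move: (bv_shift_ae Hf) (bv_shift_ae Hg).
apply: filterS2 => t Ef Eg Dt; rewrite Ef// Eg// rmorphM /=.
by rewrite mulrACA expiJ mul1r.
Qed.

#[local] Opaque ip sqnorm.

Lemma backward_shift f : H2 f -> exists b, H2 b /\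
  f = fun z => Sshift b z + f 0 * e0 z.
Proof.
move=> Hf; have [c [M [fc cM]]] := H2_coefs Hf.
have c1M : l2_le M (fun k => c k.+1).
  move=> n; apply: le_trans (cM n.+1); rewrite big_nat_recl// lerDr.
  exact: sqr_ge0.
have [b [Hb bc]] := l2_H2 c1M; exists b; split; first exact: Hb.
have Hr := H2D (H2_shift Hb) (H2Z (f 0) (H2_monomial R 0)).
apply: (H2_eq_coefs Hf Hr fc).
have h := has_coefsD (has_coefs_shift bc) (has_coefsZ (a := f 0) (@has_coefs_monomial R 0)).
apply: eq_has_coefs h => // -[|k] /=; first by rewrite mulr1 add0r (has_coefs0 fc).
by rewrite mulr0 addr0.
Qed.

Lemma ip_e0 f : H2 f -> ip f e0 = f 0.
Proof.
by move=> Hf; have [c [M [fc _]]] := H2_coefs Hf; rewrite (ip_monomial 0 Hf fc) (has_coefs0 fc).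
Qed.

Lemma ip_shift_e0 f : H2 f -> ip (Sshift f) e0 = 0.
Proof. by move=> Hf; rewrite (ip_e0 (H2_shift Hf)) /Sshift mul0r. Qed.

Lemma ip_e0e0 : ip e0 e0 = 1.
Proof.
rewrite (ip_e0 (H2_monomial R 0)) /monomial cutoff_in ?expr0//.
by rewrite /in_disk modc0.
Qed.

Lemma sqnorm_shiftD f (k : C) : H2 f ->
  sqnorm (fun z => Sshift f z + k * e0 z) = sqnorm f + modc k ^+ 2.
Proof.
move=> Hf; have Hs := H2_shift Hf; have H0 := H2_monomial R 0.
have Hk := H2Z k H0; have HF := H2D Hs Hk.
apply: complexI; rewrite -ipxx (ipDl Hs Hk HF) (ipDr Hs Hk Hs) (ipDr Hs Hk Hk).
rewrite (ipZl k H0 Hs) (ipZl k H0 Hk) !(ipZr k H0) //.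
rewrite ip_shift// (ipC Hs H0) ip_shift_e0// ip_e0e0 conjC0 !mulr0 addr0 add0r mulr1.
by rewrite mulcJ ipxx rmorphD.
Qed.

Variable a : C -> C.
Hypotheses (Ha : Hinfty a) (out_a : outer a).
Local Notation T := (coToeplitz a).

Let an_a : analytic_disk a. Proof. by case: Ha. Qed.
Let A := sval (cid Ha.2).
Let aA : forall z, in_disk z -> modc (a z) <= A.
Proof. exact: (svalP (cid Ha.2)). Qed.

Lemma H2_coToeplitz f : H2 f -> H2 (T f).
Proof. by move=> Hf; case: (coToeplitzP an_a aA Hf). Qed.

Lemma ip_coToeplitz f h : H2 f -> H2 h -> ip (T f) h = ip f (amul a h).
Proof. by move=> Hf Hh; have [_ E] := coToeplitzP an_a aA Hf; exact: E. Qed.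

Lemma coToeplitz_inj f g : H2 f -> H2 g -> T f = T g -> f = g.
Proof.
move=> Hf Hg E.
have Hd := H2D Hf (H2Z (-1) Hg).
have d0 : (fun z => f z + -1 * g z) = fun=> 0.
  apply: (outer_toeplitz_injective an_a out_a Hd) => h Hh.
  have Hah := H2_amul an_a aA Hh.
  rewrite (ipDl Hf (H2Z (-1) Hg) Hah) (ipZl (-1) Hg Hah).
  by rewrite -(ip_coToeplitz Hf Hh) -(ip_coToeplitz Hg Hh) E mulN1r subrr.
apply/funext => z; have := congr1 (fun F => F z) d0.
by rewrite mulN1r => /eqP; rewrite subr_eq0 => /eqP.
Qed.

Lemma range_norm_coToeplitz f : H2 f -> range_norm a (T f) = normH2 f.
Proof.
move=> Hf; rewrite /range_norm; set S := [set _ | _].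
have Sf : S f by split.
have [Hx Ex] := @xgetPex _ (fun=> 0) S (ex_intro _ f Sf).
by rewrite (coToeplitz_inj Hx Hf Ex).
Qed.

Let a0 := a 0.
Let a0_neq0 : a0 != 0. Proof. exact: (outer_neq0 out_a). Qed.
Let Hca : H2 (cutoff a).
Proof.
have [c ac] := an_a.
have [|//] := @H2_bounded R (cutoff a) c A (has_coefs_cutoff ac) (@cutoff_out _ a).
by move=> z z1; rewrite cutoff_in// aA.
Qed.

Lemma amul_e0 : amul a e0 = cutoff a.
Proof.
apply/funext => z; rewrite /amul /monomial /cutoff; case: ifP => _.
  by rewrite expr0 mulr1.
by rewrite mulr0.
Qed.

(** The preimage [F] of the overview; [e0] and [cutoff a] stand for the constant 1 and for [a] as
    elements of [H2]. *)
Definition shift_preimage f (z : C) : C :=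
  Sshift f z + (- (ip (Sshift f) (cutoff a) / a0^*)) * e0 z.

Lemma H2_shift_preimage f : H2 f -> H2 (shift_preimage f).
Proof.
by move=> Hf; exact: (H2D (H2_shift Hf) (H2Z _ (H2_monomial R 0))).
Qed.

Lemma coToeplitz_shift f : H2 f -> T (shift_preimage f) = Sshift (T f).
Proof.
move=> Hf; apply: (coToeplitz_eq an_a aA (H2_shift_preimage Hf)).
have HT := H2_coToeplitz Hf; have HS := H2_shift Hf; have HST := H2_shift HT.
have H0 := H2_monomial R 0.
split=> [|h Hh]; first exact: HST.
have [b [Hb hE]] := backward_shift Hh.
have Hab := H2_amul an_a aA Hb; have Hah := H2_amul an_a aA Hh.
have HSb := H2_shift Hb; have HSab := H2_shift Hab.
have ahE : amul a h = fun z => Sshift (amul a b) z + h 0 * cutoff a z.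
  apply/funext => z; have hz := congr1 (fun F => F z) hE.
  by rewrite -amul_e0 /amul hz /Sshift; ring.
have L : ip (Sshift (T f)) h = ip (Sshift f) (Sshift (amul a b)).
  rewrite {1}hE (ipDr HSb (H2Z (h 0) H0) HST) (ipZr (h 0) H0 HST).
  by rewrite (ip_shift_e0 HT) mulr0 addr0 (ip_shift HT Hb) (ip_coToeplitz Hf Hb) (ip_shift Hf Hab).
rewrite L /shift_preimage (ipDl HS (H2Z _ H0) Hah) (ipZl _ H0 Hah).
rewrite (ipC Hah H0) (ip_e0 Hah) {1}ahE (ipDr HSab (H2Z (h 0) Hca) HS).
rewrite (ipZr (h 0) Hca HS) /amul -/a0 rmorphM /=.
have c0 : a0^* != 0 by rewrite conjC_eq0.
by move: (ip _ _) (ip _ _) (h 0)^* => x y w; field.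
Qed.

Lemma sqnorm_shift_preimage f : H2 f ->
  sqnorm (shift_preimage f) =
  sqnorm f + modc (ip (Sshift f) (cutoff a)) ^+ 2 / modc a0 ^+ 2.
Proof.
move=> Hf; rewrite sqnorm_shiftD// modcN modcM modcV modcJ.
by rewrite exprMn exprVn.
Qed.

Lemma range_norm_shift f : H2 f ->
  range_norm a (Sshift (T f)) = normH2 (shift_preimage f).
Proof.
move=> Hf; rewrite -(coToeplitz_shift Hf).
exact: range_norm_coToeplitz (H2_shift_preimage Hf).
Qed.

Lemma shift_range : @Sshift R @` range_space a `<=` range_space a.
Proof.
move=> _ [_ [f Hf <-] <-]; exists (shift_preimage f).
  exact: H2_shift_preimage.
exact: coToeplitz_shift.
Qed.

Lemma op_norm_shift : op_norm (range_space a) (range_norm a) (@Sshift R) =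
  ((modc a0)^-1 * Num.sqrt (sqnorm (cutoff a)))%:E.
Proof.
have [b [Hb caE]] := backward_shift Hca.
have ca0 : cutoff a 0 = a0 by rewrite cutoff_in// /in_disk modc0.
have sa : sqnorm (cutoff a) = sqnorm b + modc a0 ^+ 2.
  by rewrite {1}caE sqnorm_shiftD// ca0.
have m0 : 0 < modc a0 by rewrite lt_neqAle eq_sym modc_eq0 a0_neq0 modc_ge0.
(* Here [b] is (a - a(0)) / z: being orthogonal to constants, z f pairs with [a] as it does with z
   b. *)
have ipa f : H2 f -> ip (Sshift f) (cutoff a) = ip f b.
  move=> Hf; have HS := H2_shift Hf; have H0 := H2_monomial R 0.
  rewrite {1}caE (ipDr (H2_shift Hb) (H2Z (cutoff a 0) H0) HS).
  by rewrite (ipZr _ H0 HS) ip_shift_e0// mulr0 addr0 ip_shift.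
(* By orthogonality |a|^2 = |b|^2 + |a(0)|^2; in the form 1 + |b|^2 / |a(0)|^2 the square can be
   compared with the norm of [shift_preimage f]. *)
have KE : (modc a0)^-1 * Num.sqrt (sqnorm (cutoff a)) =
    Num.sqrt (1 + sqnorm b / modc a0 ^+ 2).
  rewrite -[X in X * _]ger0_norm ?invr_ge0 ?modc_ge0// -sqrtr_sqr -sqrtrM ?sqr_ge0//.
  by congr Num.sqrt; rewrite sa; field; rewrite gt_eqF.
rewrite KE; apply/eqP; rewrite eq_le; apply/andP; split.
  apply: ge_ereal_sup => _ [_ [[f Hf <-] Nf] <-].
  rewrite lee_fin range_norm_shift// normH2E ler_wsqrtr//.
  rewrite sqnorm_shift_preimage// ipa//.
  have f1 : sqnorm f <= 1.
    move: Nf; rewrite range_norm_coToeplitz// normH2E => Nf.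
    by rewrite -(sqr_sqrtr (sqnorm_ge0 f)) exprn_ile1// sqrtr_ge0.
  apply: lerD => //; rewrite ler_pM2r ?invr_gt0 ?exprn_gt0//.
  apply: le_trans (ip_cauchy_schwarz Hf Hb) _.
  by rewrite ler_piMl// sqnorm_ge0.
have [f [Hf [f1 fb]]] : exists f, H2 f /\ sqnorm f = 1 /\ modc (ip f b) ^+ 2 >= sqnorm b.
  (* If [b] has norm 0, so that [a] is constant on the disk, any unit vector will do; otherwise [b]
     is normalised. *)
  have [b0|b0] := eqVneq (sqnorm b) 0.
    exists e0; split; first exact: H2_monomial.
    split; last by rewrite b0 sqr_ge0.
    by apply: complexI; rewrite -ipxx ip_e0e0.
  have nb : 0 < sqnorm b by rewrite lt_neqAle eq_sym b0 sqnorm_ge0.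
  pose s := Num.sqrt (sqnorm b).
  have s0 : 0 < s by rewrite sqrtr_gt0.
  have sE : s ^+ 2 = sqnorm b by rewrite sqr_sqrtr// ltW.
  pose k : C := (s^-1)%:C.
  have kk : k^* = k by rewrite /k conj_Creal//; apply/complex_realP; exists s^-1.
  have Hf := H2Z k Hb.
  exists (fun z => k * b z); split; first exact: Hf.
  split.
    apply: complexI; rewrite -ipxx (ipZl k Hb Hf) (ipZr k Hb Hb) ipxx kk -sE.
    by rewrite /k -!rmorphM /=; congr (_%:C); field; rewrite gt_eqF.
  rewrite (ipZl k Hb Hb) ipxx /k modcM !modc_real exprMn !real_normK ?num_real//.
  rewrite -sE le_eqVlt; apply/orP; left; apply/eqP; field.
  by rewrite gt_eqF.
apply: (@le_trans _ _ (range_norm a (Sshift (T f)))%:E).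
  rewrite lee_fin range_norm_shift// normH2E ler_wsqrtr//.
  rewrite sqnorm_shift_preimage// ipa// f1 lerD2l.
  by rewrite ler_pM2r ?invr_gt0 ?exprn_gt0.
apply: ereal_sup_ubound; exists (T f) => //; split; first by exists f.
by rewrite range_norm_coToeplitz// normH2E f1 sqrtr1.
Qed.

Lemma sqnorm_cutoff : sqnorm (cutoff a) = circle_mean (fun t => modc (bv a t) ^+ 2).
Proof.
have [ra _] := radial_bv_bounded an_a aA.
apply: circle_mean_ae; move: ra; apply: filterS => t rt Dt.
have h : radial (cutoff a) t (bv a t).
  apply: cvgC_near_eq (rt Dt); move: (near_in_disk t); apply: filterS => r r1.
  by rewrite cutoff_in.
by rewrite (bv_radial h).
Qed.

End ShiftNorm.

Theorem theorem1p6 (R : realType) (a : R[i] -> R[i]) :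
  Hinfty a -> outer a ->
  @Sshift R @` range_space a `<=` range_space a /\
  op_norm (range_space a) (range_norm a) (@Sshift R) =
    ((Normc.normc (a 0))^-1 *
     Num.sqrt ((pi *+ 2)^-1 *
       Rintegral lebesgue_measure `[0, pi *+ 2]
         (fun t => Normc.normc (bv a t) ^+ 2)))%:E.
Proof.
move=> Ha out_a; split; first exact: shift_range.
by rewrite (op_norm_shift Ha out_a) (sqnorm_cutoff Ha).
Qed.
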